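(* Let $\mathfrak g=\mathfrak{sl}_4(\mathbb C)$ with distinguished simple root $\alpha_2$, over the ground field $\mathbb C(q^{1/4})$. The algebras $\mathbb C[\mathfrak g_{-1}]_q$, $\mathbb C[\mathfrak g_{-1}]_q^{\mathrm I}$ and $\mathbb C[\mathfrak g_{-1}]_q^{\mathrm{II}}$ are isomorphic to each other as $U_q\mathfrak g_0$-module algebras.
   Context: The ground field is $\mathbb C(q^{1/4})$. $U_q\mathfrak g$, $\mathfrak g=\mathfrak{sl}_4$, is the Drinfeld–Jimbo Hopf algebra with generators $E_i,F_i,K_i^{\pm1}$, $i=1,2,3$: $K_iK_j=K_jK_i$, $K_iE_j=q^{a_{ij}}E_jK_i$, $K_iF_j=q^{-a_{ij}}F_jK_i$, $E_iF_j-F_jE_i=\delta_{ij}(K_i-K_i^{-1})/(q-q^{-1})$, quantum Serre relations ($(a_{ij})$ the Cartan matrix), $\Delta(E_i)=E_i\otimes1+K_i\otimes E_i$, $\Delta(F_i)=F_i\otimes K_i^{-1}+1\otimes F_i$, $\Delta(K_i)=K_i\otimes K_i$, $S(E_i)=-K_i^{-1}E_i$, $S(F_i)=-F_iK_i$, $S(K_i)=K_i^{-1}$, $\varepsilon(E_i)=\varepsilon(F_i)=0$, $\varepsilon(K_i)=1$. Write $\Delta(x)=x_{(1)}\otimes x_{(2)}$. The adjoint action is $\mathrm{ad}\,x(y)=x_{(1)}\,y\,S(x_{(2)})$; it makes $U_q\mathfrak g$ a $U_q\mathfrak g$-module algebra (i.e. multiplication is a module morphism and $1$ is invariant). $U_q^+$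 is the subalgebra generated by $E_1,E_2,E_3$; $U_q\mathfrak g_0$ is the Hopf subalgebra generated by $K_i^{\pm1}$ ($i=1,2,3$), $E_j,F_j$ ($j=1,3$). *$\mathbb C[\mathfrak g_{-1}]_q$.* Let $V(0)$ be the $U_q\mathfrak g$-module with generator $v(0)$ and relations $E_iv(0)=0$, $K_iv(0)=v(0)$ ($i=1,2,3$), $F_iv(0)=0$ ($i\ne2$). Let $H_i$ be defined on weight vectors by $K_i=q^{H_i}$, $H_0=H_1+2H_2+H_3$, $V(0)_k=\{v: H_0v=2kv\}$; then $V(0)=\bigoplus_{-k\in\mathbb Z_+}V(0)_k$ with finite dimensional summands. As a $U_q\mathfrak g$-module, $\mathbb C[\mathfrak g_{-1}]_q=\bigoplus_{-k\in\mathbb Z_+}(V(0)_k)^*$ (graded dual, $\langle v,\xi f\rangle=\langle S(\xi)v,f\rangle$). Equip $V(0)\otimes V(0)$ with the action $\xi(v_1\otimes v_2)=\xi_{(2)}v_1\otimes\xi_{(1)}v_2$. The maps $v(0)\mapsto v(0)\otimes v(0)$, $v(0)\mapsto1$ extend to $U_q\mathfrak g$-module morphisms $\Delta_-:V(0)\to V(0)\otimes V(0)$, $\varepsilon_-:V(0)\to\mathbb C(q^{1/4})$, making $V(0)$ a coassociative counital coalgebra; the dual maps $m=(\Delta_-)^*$, $(\varepsilon_-)^*$ make $\mathbb C[\mathfrak g_{-1}]_q$ an associative unital $U_q\mathfrak g$-module algebra, in particular a $U_q\mathfrak g_0$-module algebra. *$\mathbb C[\mathfrak g_{-1}]_q^{\mathrm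 I}$* is the minimal (unital) subalgebra of $U_q\mathfrak g$ containing the subspace $\mathrm{ad}\,U_q\mathfrak g_0(E_2)$; it is a $U_q\mathfrak g_0$-module algebra with respect to the adjoint action. *$\mathbb C[\mathfrak g_{-1}]_q^{\mathrm{II}}=U_q^+\cap T_{w_0'}^{-1}(U_q^+)$*, a subalgebra of $U_q\mathfrak g$ which is a $U_q\mathfrak g_0$-module algebra with respect to the adjoint action. Here $T_{w_0'}=T_1T_3$ and $T_i$ are the Lusztig automorphisms of $U_q\mathfrak g$: $T_i(K_j)=K_jK_i^{-a_{ij}}$, $T_i(E_i)=-F_iK_i$, $T_i(E_j)=(-\mathrm{ad}\,E_i)^{-a_{ij}}(E_j)$ for $i\ne j$, and $T_i\circ k=k\circ T_i$, where $k$ is the conjugate linear antiautomorphism with $k(E_i)=F_i$, $k(F_i)=E_i$, $k(K_i)=K_i^{-1}$, $k(q^{1/4})=q^{-1/4}$.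
   Formalization: The algebra C[g_{-1}]_q^II is taken to be U_q^+ ∩ T_{w_0'}(U_q^+) instead of U_q^+ ∩ T_{w_0'}^{-1}(U_q^+): with the stated T_i the latter contains E_2 but not ad E_1(E_2), so it carries no adjoint U_q g_0-action. *)

(* Defs.v *)
From HB Require Import structures.
From mathcomp Require Import all_boot all_order all_algebra.
From mathcomp Require Import generic_quotient fraction sesquilinear complex.
From mathcomp Require Import boolp classical_sets functions reals.

Set Implicit Arguments.
Unset Strict Implicit.
Unset Printing Implicit Defensive.

Import GRing.Theory.
Local Open Scope ring_scope.
Local Open Scope quotient_scope.

Section Tensor.
Variables (F : fieldType) (V W : lmodType F).

(* An element of V (x) W is a finite sum of pure tensors, written as the list
   of its terms; two lists are identified when every bilinear map out of V x W
   takes the same value on them. *)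
Definition tensor_pre := seq (V * W).
HB.instance Definition _ := gen_eqMixin tensor_pre.
HB.instance Definition _ := gen_choiceMixin tensor_pre.

Definition tensor_sum (X : lmodType F) (b : V -> W -> X) (s : tensor_pre) : X :=
  \sum_(p <- (s : seq (V * W))) b p.1 p.2.

Definition tensor_rel (s t : tensor_pre) : bool :=
  `[< forall (X : lmodType F) (b : V -> W -> X),
        bilinear_for *:%R *:%R b -> tensor_sum b s = tensor_sum b t >].

Lemma tensor_rel_refl : reflexive tensor_rel.
Proof. by move=> s; apply/asboolP. Qed.

Lemma tensor_rel_sym : symmetric tensor_rel.
Proof.
by move=> s t; apply: asbool_equiv_eq; split=> h X b bb; rewrite h.
Qed.

Lemma tensor_rel_trans : transitive tensor_rel.
Proof.
move=> t s u /asboolP st /asboolP tu; apply/asboolP => X b bb.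
by rewrite st // tu.
Qed.

Canonical tensor_equiv :=
  EquivRel tensor_rel tensor_rel_refl tensor_rel_sym tensor_rel_trans.

Definition tensor := {eq_quot tensor_rel}.
HB.instance Definition _ : EqQuotient _ tensor_rel tensor :=
  EqQuotient.on tensor.
HB.instance Definition _ := Choice.on tensor.

Definition tens (v : V) (w : W) : tensor := \pi_tensor [:: (v, w)].

(* The linear map out of the tensor product induced by the bilinear map b. *)
Definition tlift (X : lmodType F) (b : V -> W -> X) (x : tensor) : X :=
  tensor_sum b (repr x).

Lemma tlift_pi (X : lmodType F) (b : V -> W -> X) (s : tensor_pre) :
  bilinear_for *:%R *:%R b -> tlift b (\pi_tensor s) = tensor_sum b s.
Proof.
move=> bb; have : repr (\pi_tensor s) = s %[mod tensor] by rewrite reprK.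
by move=> /eqmodP /asboolP; apply.
Qed.

Lemma tensorP (x y : tensor) :
  (forall (X : lmodType F) (b : V -> W -> X),
     bilinear_for *:%R *:%R b -> tlift b x = tlift b y) -> x = y.
Proof.
move=> h; rewrite -[x]reprK -[y]reprK; apply/eqmodP/asboolP => X b bb.
exact: h.
Qed.

Definition tensor_add (x y : tensor) : tensor :=
  \pi_tensor ((repr x : seq (V * W)) ++ (repr y : seq (V * W))).
Definition tensor_scale (c : F) (x : tensor) : tensor :=
  \pi_tensor [seq (c *: p.1, p.2) | p <- (repr x : seq (V * W))].
Definition tensor_zero : tensor := \pi_tensor [::].
Definition tensor_opp (x : tensor) : tensor := tensor_scale (-1) x.

Section Lift.
Variables (X : lmodType F) (b : V -> W -> X).
Hypothesis bb : bilinear_for *:%R *:%R b.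

Lemma tlift_add x y : tlift b (tensor_add x y) = tlift b x + tlift b y.
Proof. by rewrite tlift_pi // /tensor_sum big_cat. Qed.

Lemma bil_scale c v w : b (c *: v) w = c *: b v w.
Proof.
have [/(_ w) /= h _] := bb.
by have h0 : b 0 w = 0; [have := h (-1) 0 0; rewrite scaler0 addr0 scaleN1r addNr
  | have := h c v 0; rewrite h0 !addr0].
Qed.

Lemma tlift_scale c x : tlift b (tensor_scale c x) = c *: tlift b x.
Proof.
rewrite tlift_pi // /tlift /tensor_sum big_map scaler_sumr.
by apply: eq_bigr => p _; rewrite bil_scale.
Qed.

Lemma tlift_zero : tlift b tensor_zero = 0.
Proof. by rewrite tlift_pi // /tensor_sum big_nil. Qed.

Lemma tlift_tens v w : tlift b (tens v w) = b v w.
Proof. by rewrite tlift_pi // /tensor_sum big_seq1. Qed.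
End Lift.

Lemma tensor_addA : associative tensor_add.
Proof. by move=> x y z; apply: tensorP => X b bb; rewrite !tlift_add // addrA. Qed.
Lemma tensor_addC : commutative tensor_add.
Proof. by move=> x y; apply: tensorP => X b bb; rewrite !tlift_add // addrC. Qed.
Lemma tensor_add0 : left_id tensor_zero tensor_add.
Proof.
by move=> x; apply: tensorP => X b bb; rewrite tlift_add // tlift_zero // add0r.
Qed.
Lemma tensor_addN : left_inverse tensor_zero tensor_opp tensor_add.
Proof.
move=> x; apply: tensorP => X b bb.
by rewrite tlift_add // tlift_scale // tlift_zero // scaleN1r addNr.
Qed.
HB.instance Definition _ := GRing.isZmodule.Build tensor
  tensor_addA tensor_addC tensor_add0 tensor_addN.

Lemma tensor_scaleA c d (x : tensor) :
  tensor_scale c (tensor_scale d x) = tensor_scale (c * d) x.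
Proof. by apply: tensorP => X b bb; rewrite !tlift_scale // scalerA. Qed.
Lemma tensor_scale1 : left_id 1 tensor_scale.
Proof. by move=> x; apply: tensorP => X b bb; rewrite tlift_scale // scale1r. Qed.
Lemma tensor_scaleDr : right_distributive tensor_scale +%R.
Proof.
move=> c x y; apply: tensorP => X b bb.
by rewrite tlift_scale // !tlift_add // !tlift_scale // scalerDr.
Qed.
Lemma tensor_scaleDl (x : tensor) : {morph tensor_scale^~ x : c d / c + d}.
Proof.
move=> c d; apply: tensorP => X b bb.
by rewrite tlift_add // !tlift_scale // scalerDl.
Qed.
HB.instance Definition _ := GRing.Zmodule_isLmodule.Build F tensor
  tensor_scaleA tensor_scale1 tensor_scaleDr tensor_scaleDl.

End Tensor.

Section Generated.
Local Open Scope classical_set_scope.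
Variables (F : fieldType) (A : lalgType F).

Definition is_subalg (S : set A) : Prop :=
  [/\ S 1, forall (c : F) x y, S x -> S y -> S (c *: x + y)
    & forall x y, S x -> S y -> S (x * y)].

Definition subalg_gen (G : set A) : set A := smallest is_subalg G.

Definition is_lideal (J : set A) : Prop :=
  [/\ J 0, forall x y, J x -> J y -> J (x + y) & forall a x, J x -> J (a * x)].

Definition lideal_gen (G : set A) : set A := smallest is_lideal G.

Lemma lideal_gen_is_lideal (G : set A) : is_lideal (lideal_gen G).
Proof.
split=> [J [[] //]|x y Jx Jy J JG|a x Jx J JG]; have [[J0 JD JM] _] := JG.
  by apply: JD; [apply: Jx|apply: Jy].
by apply: JM; apply: Jx.
Qed.

End Generated.

Section LQuot.
Variables (F : fieldType) (A : algType F) (G : set A).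
Let J := lideal_gen G.

Definition lquot_rel (x y : A) : bool := `[< J (x - y) >].

Let J0 : J 0. Proof. by have [] := lideal_gen_is_lideal G. Qed.
Let JD x y : J x -> J y -> J (x + y).
Proof. by have [_ h _] := lideal_gen_is_lideal G; apply: h. Qed.
Let JM a x : J x -> J (a * x).
Proof. by have [_ _ h] := lideal_gen_is_lideal G; apply: h. Qed.
Let JN x : J x -> J (- x).
Proof. by rewrite -mulN1r; apply: JM. Qed.

Lemma lquot_rel_refl : reflexive lquot_rel.
Proof. by move=> x; apply/asboolP; rewrite subrr. Qed.
Lemma lquot_rel_sym : symmetric lquot_rel.
Proof.
by move=> x y; apply: asbool_equiv_eq; split=> /JN; rewrite opprB.
Qed.
Lemma lquot_rel_trans : transitive lquot_rel.
Proof.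
move=> y x z /asboolP xy /asboolP yz; apply/asboolP.
by have := JD xy yz; rewrite addrA subrK.
Qed.
Canonical lquot_equiv :=
  EquivRel lquot_rel lquot_rel_refl lquot_rel_sym lquot_rel_trans.

Definition lquot := {eq_quot lquot_rel}.
HB.instance Definition _ : EqQuotient _ lquot_rel lquot := EqQuotient.on lquot.
HB.instance Definition _ := Choice.on lquot.

Lemma lquotP x y : J (x - y) <-> \pi_lquot x = \pi_lquot y.
Proof.
by split=> [h|/eqmodP/asboolP //]; apply/eqmodP/asboolP.
Qed.

Lemma lquot_repr x : J (repr (\pi_lquot x) - x).
Proof. by apply/lquotP; rewrite reprK. Qed.

Definition lquot_add (v w : lquot) : lquot := \pi_lquot (repr v + repr w).
Definition lquot_act (a : A) (v : lquot) : lquot := \pi_lquot (a * repr v).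
Definition lquot_zero : lquot := \pi_lquot 0.
Definition lquot_scale (c : F) (v : lquot) : lquot := lquot_act c%:A v.
Definition lquot_opp (v : lquot) : lquot := lquot_act (-1) v.

Lemma lquot_addE x y : lquot_add (\pi x) (\pi y) = \pi_lquot (x + y).
Proof.
apply/lquotP; rewrite opprD addrACA.
by apply: JD; apply: lquot_repr.
Qed.
Lemma lquot_actE a x : lquot_act a (\pi x) = \pi_lquot (a * x).
Proof. by apply/lquotP; rewrite -mulrBr; apply: JM; apply: lquot_repr. Qed.

Lemma lquot_addA : associative lquot_add.
Proof. by elim/quotW=> x; elim/quotW=> y; elim/quotW=> z; rewrite !lquot_addE addrA. Qed.
Lemma lquot_addC : commutative lquot_add.
Proof. by elim/quotW=> x; elim/quotW=> y; rewrite !lquot_addE addrC. Qed.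
Lemma lquot_add0 : left_id lquot_zero lquot_add.
Proof. by elim/quotW=> x; rewrite lquot_addE add0r. Qed.
Lemma lquot_addN : left_inverse lquot_zero lquot_opp lquot_add.
Proof. by elim/quotW=> x; rewrite /lquot_opp lquot_actE lquot_addE mulN1r addNr. Qed.
HB.instance Definition _ := GRing.isZmodule.Build lquot
  lquot_addA lquot_addC lquot_add0 lquot_addN.

Lemma lquot_piD x y : \pi_lquot x + \pi_lquot y = \pi_lquot (x + y).
Proof. exact: lquot_addE. Qed.

Lemma lquot_scaleA c d (v : lquot) :
  lquot_scale c (lquot_scale d v) = lquot_scale (c * d) v.
Proof.
elim/quotW: v => x; rewrite /lquot_scale !lquot_actE.
by rewrite !mulr_algl scalerA.
Qed.
Lemma lquot_scale1 : left_id 1 lquot_scale.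
Proof. by elim/quotW=> x; rewrite /lquot_scale lquot_actE scale1r mul1r. Qed.
Lemma lquot_scaleDr : right_distributive lquot_scale +%R.
Proof.
move=> c; elim/quotW=> x; elim/quotW=> y.
by rewrite /lquot_scale lquot_piD !lquot_actE lquot_piD mulrDr.
Qed.
Lemma lquot_scaleDl (v : lquot) : {morph lquot_scale^~ v : c d / c + d}.
Proof.
elim/quotW: v => x c d; rewrite /lquot_scale !lquot_actE lquot_piD.
by rewrite scalerDl mulrDl.
Qed.
HB.instance Definition _ := GRing.Zmodule_isLmodule.Build F lquot
  lquot_scaleA lquot_scale1 lquot_scaleDr lquot_scaleDl.

End LQuot.

(* The nodes 1, 2, 3 of the Dynkin diagram are the elements 0, 1, 2 of 'I_3. *)
Definition node1 : 'I_3 := @Ordinal 3 0 isT.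
Definition node2 : 'I_3 := @Ordinal 3 1 isT.
Definition node3 : 'I_3 := @Ordinal 3 2 isT.

Definition cartan (i j : 'I_3) : int :=
  if i == j then 2 else if (i.+1 == j) || (j.+1 == i) then -1 else 0.

Variant ugen : Type := GE of 'I_3 | GF of 'I_3 | GK of 'I_3 | GKinv of 'I_3.

Inductive uterm (F : Type) : Type :=
| TGen of ugen
| TZero
| TOne
| TAdd of uterm F & uterm F
| TMul of uterm F & uterm F
| TScale of F & uterm F.

Arguments TGen {F}.
Arguments TZero {F}.
Arguments TOne {F}.

Declare Scope uterm_scope.
Delimit Scope uterm_scope with T.
Bind Scope uterm_scope with uterm.
Notation "x + y" := (TAdd x y) : uterm_scope.
Notation "x * y" := (TMul x y) : uterm_scope.
Notation "c *: x" := (TScale c%R x) : uterm_scope.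
Notation "0" := TZero : uterm_scope.
Notation "1" := TOne : uterm_scope.

(* Value of an expression when the generators are given the values g, the unit
   and the product the values one and mul, and the scalars are twisted by sg.
   With sg = id and mul = *%R this is the usual evaluation; the opposite
   product gives antihomomorphisms, and a nontrivial sg semilinear maps. *)
Fixpoint teval (F : fieldType) (A : lmodType F) (sg : F -> F)
    (one : A) (mul : A -> A -> A) (g : ugen -> A) (t : uterm F) : A :=
  match t with
  | TGen x => g x
  | TZero => 0
  | TOne => one
  | TAdd t1 t2 => teval sg one mul g t1 + teval sg one mul g t2
  | TMul t1 t2 => mul (teval sg one mul g t1) (teval sg one mul g t2)
  | TScale c t1 => sg c *: teval sg one mul g t1
  end.

Section Uq.
Variables (F : fieldType) (q : F).
Implicit Types t : uterm F.

Notation gE i := (TGen (GE i)).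
Notation gF i := (TGen (GF i)).
Notation gK i := (TGen (GK i)).
Notation gK' i := (TGen (GKinv i)).

Inductive urel : uterm F -> uterm F -> Prop :=
| urel_KK' i : urel (gK i * gK' i) 1
| urel_K'K i : urel (gK' i * gK i) 1
| urel_KK i j : urel (gK i * gK j) (gK j * gK i)
| urel_KE i j : urel (gK i * gE j) (q ^ cartan i j *: (gE j * gK i))
| urel_KF i j : urel (gK i * gF j) (q ^ (- cartan i j) *: (gF j * gK i))
| urel_EF i j :
    urel (gE i * gF j + (-1) *: (gF j * gE i))
         (((i == j)%:R / (q - q^-1)) *: (gK i + (-1) *: gK' i))
| urel_EE0 i j : cartan i j = 0 -> urel (gE i * gE j) (gE j * gE i)
| urel_FF0 i j : cartan i j = 0 -> urel (gF i * gF j) (gF j * gF i)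
| urel_EE1 i j : cartan i j = -1 ->
    urel (gE i * gE i * gE j + (- (q + q^-1)) *: (gE i * gE j * gE i)
          + gE j * gE i * gE i) 0
| urel_FF1 i j : cartan i j = -1 ->
    urel (gF i * gF i * gF j + (- (q + q^-1)) *: (gF i * gF j * gF i)
          + gF j * gF i * gF i) 0.

(* The congruence generated by urel and the axioms of associative unital
   F-algebras: its quotient is the algebra presented by urel. *)
Inductive ucong : uterm F -> uterm F -> Prop :=
| uc_rel t u : urel t u -> ucong t u
| uc_refl t : ucong t t
| uc_sym t u : ucong t u -> ucong u t
| uc_trans u t v : ucong t u -> ucong u v -> ucong t v
| uc_add t t' u u' : ucong t t' -> ucong u u' -> ucong (t + u) (t' + u')
| uc_mul t t' u u' : ucong t t' -> ucong u u' -> ucong (t * u) (t' * u')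
| uc_scale c t t' : ucong t t' -> ucong (c *: t) (c *: t')
| uc_addA t u v : ucong (t + (u + v)) (t + u + v)
| uc_addC t u : ucong (t + u) (u + t)
| uc_add0 t : ucong (0 + t) t
| uc_addN t : ucong ((-1) *: t + t) 0
| uc_mulA t u v : ucong (t * (u * v)) (t * u * v)
| uc_mul1l t : ucong (1 * t) t
| uc_mul1r t : ucong (t * 1) t
| uc_mulDl t u v : ucong ((t + u) * v) (t * v + u * v)
| uc_mulDr t u v : ucong (t * (u + v)) (t * u + t * v)
| uc_scaleA c d t : ucong (c *: (d *: t)) ((c * d) *: t)
| uc_scale1 t : ucong (1 *: t) t
| uc_scaleDr c t u : ucong (c *: (t + u)) (c *: t + c *: u)
| uc_scaleDl c d t : ucong ((c + d) *: t) (c *: t + d *: t)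
| uc_scaleAl c t u : ucong (c *: (t * u)) ((c *: t) * u)
| uc_scaleAr c t u : ucong (c *: (t * u)) (t * (c *: u)).

(* Universal property: an evaluation of the expressions by a semilinear,
   bilinear, associative and unital set of operations which satisfies the
   defining relations factors through the presented algebra. *)
Lemma teval_ucong (A : lmodType F) (sg : {rmorphism F -> F})
    (one : A) (mul : A -> A -> A) (g : ugen -> A) :
    bilinear_for *:%R *:%R mul -> associative mul ->
    left_id one mul -> right_id one mul ->
    (forall t u, urel t u -> teval sg one mul g t = teval sg one mul g u) ->
  forall t u, ucong t u -> teval sg one mul g t = teval sg one mul g u.
Proof.
move=> bm mA m1 m1r hrel t u; elim=> {t u} //=; try by move=> *; congruence.
- by move=> *; rewrite addrA.
- by move=> *; rewrite addrC.
- by move=> *; rewrite add0r.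
- by move=> t; rewrite rmorphN1 scaleN1r addNr.
- by move=> t u v; have := bm.1 (teval sg one mul g v) 1
    (teval sg one mul g t) (teval sg one mul g u); rewrite /= !scale1r.
- by move=> t u v; have := bm.2 (teval sg one mul g t) 1
    (teval sg one mul g u) (teval sg one mul g v); rewrite /= !scale1r.
- by move=> c d t; rewrite rmorphM scalerA.
- by move=> t; rewrite rmorph1 scale1r.
- by move=> c t u; rewrite scalerDr.
- by move=> c d t; rewrite rmorphD scalerDl.
- by move=> c t u; rewrite (bil_scale bm).
- move=> c t u; have bm' : bilinear_for *:%R *:%R (fun x y => mul y x).
    by split=> x; [apply: bm.2|apply: bm.1].
  by have := bil_scale bm' (sg c) (teval sg one mul g u) (teval sg one mul g t).
Qed.

HB.instance Definition _ := gen_eqMixin (uterm F).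
HB.instance Definition _ := gen_choiceMixin (uterm F).

Definition ucongb t u : bool := `[< ucong t u >].
Lemma ucongb_refl : reflexive ucongb.
Proof. by move=> t; apply/asboolP; apply: uc_refl. Qed.
Lemma ucongb_sym : symmetric ucongb.
Proof. by move=> t u; apply: asbool_equiv_eq; split; apply: uc_sym. Qed.
Lemma ucongb_trans : transitive ucongb.
Proof.
by move=> u t v /asboolP tu /asboolP uv; apply/asboolP; apply: uc_trans tu uv.
Qed.
Canonical ucong_equiv := EquivRel ucongb ucongb_refl ucongb_sym ucongb_trans.

Definition Uq := {eq_quot ucongb}.
HB.instance Definition _ : EqQuotient _ ucongb Uq := EqQuotient.on Uq.
HB.instance Definition _ := Choice.on Uq.

Lemma UqP t u : ucong t u <-> \pi_Uq t = \pi_Uq u.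
Proof. by split=> [h|/eqmodP/asboolP //]; apply/eqmodP/asboolP. Qed.

Lemma Uq_repr t : ucong (repr (\pi_Uq t)) t.
Proof. by apply/UqP; rewrite reprK. Qed.

Definition Uq_add (x y : Uq) : Uq := \pi_Uq (repr x + repr y)%T.
Definition Uq_mul (x y : Uq) : Uq := \pi_Uq (repr x * repr y)%T.
Definition Uq_scale (c : F) (x : Uq) : Uq := \pi_Uq (c *: repr x)%T.
Definition Uq_opp (x : Uq) : Uq := Uq_scale (-1) x.

Lemma Uq_addE t u : Uq_add (\pi t) (\pi u) = \pi_Uq (t + u)%T.
Proof. by apply/UqP/uc_add; apply: Uq_repr. Qed.
Lemma Uq_mulE t u : Uq_mul (\pi t) (\pi u) = \pi_Uq (t * u)%T.
Proof. by apply/UqP/uc_mul; apply: Uq_repr. Qed.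
Lemma Uq_scaleE c t : Uq_scale c (\pi t) = \pi_Uq (c *: t)%T.
Proof. by apply/UqP/uc_scale; apply: Uq_repr. Qed.

Lemma Uq_addA : associative Uq_add.
Proof.
elim/quotW=> x; elim/quotW=> y; elim/quotW=> z; rewrite !Uq_addE.
by apply/UqP/uc_addA.
Qed.
Lemma Uq_addC : commutative Uq_add.
Proof. by elim/quotW=> x; elim/quotW=> y; rewrite !Uq_addE; apply/UqP/uc_addC. Qed.
Lemma Uq_add0 : left_id (\pi_Uq 0%T) Uq_add.
Proof. by elim/quotW=> x; rewrite Uq_addE; apply/UqP/uc_add0. Qed.
Lemma Uq_addN : left_inverse (\pi_Uq 0%T) Uq_opp Uq_add.
Proof.
by elim/quotW=> x; rewrite /Uq_opp Uq_scaleE Uq_addE; apply/UqP/uc_addN.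
Qed.
HB.instance Definition _ := GRing.isZmodule.Build Uq
  Uq_addA Uq_addC Uq_add0 Uq_addN.

Lemma Uq_piD t u : \pi_Uq t + \pi_Uq u = \pi_Uq (t + u)%T.
Proof. exact: Uq_addE. Qed.

Lemma Uq_mulA : associative Uq_mul.
Proof.
elim/quotW=> x; elim/quotW=> y; elim/quotW=> z; rewrite !Uq_mulE.
by apply/UqP/uc_mulA.
Qed.
Lemma Uq_mul1l : left_id (\pi_Uq 1%T) Uq_mul.
Proof. by elim/quotW=> x; rewrite Uq_mulE; apply/UqP/uc_mul1l. Qed.
Lemma Uq_mul1r : right_id (\pi_Uq 1%T) Uq_mul.
Proof. by elim/quotW=> x; rewrite Uq_mulE; apply/UqP/uc_mul1r. Qed.
Lemma Uq_mulDl : left_distributive Uq_mul +%R.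
Proof.
elim/quotW=> x; elim/quotW=> y; elim/quotW=> z.
by rewrite Uq_piD !Uq_mulE Uq_piD; apply/UqP/uc_mulDl.
Qed.
Lemma Uq_mulDr : right_distributive Uq_mul +%R.
Proof.
elim/quotW=> x; elim/quotW=> y; elim/quotW=> z.
by rewrite Uq_piD !Uq_mulE Uq_piD; apply/UqP/uc_mulDr.
Qed.

Definition counit_gen (x : ugen) : F^o :=
  match x with GE _ | GF _ => 0 | GK _ | GKinv _ => 1 end.

Lemma counit_gen_ucong t u : ucong t u ->
  teval id (1 : F^o) *%R counit_gen t = teval id (1 : F^o) *%R counit_gen u.
Proof.
apply: (@teval_ucong F^o idfun) => [|||| {}t {}u].
- split=> x c y z /=; first by rewrite mulrDl -scalerAl.
  by rewrite mulrDr -scalerAr.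
- exact: mulrA.
- exact: mul1r.
- exact: mulr1.
by case=> *; rewrite /= ?(mul0r, mulr0, mulr1, scaler0, addr0, add0r) //
  scaleN1r subrr scaler0.
Qed.

Lemma Uq_one_neq0 : \pi_Uq 1%T != 0 :> Uq.
Proof.
apply/eqP => /UqP /counit_gen_ucong /=.
by apply/eqP; apply: oner_neq0.
Qed.

HB.instance Definition _ := GRing.Zmodule_isNzRing.Build Uq
  Uq_mulA Uq_mul1l Uq_mul1r Uq_mulDl Uq_mulDr Uq_one_neq0.

Lemma Uq_scaleA c d (x : Uq) : Uq_scale c (Uq_scale d x) = Uq_scale (c * d) x.
Proof. by elim/quotW: x => x; rewrite !Uq_scaleE; apply/UqP/uc_scaleA. Qed.
Lemma Uq_scale1 : left_id 1 Uq_scale.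
Proof. by elim/quotW=> x; rewrite Uq_scaleE; apply/UqP/uc_scale1. Qed.
Lemma Uq_scaleDr : right_distributive Uq_scale +%R.
Proof.
move=> c; elim/quotW=> x; elim/quotW=> y.
by rewrite Uq_piD !Uq_scaleE Uq_piD; apply/UqP/uc_scaleDr.
Qed.
Lemma Uq_scaleDl (x : Uq) : {morph Uq_scale^~ x : c d / c + d}.
Proof.
elim/quotW: x => x c d.
by rewrite !Uq_scaleE Uq_piD; apply/UqP/uc_scaleDl.
Qed.
HB.instance Definition _ := GRing.Zmodule_isLmodule.Build F Uq
  Uq_scaleA Uq_scale1 Uq_scaleDr Uq_scaleDl.

Lemma Uq_scaleAl (c : F) (x y : Uq) : c *: (x * y) = (c *: x) * y.
Proof.
elim/quotW: x => x; elim/quotW: y => y.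
by rewrite /GRing.scale /GRing.mul /= !(Uq_scaleE, Uq_mulE); apply/UqP/uc_scaleAl.
Qed.
HB.instance Definition _ := GRing.Lmodule_isLalgebra.Build F Uq Uq_scaleAl.

Lemma Uq_scaleAr (c : F) (x y : Uq) : c *: (x * y) = x * (c *: y).
Proof.
elim/quotW: x => x; elim/quotW: y => y.
by rewrite /GRing.scale /GRing.mul /= !(Uq_scaleE, Uq_mulE); apply/UqP/uc_scaleAr.
Qed.
HB.instance Definition _ := GRing.Lalgebra_isAlgebra.Build F Uq Uq_scaleAr.

Definition ugenE (x : ugen) : Uq := \pi_Uq (TGen x).
Definition uE i := ugenE (GE i).
Definition uF i := ugenE (GF i).
Definition uK i := ugenE (GK i).
Definition uK' i := ugenE (GKinv i).

Definition uKpow (i : 'I_3) (n : int) : Uq :=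
  match n with Posz m => uK i ^+ m | Negz m => uK' i ^+ m.+1 end.

(* A map on Uq given by its values on generators; [uext] is well defined, that
   is independent of the chosen expression, as soon as [g] satisfies the
   defining relations (teval_ucong). *)
Definition uext (A : lmodType F) (sg : F -> F) (one : A) (mul : A -> A -> A)
    (g : ugen -> A) (x : Uq) : A :=
  teval sg one mul g (repr x).

Lemma uextE (A : lmodType F) (sg : {rmorphism F -> F})
    (one : A) (mul : A -> A -> A) (g : ugen -> A) :
    bilinear_for *:%R *:%R mul -> associative mul ->
    left_id one mul -> right_id one mul ->
    (forall t u, urel t u -> teval sg one mul g t = teval sg one mul g u) ->
  forall t, uext sg one mul g (\pi_Uq t) = teval sg one mul g t.
Proof. by move=> *; apply: teval_ucong => //; apply: Uq_repr. Qed.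

Notation U2 := (tensor Uq Uq).

Definition tmul (x y : U2) : U2 :=
  tlift (fun a b => tlift (fun a' b' => tens (a * a') (b * b')) y) x.

Definition comult_gen (x : ugen) : U2 :=
  match x with
  | GE i => tens (uE i) 1 + tens (uK i) (uE i)
  | GF i => tens (uF i) (uK' i) + tens 1 (uF i)
  | GK i => tens (uK i) (uK i)
  | GKinv i => tens (uK' i) (uK' i)
  end.

Definition comult : Uq -> U2 := uext id (tens 1 1) tmul comult_gen.

Definition antipode_gen (x : ugen) : Uq :=
  match x with
  | GE i => - (uK' i * uE i)
  | GF i => - (uF i * uK i)
  | GK i => uK' i
  | GKinv i => uK i
  end.

Definition antipode : Uq -> Uq := uext id 1 (fun x y => y * x) antipode_gen.

Definition counit : Uq -> F^o := uext id 1 *%R counit_gen.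

Definition ad (x y : Uq) : Uq := tlift (fun a b => a * y * antipode b) (comult x).

Local Open Scope classical_set_scope.

Definition Uplus : set Uq := subalg_gen (range uE).

(* This subalgebra is stable under the comultiplication and the antipode. *)
Definition U0 : set Uq :=
  subalg_gen (range uK `|` range uK' `|` (uE @` [set node1; node3])
              `|` (uF @` [set node1; node3])).

Definition V0_relators : set Uq :=
  [set x | (exists i, x = uE i) \/ (exists i, x = uK i - 1)
           \/ (exists2 i, i != node2 & x = uF i)].

Definition V0 := lquot V0_relators.
HB.instance Definition _ := GRing.Lmodule.on V0.

Definition V0act (x : Uq) (v : V0) : V0 := lquot_act x v.
Definition v0 : V0 := \pi_(lquot V0_relators) 1.

(* Some element x of Uq such that v = x v0. *)
Definition V0coef (v : V0) : Uq := repr (v : lquot V0_relators).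

(* v has weight n, i.e. H_i v = n i v. *)
Definition V0_weight (n : 'I_3 -> int) (v : V0) : Prop :=
  forall i, V0act (uK i) v = q ^ n i *: v.

(* The eigenspace of H_0 = H_1 + 2 H_2 + H_3 with eigenvalue 2 k; H_0 being
   defined on weight vectors, this is the sum of the corresponding weight
   spaces. *)
Definition V0_deg (k : int) : set V0 :=
  [set v | exists2 s : seq V0, v = \sum_(w <- s) w
     & forall w, w \in s -> exists2 n : 'I_3 -> int,
         n node1 + 2 * n node2 + n node3 = 2 * k & V0_weight n w].

(* The action on V(0) (x) V(0) through the opposite comultiplication. *)
Definition V0act2 (x : Uq) (t : tensor V0 V0) : tensor V0 V0 :=
  tlift (fun a b => tlift (fun v w => tens (V0act b v) (V0act a w)) t)
        (comult x).

(* The morphisms of Uq-modules with v0 |-> v0 (x) v0 and v0 |-> 1. *)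
Definition V0comult (v : V0) : tensor V0 V0 := V0act2 (V0coef v) (tens v0 v0).
Definition V0counit (v : V0) : F^o := counit (V0coef v).

(* An algebra with an action of Uq, carried by a subspace of a vector space;
   the operations are only meaningful on that subspace. *)
Record modalg := ModAlg {
  ma_space : lmodType F;
  ma_set : set ma_space;
  ma_one : ma_space;
  ma_mul : ma_space -> ma_space -> ma_space;
  ma_act : Uq -> ma_space -> ma_space
}.
Arguments ma_set m : clear implicits.
Arguments ma_one m : clear implicits.
Arguments ma_mul m : clear implicits.
Arguments ma_act m : clear implicits.

Definition U0_modalg_iso (A B : modalg) : Prop :=
  exists phi : ma_space A -> ma_space B,
    [/\ set_bij (ma_set A) (ma_set B) phi,
        forall (c : F) x y, ma_set A x -> ma_set A y ->
          phi (c *: x + y) = c *: phi x + phi y,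
        phi (ma_one A) = ma_one B,
        forall x y, ma_set A x -> ma_set A y ->
          phi (ma_mul A x y) = ma_mul B (phi x) (phi y)
      & forall xi x, U0 xi -> ma_set A x ->
          phi (ma_act A xi x) = ma_act B xi (phi x)].

(* V(0) is the direct sum of the V(0)_{-k}, k >= 0, all finite dimensional, so
   its graded dual is the space of the linear forms which vanish on all but
   finitely many of them. *)
Definition Cg_set : set (V0 -> F^o) :=
  [set f | (forall (c : F) v w, f (c *: v + w) = c *: f v + f w) /\
     exists N : nat, forall k : nat, (N < k)%N ->
       forall v, V0_deg (- k%:Z) v -> f v = 0].

Definition Cg : modalg :=
  @ModAlg (V0 -> F^o) Cg_set V0counit
    (fun f g v => tlift (fun v1 v2 => f v1 * g v2 : F^o) (V0comult v))
    (fun xi f v => f (V0act (antipode xi) v)).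

Definition CgI : modalg :=
  @ModAlg Uq (subalg_gen [set ad xi (uE node2) | xi in U0]) 1 *%R ad.

(* [bar] is the automorphism of the ground field for which the antiautomorphism
   k is semilinear. *)
Variable bar : F -> F.

Definition kconj_gen (x : ugen) : Uq :=
  match x with
  | GE i => uF i
  | GF i => uE i
  | GK i => uK' i
  | GKinv i => uK i
  end.

Definition kconj : Uq -> Uq := uext bar 1 (fun x y => y * x) kconj_gen.

Definition lusztigE (i j : 'I_3) : Uq :=
  if i == j then - (uF i * uK i)
  else iter `|cartan i j|%N (fun y => - ad (uE i) y) (uE j).

(* The value on F_j = k(E_j) is forced by T_i k = k T_i. *)
Definition lusztig_gen (i : 'I_3) (x : ugen) : Uq :=
  match x with
  | GE j => lusztigE i j
  | GF j => kconj (lusztigE i j)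
  | GK j => uK j * uKpow i (- cartan i j)
  | GKinv j => uK' j * uKpow i (cartan i j)
  end.

Definition lusztig (i : 'I_3) : Uq -> Uq := uext id 1 *%R (lusztig_gen i).

Definition Tw0' (x : Uq) : Uq := lusztig node1 (lusztig node3 x).

(* With these T_i, the subalgebra stable under the adjoint action of U0 is
   U+ /\ T_{w0'}(U+).  The subalgebra U+ /\ T_{w0'}^-1(U+) is not stable: it
   contains E_2 but not y = ad E_1 (E_2) = E_1 E_2 - q^-1 E_2 E_1, because
   T_1(y) = q E_2 + (q - q^-1) y F_1 K_1. *)
Definition CgII : modalg :=
  @ModAlg Uq (Uplus `&` (Tw0' @` Uplus)) 1 *%R ad.

End Uq.

Section Ground.
Variable R : realType.

Definition ground : fieldType := {fraction {poly R[i]}}.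

Definition q4 : ground := tofrac 'X.
Definition qg : ground := q4 ^+ 4.

(* The field automorphism which is the complex conjugation on C and maps
   q^{1/4} to q^{-1/4}, first on C[q^{1/4}] and then on quotients. *)
Definition bar_poly (p : {poly R[i]}) : ground :=
  \sum_(n < size p) tofrac (conjc p`_n)%:P * q4 ^- n.

Definition ground_bar (x : ground) : ground :=
  let r : {ratio {poly R[i]}} := repr (x : {fraction {poly R[i]}}) in
  bar_poly \n_r / bar_poly \d_r.

End Ground.

(* Main.v *)
Require Import Defs.
From HB Require Import structures.
From mathcomp Require Import all_boot all_order all_algebra.
From mathcomp Require Import generic_quotient fraction sesquilinear complex.
From mathcomp Require Import boolp classical_sets functions reals.
From mathcomp Require Import ring zify.

Set Implicit Arguments.
Unset Strict Implicit.
Unset Printing Implicit Defensive.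

Import GRing.Theory.
Local Open Scope ring_scope.
Local Open Scope quotient_scope.

(** Write U for the quantum group, U_0 for its Levi part, Z for the subalgebra
    generated by the four vectors z_ab = ad (E_1^a E_3^b) (E_2), a, b in {0, 1}.
    These vectors span ad U_0 (E_2), because E_2 is a lowest weight vector for
    U_0 killed by ad E_1^2 and ad E_3^2 (levi_tableP). So Z is the second algebra
    (CgI_setE).

    The second and the third algebra are equal (CgI_CgII). The automorphism
    T = T_1 T_3 maps E_2 to z_11 and E_i to - F_i K_i for i = 1, 3. Its image on
    U+ contains z_11 and the F_i K_i, with which ad F_1 and ad F_3 lower z_11 to
    the other generators, hence contains Z. Conversely T(U+) lies in Z + U F_1 + U F_3, because F_i K_i
    can be moved to the right through Z. There is a linear map on U which is the
    identity on U+ and kills all U F_i (Uplus_tautological); applied to an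
    element of U+ in T(U+) it shows that this element is in Z.

    That map, and with it all that is needed of the structure of U+, is obtained
    without a basis of Poincare-Birkhoff-Witt type. The functions on words in
    the F_i that vanish on the ideal of the Serre relations carry a right action
    of U (word_act): they are the linear forms on a Verma module. So operators
    op_1, op_2, op_3 on a space which satisfy the Serre relations, with a vector
    x0, give a linear map f on U with f(1) = x0, f(E_i x) = op_i (f x) and
    f(x F_i) = 0 (induced).

    The same device gives the isomorphism with the first algebra. Let zeta_0 be
    the linear form on V(0) which is 1 on F_2 v(0) and 0 on all other words in
    the F_i applied to v(0). On forms let E_1 and E_3 act by their action and
    E_2 by the multiplication by zeta_0. These operators satisfy the Serre
    relations (psi_serre1), and the resulting map psi from U to forms is
    multiplicative and U_0-equivariant on Z (psiM, psi_ad). It is injective on Z: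
    the ordered monomials in the z_ab span Z (Zalg_span) and their images are
    independent (fmon_free), since the evaluations at suitable products of powers
    of the F_i applied to v(0) form a triangular matrix; its diagonal consists of
    products of Gaussian binomials and powers of q, nonzero as q is not a root
    of unity. It is surjective: V(0) is spanned by the vectors omega(x) v(0), x an
    ordered monomial and omega the Chevalley involution (V0_Zalg), so a form
    which vanishes below degree - N is determined by as many values as there
    are monomials of degree at most N, and the images of these monomials are as
    many independent forms of the same kind (psi_surj).

    The relations needed on the way are identities between noncommutative
    polynomials, decided by rewriting: ncheckP is the soundness of a rewriting
    procedure over Z[q, q^-1, (q - q^-1)^-1], and uq_solve runs it with the
    relations of U, the Serre relations being completed by two consequences
    (serre_zyxy, serre_zyzyx). *)

(** * Noncommutative rewriting with Laurent coefficients *)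

(** Scalars in Z[q, q^-1, (q - q^-1)^-1]: CVar is q, CInv is q^-1, CPow e is
    q^e and CDen is (q - q^-1)^-1, the only denominator in the relations of the
    quantum group. *)
Inductive ncoef : Type :=
| CInt of int | CPow of int | CVar | CInv | CDen
| CAdd of ncoef & ncoef | CMul of ncoef & ncoef | COpp of ncoef.

Inductive nterm : Type :=
| NGen of nat | NZero | NOne | NAdd of nterm & nterm | NMul of nterm & nterm
| NOpp of nterm | NScale of ncoef & nterm.

(** The triple (z, e, k) is the scalar z q^e (q - q^-1)^-k. *)
Definition cmono : Type := (int * int * nat)%type.
Definition nmono : Type := (cmono * seq nat)%type.

Definition cmono_mul (c d : cmono) : cmono :=
  (c.1.1 * d.1.1, c.1.2 + d.1.2, (c.2 + d.2)%N).

Definition cscale (c : cmono) (l : seq cmono) := [seq cmono_mul c d | d <- l].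
Definition nscale (c : cmono) (w : seq nat) (l : seq nmono) : seq nmono :=
  [seq (cmono_mul c m.1, w ++ m.2) | m <- l].

Fixpoint cnorm (c : ncoef) : seq cmono :=
  match c with
  | CInt z => [:: (z, 0 : int, 0%N)]
  | CPow e => [:: (1 : int, e, 0%N)]
  | CVar => [:: (1 : int, 1 : int, 0%N)]
  | CInv => [:: (1 : int, -1 : int, 0%N)]
  | CDen => [:: (1 : int, 0 : int, 1%N)]
  | CAdd a b => cnorm a ++ cnorm b
  | CMul a b => let nb := cnorm b in flatten [seq cscale c nb | c <- cnorm a]
  | COpp a => cscale (-1, 0, 0%N) (cnorm a)
  end.

Fixpoint nnorm (t : nterm) : seq nmono :=
  match t with
  | NGen k => [:: ((1, 0, 0%N), [:: k])]
  | NZero => [::]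
  | NOne => [:: ((1, 0, 0%N), [::])]
  | NAdd a b => nnorm a ++ nnorm b
  | NMul a b => let nb := nnorm b in
      flatten [seq nscale m.1 m.2 nb | m <- nnorm a]
  | NOpp a => nscale (-1, 0, 0%N) [::] (nnorm a)
  | NScale c a => let na := nnorm a in
      flatten [seq nscale d [::] na | d <- cnorm c]
  end.

(** Equality of words and of exponents is decided, so like monomials are
    merged and cancelled ones dropped. *)
Fixpoint ninsert (m : nmono) (l : seq nmono) : seq nmono :=
  match l with
  | [::] => if m.1.1.1 == 0 then [::] else [:: m]
  | m' :: l' =>
      if [&& m.2 == m'.2, m.1.1.2 == m'.1.1.2 & m.1.2 == m'.1.2] then
        let z := m.1.1.1 + m'.1.1.1 in
        if z == 0 then l' else ((z, m'.1.1.2, m'.1.2), m'.2) :: l'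
      else m' :: ninsert m l'
  end.

Definition ncollect (l : seq nmono) : seq nmono := foldr ninsert [::] l.

Definition nrule : Type := (seq nat * seq nmono)%type.

Definition nmatch (rules : seq nrule) (w : seq nat) : option (seq nat * nrule) :=
  foldr (fun r o => if prefix r.1 w then Some (drop (size r.1) w, r) else o)
        None rules.

(** Applies the first rule that matches at the leftmost possible position of
    the word. *)
Fixpoint nrewrite (rules : seq nrule) (w : seq nat) : option (seq nmono) :=
  match nmatch rules w with
  | Some (s, r) => Some [seq (m.1, m.2 ++ s) | m <- r.2]
  | None =>
      if w is k :: w' then
        if nrewrite rules w' is Some p then
          Some [seq (m.1, k :: m.2) | m <- p]
        else None
      else None
  end.

Definition nstep (rules : seq nrule) (l : seq nmono) : seq nmono :=
  ncollect (flatten [seq if nrewrite rules m.2 is Some p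
                         then nscale m.1 [::] p else [:: m] | m <- l]).

(** Multiplication by (q - q^-1) that leaves the exponent of the denominator
    as it is. *)
Definition nraise (l : seq nmono) : seq nmono :=
  flatten [seq [:: ((m.1.1.1, m.1.1.2 + 1, m.1.2), m.2);
                   ((- m.1.1.1, m.1.1.2 - 1, m.1.2), m.2)] | m <- l].

(** Brings all monomials to the common denominator (q - q^-1)^K and drops it;
    without this step two equal scalars could have different normal forms. *)
Definition nclear (K : nat) (l : seq nmono) : seq nmono :=
  flatten [seq [seq ((m'.1.1, 0%N), m'.2) | m' <- iter (K - m.1.2) nraise [:: m]]
          | m <- l].

Definition nzero (l : seq nmono) : bool :=
  let K := foldr maxn 0%N [seq m.1.2 | m <- l] in
  nilp (ncollect (nclear K l)).

(** An equation becomes a rewriting rule when its left side is a word with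
    coefficient 1; any other equation becomes the rule which rewrites the empty
    word to itself. *)
Definition mkrule (e : nterm * nterm) : nrule :=
  match nnorm e.1 with
  | [:: ((1, 0, 0%N), w)] => (w, nnorm e.2)
  | _ => ([::], [:: ((1, 0, 0%N), [::])])
  end.

Definition ncheck (fuel : nat) (eqs : seq (nterm * nterm)) (l r : nterm) : bool :=
  let rules := [seq mkrule e | e <- eqs] in
  nzero (iter fuel (nstep rules) (ncollect (nnorm (NAdd l (NOpp r))))).

Section Soundness.
Variables (F : fieldType) (q : F).
Hypothesis q0 : q != 0.
Hypothesis qq : q - q^-1 != 0.

Fixpoint ceval (c : ncoef) : F :=
  match c with
  | CInt z => z%:~R
  | CPow e => q ^ e
  | CVar => q
  | CInv => q^-1
  | CDen => (q - q^-1)^-1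
  | CAdd a b => ceval a + ceval b
  | CMul a b => ceval a * ceval b
  | COpp a => - ceval a
  end.

Definition cmeval (c : cmono) : F := c.1.1%:~R * q ^ c.1.2 * (q - q^-1)^-1 ^+ c.2.

Lemma cmeval_mul c d : cmeval (cmono_mul c d) = cmeval c * cmeval d.
Proof.
by rewrite /cmeval /= intrM expfzDr // exprD [RHS]mulrACA [X in _ = X * _]mulrACA.
Qed.

Lemma cnormE c : \sum_(d <- cnorm c) cmeval d = ceval c.
Proof.
elim: c => //=; rewrite ?big_seq1 /cmeval /= ?expr0 ?expr0z ?mulr1 ?mul1r ?expr1 //.
- by move=> *; rewrite ?big_seq1 /cmeval /= ?expr0z ?expr0 ?mulr1.
- by move=> *; rewrite ?big_seq1 /cmeval /= ?expr0z ?expr0 ?mul1r ?mulr1.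
- by move=> a IHa b IHb; rewrite big_cat IHa IHb.
- move=> a IHa b IHb; rewrite big_flatten big_map -IHa mulr_suml.
  apply: eq_bigr => d _; rewrite big_map -IHb mulr_sumr.
  by apply: eq_bigr => d' _; rewrite -/(cmeval _) cmeval_mul.
- move=> a IHa; rewrite big_map -IHa -sumrN.
  by apply: eq_bigr => d _; rewrite -/(cmeval _) cmeval_mul /cmeval /= expr0z mulr1 mulr1 mulN1r.
Qed.

Variables (V : lmodType F) (op : nat -> V -> V).
Hypothesis op_lin : forall k c v w, op k (c *: v + w) = c *: op k v + op k w.

Fixpoint neval (t : nterm) (v : V) : V :=
  match t with
  | NGen k => op k v
  | NZero => 0
  | NOne => v
  | NAdd a b => neval a v + neval b v
  | NMul a b => neval a (neval b v)
  | NOpp a => - neval a v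
  | NScale c a => ceval c *: neval a v
  end.

Definition wact (w : seq nat) (v : V) : V := foldr op v w.
Definition peval (l : seq nmono) (v : V) : V :=
  \sum_(m <- l) cmeval m.1 *: wact m.2 v.

Lemma op_add k v w : op k (v + w) = op k v + op k w.
Proof. by have := op_lin k 1 v w; rewrite !scale1r. Qed.
Lemma op_zero k : op k 0 = 0.
Proof. by apply: (@addrI _ (op k 0)); rewrite -op_add !addr0. Qed.
Lemma op_scale k c v : op k (c *: v) = c *: op k v.
Proof. by have := op_lin k c v 0; rewrite op_zero !addr0. Qed.

Lemma wact_cat w1 w2 v : wact (w1 ++ w2) v = wact w1 (wact w2 v).
Proof. by rewrite /wact foldr_cat. Qed.

Lemma wact_sum w (l : seq nmono) v :
  wact w (peval l v) = \sum_(m <- l) cmeval m.1 *: wact (w ++ m.2) v.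
Proof.
elim: w => [//|k w /= ->]; elim: l => [|m l IH]; first by rewrite !big_nil op_zero.
by rewrite !big_cons op_add op_scale IH.
Qed.

Lemma peval_nscale c w l v : peval (nscale c w l) v = cmeval c *: wact w (peval l v).
Proof.
rewrite wact_sum /peval big_map scaler_sumr.
by apply: eq_bigr => m _ /=; rewrite cmeval_mul scalerA.
Qed.

Lemma nnormE t v : peval (nnorm t) v = neval t v.
Proof.
elim: t v => [k||| a IHa b IHb| a IHa b IHb| a IHa| c a IHa] v /=.
- by rewrite /peval big_seq1 /cmeval /= expr0z !mulr1 scale1r.
- by rewrite /peval big_nil.
- by rewrite /peval big_seq1 /cmeval /= expr0z !mulr1 scale1r.
- by rewrite /peval big_cat -IHa -IHb.
- rewrite -IHa -IHb {1}/peval big_flatten big_map /=.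
  rewrite [RHS]/peval; apply: eq_bigr => m _.
  by rewrite -/(peval _ v) peval_nscale.
- rewrite peval_nscale /= IHa /cmeval /= expr0z !mulr1.
  by rewrite scaleN1r.
- rewrite /peval big_flatten big_map -cnormE scaler_suml; apply: eq_bigr => d _.
  by rewrite -/(peval _ v) peval_nscale /= IHa.
Qed.

Lemma peval_cons m l v : peval (m :: l) v = cmeval m.1 *: wact m.2 v + peval l v.
Proof. by rewrite /peval big_cons. Qed.

Lemma ninsertE m l v : peval (ninsert m l) v = peval (m :: l) v.
Proof.
elim: l => [|m' l IH] /=.
  case: eqP => // z0; rewrite peval_cons /cmeval z0 !mul0r scale0r add0r.
  by rewrite /peval big_nil.
case: and3P => [[/eqP e1 /eqP e2 /eqP e3]|_].
  have E : peval [:: m, m' & l] v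
         = cmeval ((m.1.1.1 + m'.1.1.1, m'.1.1.2), m'.1.2) *: wact m'.2 v + peval l v.
    rewrite !peval_cons addrA e1 -scalerDl; congr (_ *: _ + _).
    by rewrite /cmeval /= e2 e3 intrD !mulrDl.
  case: eqP => [z0|_]; last by rewrite E peval_cons.
  by rewrite E z0 /cmeval /= !mul0r scale0r add0r.
by rewrite !peval_cons IH peval_cons addrCA.
Qed.

Lemma ncollectE l v : peval (ncollect l) v = peval l v.
Proof. by elim: l => [//|m l IH] /=; rewrite ninsertE !peval_cons IH. Qed.

(* The rules need only hold on a part of the module stable under the operators. *)
Variable P : V -> Prop.
Hypothesis opP : forall k v, P v -> P (op k v).

Lemma wactP w v : P v -> P (wact w v).
Proof. by move=> Pv; elim: w => [//|k w IH]; apply: opP. Qed.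

Definition rule_ok (r : nrule) := forall v, P v -> wact r.1 v = peval r.2 v.

Variable rules : seq nrule.
Hypothesis rules_ok : {in rules, forall r, rule_ok r}.

Lemma nmatchP w s r : nmatch rules w = Some (s, r) -> w = r.1 ++ s /\ rule_ok r.
Proof.
elim: rules rules_ok => [//|r' l IH] h /=.
have := h r' (mem_head _ _); case: ifP => [/prefixP[s' ->] h' [<- <-]|_ _].
  by rewrite drop_size_cat.
by apply: IH => x xl; apply: h; rewrite inE xl orbT.
Qed.

Lemma nmatchE w s r v : P v -> nmatch rules w = Some (s, r) ->
  wact w v = peval [seq (m.1, m.2 ++ s) | m <- r.2] v.
Proof.
move=> Pv /nmatchP[-> h]; rewrite wact_cat h ?/peval ?big_map; last exact: wactP.
by apply: eq_bigr => m _ /=; rewrite wact_cat.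
Qed.

(** A rule is applied to the vector produced by the letters to its right,
    which is again in P; the letters to its left are linear and pass through the
    sum. *)
Lemma nrewriteP w p :
  nrewrite rules w = Some p -> forall v, P v -> wact w v = peval p v.
Proof.
elim: w p => [|k w IH] p; rewrite [nrewrite _ _]/=;
  case E: (nmatch _ _) => [[s r]|] //; try by move=> [<-] v Pv; rewrite (nmatchE Pv E).
case: nrewrite IH => [p'|//] /(_ _ erefl) IH [<-] v Pv.
by rewrite /= IH // -[op k _]/(wact [:: k] _) wact_sum /peval big_map.
Qed.

Lemma nstepE l v : P v -> peval (nstep rules l) v = peval l v.
Proof.
move=> Pv; rewrite /nstep ncollectE /peval big_flatten big_map; apply: eq_bigr => m _.
case E: nrewrite => [p|]; last by rewrite big_seq1.
by rewrite -/(peval _ v) peval_nscale (nrewriteP E Pv).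
Qed.

Lemma cmeval_raise z e k :
  cmeval (z, e + 1, k) + cmeval (- z, e - 1, k) = (q - q^-1) * cmeval (z, e, k).
Proof.
rewrite /cmeval /= !expfzDr // exprN1 expr1z rmorphN /=.
set h := _ ^+ k; set x := q ^ e; set y := _%:~R; clearbody h x y; ring.
Qed.

Lemma nraiseE l v : peval (nraise l) v = (q - q^-1) *: peval l v.
Proof.
rewrite /peval big_flatten big_map scaler_sumr; apply: eq_bigr => [[[[z e] k] w]] _ /=.
by rewrite big_cons big_seq1 /= -scalerDl cmeval_raise scalerA.
Qed.

Lemma cmeval_drop z e k : cmeval (z, e, 0%N) = (q - q^-1) ^+ k * cmeval (z, e, k).
Proof. by rewrite /cmeval /= expr0 mulr1 exprVn [RHS]mulrCA divff ?mulr1 // expf_neq0. Qed.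

Lemma iter_nraise_den j z e k w :
  all (fun m => m.1.2 == k) (iter j nraise [:: ((z, e, k), w)]).
Proof.
elim: j => [|j IH] /=; first by rewrite eqxx.
apply/allP => m /flattenP[s /mapP[m' m'in ->]].
by rewrite !inE => /orP[]/eqP-> /=; apply: (allP IH).
Qed.

Lemma nclearE K l v : all (fun m => m.1.2 <= K)%N l ->
  peval (nclear K l) v = (q - q^-1) ^+ K *: peval l v.
Proof.
elim: l => [|[[[z e] k] w] l IH] /=; first by rewrite /peval !big_nil scaler0.
move=> /andP[kK /IH {}IH].
rewrite peval_cons scalerDr -IH /nclear /= {1}/peval big_cat /=; congr (_ + _).
rewrite big_map.
have -> : (q - q^-1) ^+ K *: (cmeval (z, e, k) *: wact w v)
  = (q - q^-1) ^+ k *: peval (iter (K - k) nraise [:: ((z, e, k), w)]) v.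
  rewrite -{1}(subnKC kK) exprD -[LHS]scalerA; congr (_ *: _).
  elim: (K - k)%N => [|j IHj]; first by rewrite /= expr0 scale1r /peval big_seq1.
  by rewrite iterS nraiseE -IHj exprS [RHS]scalerA.
rewrite /peval scaler_sumr !big_seq; apply: eq_bigr => -[[[z' e'] k'] w'] m'in.
have /= /eqP-> := allP (iter_nraise_den _ _ _ _ _) _ m'in.
by rewrite scalerA -cmeval_drop.
Qed.

(** The normal form is only sound, not complete: clearing the denominator
    multiplies the value by a power of the nonzero scalar q - q^-1, so a vanishing
    numerator suffices. *)
Lemma nzeroP l v : nzero l -> peval l v = 0.
Proof.
move=> /nilP h; set K := foldr maxn _ _ in h.
have lK : all (fun m : nmono => m.1.2 <= K)%N l.
  rewrite /K; elim: l {h K} => [//|m l IH] /=; rewrite leq_maxl /=.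
  by apply: sub_all IH => x /leq_trans-> //; apply: leq_maxr.
have := nclearE v lK; rewrite -ncollectE h {1}/peval big_nil => /esym/eqP.
by rewrite scaler_eq0 expf_eq0 (negPf qq) andbF => /eqP.
Qed.

End Soundness.

Section Check.
Variables (F : fieldType) (q : F).
Hypothesis q0 : q != 0.
Hypothesis qq : q - q^-1 != 0.

Fixpoint eqs_hold (T : Type) (ev : nterm -> T) (eqs : seq (nterm * nterm)) : Prop :=
  if eqs is e :: eqs' then ev e.1 = ev e.2 /\ eqs_hold ev eqs' else True.

(** Two words in operators agree when the difference rewrites to zero by the
    given equations. The equations may hold only on a stable part P of the module:
    this is what is needed for operators which satisfy the Serre relations on
    special functions only. *)
Lemma ncheckP (V : lmodType F) (op : nat -> V -> V) (P : V -> Prop) fuel eqs l r :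
  (forall k v, P v -> P (op k v)) ->
  (forall k c v w, op k (c *: v + w) = c *: op k v + op k w) ->
  (forall v, P v -> eqs_hold (fun t => neval q op t v) eqs) ->
  ncheck fuel eqs l r -> forall v, P v -> neval q op l v = neval q op r v.
Proof.
move=> opP op_lin h chk v Pv; apply/eqP; rewrite -subr_eq0; apply/eqP.
rewrite -[LHS]/(neval q op (NAdd l (NOpp r)) v) -(nnormE q0 op_lin) -(ncollectE q op).
rewrite -[RHS](nzeroP q0 qq op v chk).
elim: fuel {chk} => [//|n ->] /=.
rewrite (nstepE q0 op_lin opP) // => {v Pv} rl rin v Pv.
have : exists2 e, rl = mkrule e & forall u, P u -> neval q op e.1 u = neval q op e.2 u.
  elim: eqs h rin => [//|e eqs' IH] /= h; rewrite inE => /orP[/eqP->|].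
    by exists e => // u Pu; have [] := h u Pu.
  by apply: IH => u Pu; have [] := h u Pu.
move=> [e -> he].
have triv : wact op [::] v = peval q op [:: ((1, 0, 0%N), [::])] v.
  by rewrite /peval big_seq1 /cmeval /= expr0z !mulr1 scale1r.
have := nnormE q0 op_lin e.1 v; rewrite he // -(nnormE q0 op_lin) /mkrule.
case: (nnorm e.1) => [|[[[z z'] k] w] [|m l']] //;
  case: z => [[|[|z]]|z] //; case: z' => [[|z']|z'] //; case: k => [|k] //=.
by rewrite {1}/peval big_seq1 /cmeval /= expr0z !mulr1 scale1r.
Qed.

Fixpoint aeval (A : algType F) (env : seq A) (t : nterm) : A :=
  match t with
  | NGen k => nth 0 env k
  | NZero => 0
  | NOne => 1
  | NAdd a b => aeval env a + aeval env b
  | NMul a b => aeval env a * aeval env b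
  | NOpp a => - aeval env a
  | NScale c a => ceval q c *: aeval env a
  end.

(** In an algebra the letters act by left multiplication, and evaluation at 1
    returns the elements themselves. *)
Lemma ncheck_alg (A : algType F) (env : seq A) eqs fuel l r :
  eqs_hold (aeval env) eqs -> ncheck fuel eqs l r -> aeval env l = aeval env r.
Proof.
pose op k (x : A) := nth 0 env k * x.
have opE t x : neval q op t x = aeval env t * x.
  elim: t x => //= [x|x|a IHa b IHb x|a IHa b IHb x|a IHa x|c a IHa x].
  - by rewrite mul0r.
  - by rewrite mul1r.
  - by rewrite IHa IHb mulrDl.
  - by rewrite IHb IHa mulrA.
  - by rewrite IHa mulNr.
  - by rewrite IHa -scalerAl.
move=> h chk; rewrite -[LHS]mulr1 -[RHS]mulr1 -!opE; apply: (ncheckP (P := fun _ => True)) chk _ _ => //.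
  by move=> k c v w; rewrite /op mulrDr -scalerAr.
by move=> v _; elim: eqs h => [//|e eqs IH] /= [h /IH]; rewrite !opE h.
Qed.
End Check.

Ltac nc_coef q c :=
  lazymatch c with
  | q => constr:(CVar)
  | (q^-1)%R => constr:(CInv)
  | (q ^ ?e)%R => constr:(CPow e)
  | (q - q^-1)^-1%R => constr:(CDen)
  | (?a + ?b)%R => let a' := nc_coef q a in let b' := nc_coef q b in constr:(CAdd a' b')
  | (?a * ?b)%R => let a' := nc_coef q a in let b' := nc_coef q b in constr:(CMul a' b')
  | (- ?a)%R => let a' := nc_coef q a in constr:(COpp a')
  | (?n%:R)%R => constr:(CInt (Posz n))
  | 1%R => constr:(CInt 1)
  | 0%R => constr:(CInt 0)
  end.

Ltac nc_mem x l :=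
  lazymatch l with
  | nil => constr:(false)
  | cons x _ => constr:(true)
  | cons _ ?l' => nc_mem x l'
  end.

Ltac nc_pos x l :=
  lazymatch l with
  | cons x _ => constr:(0%N)
  | cons _ ?l' => let n := nc_pos x l' in constr:(S n)
  end.

Ltac nc_atoms e l :=
  lazymatch e with
  | (?a + ?b)%R => let l' := nc_atoms a l in nc_atoms b l'
  | (?a * ?b)%R => let l' := nc_atoms a l in nc_atoms b l'
  | (- ?a)%R => nc_atoms a l
  | (?c *: ?a)%R => nc_atoms a l
  | 1%R => l
  | 0%R => l
  | _ => let b := nc_mem e l in
         lazymatch b with true => l | false => constr:(cons e l) end
  end.

Ltac nc_reify q env e :=
  lazymatch e with
  | (?a + ?b)%R => let a' := nc_reify q env a in let b' := nc_reify q env b in constr:(NAdd a' b')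
  | (?a * ?b)%R => let a' := nc_reify q env a in let b' := nc_reify q env b in constr:(NMul a' b')
  | (- ?a)%R => let a' := nc_reify q env a in constr:(NOpp a')
  | (?c *: ?a)%R => let c' := nc_coef q c in let a' := nc_reify q env a in constr:(NScale c' a')
  | 1%R => constr:(NOne)
  | 0%R => constr:(NZero)
  | _ => let n := nc_pos e env in constr:(NGen n)
  end.

Ltac nc_hyps_atoms H l :=
  lazymatch H with
  | (?H1, ?H2) => let l' := nc_hyps_atoms H1 l in nc_hyps_atoms H2 l'
  | tt => l
  | _ => let T := type of H in
    lazymatch eval cbv beta in T with (?a = ?b) => let l' := nc_atoms a l in nc_atoms b l' end
  end.

Ltac nc_hyps_eqs q env H acc :=
  lazymatch H with
  | (?H1, ?H2) => let acc' := nc_hyps_eqs q env H2 acc in nc_hyps_eqs q env H1 acc'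
  | tt => acc
  | _ => let T := type of H in
    lazymatch eval cbv beta in T with (?a = ?b) =>
      let a' := nc_reify q env a in let b' := nc_reify q env b in
      constr:(cons (a', b') acc) end
  end.

Ltac nc_hyps_proof H acc :=
  lazymatch H with
  | (?H1, ?H2) => let acc' := nc_hyps_proof H2 acc in nc_hyps_proof H1 acc'
  | tt => acc
  | _ => constr:(conj H acc)
  end.

(** Solves an equation between elements of an algebra, modulo the equations
    H used as rewriting rules from left to right. The fuel 60 only bounds the
    number of rewriting rounds. *)
Ltac nc_solve q q0 qq H :=
  lazymatch goal with
  | |- @eq ?A ?l ?r =>
    let env := nc_atoms l (@nil A) in
    let env := nc_atoms r env in
    let env := nc_hyps_atoms H env in
    let l' := nc_reify q env l in
    let r' := nc_reify q env r in
    let eqs := nc_hyps_eqs q env H (@nil (nterm * nterm)%type) in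
    let pf := nc_hyps_proof H I in
    refine (@ncheck_alg _ q q0 qq _ env eqs 60 l' r' pf _);
    vm_compute; exact (erefl true)
  end.

(** * The presented algebra *)

Section Presented.
Variables (F : fieldType) (q : F).
Notation U := (Uq q).

Lemma piD t u : \pi_(Uq q) (TAdd t u) = (\pi t : U) + \pi u.
Proof. by rewrite Uq_piD. Qed.
Lemma piM t u : \pi_(Uq q) (TMul t u) = (\pi t : U) * \pi u.
Proof. by rewrite -[RHS]/(Uq_mul _ _) Uq_mulE. Qed.
Lemma piZ c t : \pi_(Uq q) (TScale c t) = c *: (\pi t : U).
Proof. by rewrite -[RHS]/(Uq_scale _ _) Uq_scaleE. Qed.

Lemma Uq_ind (P : U -> Prop) :
  (forall g, P (ugenE q g)) -> P 0 -> P 1 ->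
  (forall x y, P x -> P y -> P (x + y)) ->
  (forall x y, P x -> P y -> P (x * y)) ->
  (forall c x, P x -> P (c *: x)) -> forall x, P x.
Proof.
move=> Pg P0 P1 PD PM PZ; elim/quotW => t.
elim: t => [g||| t IHt u IHu| t IHt u IHu| c t IHt] //.
- exact: Pg.
- by rewrite piD; apply: PD.
- by rewrite piM; apply: PM.
- by rewrite piZ; apply: PZ.
Qed.

Lemma urelE t u : urel q t u -> (\pi_(Uq q) t : U) = \pi u.
Proof. by move=> h; apply/UqP/uc_rel. Qed.

Lemma uKK' i : uK q i * uK' q i = 1.
Proof. by rewrite -piM (urelE (urel_KK' _ i)). Qed.
Lemma uK'K i : uK' q i * uK q i = 1.
Proof. by rewrite -piM (urelE (urel_K'K _ i)). Qed.
Lemma uKK i j : uK q i * uK q j = uK q j * uK q i.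
Proof. by rewrite -!piM (urelE (urel_KK _ i j)). Qed.
Lemma uKE i j : uK q i * uE q j = q ^ cartan i j *: (uE q j * uK q i).
Proof. by rewrite -!piM -piZ (urelE (urel_KE _ i j)). Qed.
Lemma uKF i j : uK q i * uF q j = q ^ (- cartan i j) *: (uF q j * uK q i).
Proof. by rewrite -!piM -piZ (urelE (urel_KF _ i j)). Qed.
Lemma uEF i j : uE q i * uF q j =
  uF q j * uE q i + ((i == j)%:R / (q - q^-1)) *: (uK q i - uK' q i).
Proof.
have := urelE (urel_EF q i j); rewrite !(piD, piZ, piM) !scaleN1r.
by move=> /(congr1 (fun x => uF q j * uE q i + x)); rewrite addrC subrK.
Qed.
Lemma uEE0 i j : cartan i j = 0 -> uE q i * uE q j = uE q j * uE q i.
Proof. by move=> h; rewrite -!piM (urelE (urel_EE0 _ h)). Qed.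
Lemma uFF0 i j : cartan i j = 0 -> uF q i * uF q j = uF q j * uF q i.
Proof. by move=> h; rewrite -!piM (urelE (urel_FF0 _ h)). Qed.
Lemma uEE1 i j : cartan i j = -1 ->
  uE q i * uE q i * uE q j =
  (q + q^-1) *: (uE q i * uE q j * uE q i) - uE q j * uE q i * uE q i.
Proof.
move=> h; have := urelE (urel_EE1 q h); rewrite !(piD, piZ, piM) scaleNr.
by move=> /eqP; rewrite -addrA addr_eq0 opprD opprK => /eqP.
Qed.
Lemma uFF1 i j : cartan i j = -1 ->
  uF q i * uF q i * uF q j =
  (q + q^-1) *: (uF q i * uF q j * uF q i) - uF q j * uF q i * uF q i.
Proof.
move=> h; have := urelE (urel_FF1 q h); rewrite !(piD, piZ, piM) scaleNr.
by move=> /eqP; rewrite -addrA addr_eq0 opprD opprK => /eqP.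
Qed.

Section Uext.
Variables (A : lmodType F) (sg : {rmorphism F -> F}).
Variables (one : A) (mul : A -> A -> A) (g : ugen -> A).
Hypothesis bm : bilinear_for *:%R *:%R mul.
Hypothesis mA : associative mul.
Hypothesis m1 : left_id one mul.
Hypothesis m1r : right_id one mul.
Hypothesis hrel :
  forall t u, urel q t u -> teval sg one mul g t = teval sg one mul g u.
Let ext := uextE bm mA m1 m1r hrel.
Notation f := (@uext F q A sg one mul g).

Lemma uext_gen x : f (ugenE q x) = g x. Proof. exact: ext. Qed.
Lemma uext1 : f 1 = one. Proof. exact: (ext (TOne : uterm F)). Qed.
Lemma uextD x y : f (x + y) = f x + f y.
Proof. by elim/quotW: x => x; elim/quotW: y => y; rewrite -piD !ext. Qed.
Lemma uextM x y : f (x * y) = mul (f x) (f y).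
Proof. by elim/quotW: x => x; elim/quotW: y => y; rewrite -piM !ext. Qed.
Lemma uextZ c x : f (c *: x) = sg c *: f x.
Proof. by elim/quotW: x => x; rewrite -piZ !ext. Qed.
End Uext.

Lemma bilinear_mul (A : algType F) : bilinear_for *:%R *:%R (@GRing.mul A).
Proof. by split=> x c y z /=; rewrite ?mulrDl ?mulrDr -?scalerAl -?scalerAr. Qed.
Lemma bilinear_mulop (A : algType F) :
  bilinear_for *:%R *:%R (fun x y : A => y * x).
Proof. by split=> x c y z /=; rewrite ?mulrDl ?mulrDr -?scalerAl -?scalerAr. Qed.
End Presented.

(** * Tensor products *)

Section TensorTheory.
Variables (F : fieldType) (V W : lmodType F).
Notation T := (tensor V W).

Section TL.
Variables (X : lmodType F) (b : V -> W -> X).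
Hypothesis bb : bilinear_for *:%R *:%R b.
Lemma tliftD x y : tlift b (x + y) = tlift b x + tlift b y.
Proof. exact: tlift_add. Qed.
Lemma tliftZ c x : tlift b (c *: x) = c *: tlift b x.
Proof. exact: tlift_scale. Qed.
Lemma tlift0 : tlift b 0 = 0.
Proof. exact: tlift_zero. Qed.
End TL.

Lemma bilDl (X : lmodType F) (b : V -> W -> X) v v' w :
  bilinear_for *:%R *:%R b -> b (v + v') w = b v w + b v' w.
Proof. by move=> [h _]; have := h w 1 v v'; rewrite /= !scale1r. Qed.
Lemma bilDr (X : lmodType F) (b : V -> W -> X) v w w' :
  bilinear_for *:%R *:%R b -> b v (w + w') = b v w + b v w'.
Proof. by move=> [_ h]; have := h v 1 w w'; rewrite /= !scale1r. Qed.
Lemma bilZl (X : lmodType F) (b : V -> W -> X) c v w :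
  bilinear_for *:%R *:%R b -> b (c *: v) w = c *: b v w.
Proof. by move=> bb; apply: bil_scale. Qed.
Lemma bilZr (X : lmodType F) (b : V -> W -> X) c v w :
  bilinear_for *:%R *:%R b -> b v (c *: w) = c *: b v w.
Proof.
move=> bb; have b0 : b v 0 = 0.
  by apply: (@addrI _ (b v 0)); rewrite -bilDr // !addr0.
by have := bb.2 v c w 0; rewrite /= b0 !addr0.
Qed.

Lemma tens_bil : bilinear_for *:%R *:%R (@tens F V W).
Proof.
split=> x c y z; apply: tensorP => X b bb.
  by rewrite tliftD // tliftZ // !tlift_tens // (bilDl _ _ _ bb) (bilZl _ _ _ bb).
by rewrite tliftD // tliftZ // !tlift_tens // (bilDr _ _ _ bb) (bilZr _ _ _ bb).
Qed.

(** An element of the tensor product is a list of pure tensors; the induction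
    is on this list. *)
Lemma tens_ind (P : T -> Prop) :
  P 0 -> (forall x y, P x -> P y -> P (x + y)) -> (forall v w, P (tens v w)) ->
  forall x, P x.
Proof.
move=> P0 PD Pt; elim/quotW; elim=> [|[v w] s IH]; first exact: P0.
have -> : \pi_(tensor V W) ((v, w) :: s) = tens v w + \pi_(tensor V W) (s : tensor_pre V W).
  apply: tensorP => X b bb; rewrite tliftD // tlift_tens // !tlift_pi //.
  by rewrite /tensor_sum big_cons.
exact: PD.
Qed.

End TensorTheory.

(** * Straightening rules for the quantum group *)

Lemma node_ind (P : 'I_3 -> Prop) : P node1 -> P node2 -> P node3 -> forall i, P i.
Proof.
move=> P1 P2 P3 [[|[|[|]]] h] //.
- by rewrite (_ : Ordinal h = node1) //; apply: val_inj.
- by rewrite (_ : Ordinal h = node2) //; apply: val_inj.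
- by rewrite (_ : Ordinal h = node3) //; apply: val_inj.
Qed.

Section Serre.
Variables (F : fieldType) (q : F).
Hypothesis q0 : q != 0.
Hypothesis qq : q - q^-1 != 0.
Hypothesis q2 : q + q^-1 != 0.
Variables (A : algType F) (x y z : A).

Hypothesis yyx : y * y * x = (q + q^-1) *: (y * x * y) - x * y * y.
Hypothesis yxx : y * x * x = (q + q^-1) *: (x * y * x) - x * x * y.
Hypothesis zzy : z * z * y = (q + q^-1) *: (z * y * z) - y * z * z.
Hypothesis zyy : z * y * y = (q + q^-1) *: (y * z * y) - y * y * z.
Hypothesis zx : z * x = x * z.

(** The Serre relations are not confluent as rewriting rules. This is the
    relation forced by the overlap z y y x of the left sides z y y and y y x; a
    factor q + q^-1 is divided out. *)
Lemma serre_zyxy : z * y * x * y = y * z * y * x + x * y * z * y - y * x * y * z.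
Proof.
have e : (q + q^-1) *: (z * y * x * y - (y * z * y * x + x * y * z * y - y * x * y * z)) =
    (z * y * y - ((q + q^-1) *: (y * z * y) - y * y * z)) * x
    - z * (y * y * x - ((q + q^-1) *: (y * x * y) - x * y * y))
    + x * (z * y * y - ((q + q^-1) *: (y * z * y) - y * y * z))
    - (y * y * x - ((q + q^-1) *: (y * x * y) - x * y * y)) * z.
  nc_solve q q0 qq zx.
move: e; rewrite -yyx -zyy !subrr !mul0r !mulr0 !(subr0, addr0) => /eqP.
by rewrite scaler_eq0 (negPf q2) /= subr_eq0 => /eqP.
Qed.

(** The second relation of the completion, forced by the overlap of z z y with
    the relation of the previous lemma. *)
Lemma serre_zyzyx : z * y * z * y * x =
  (q + q^-1) *: (z * y * x * z * y) - x * z * y * z * y + y * z * y * x * z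
  + x * y * z * y * z - (q + q^-1) *: (y * x * z * y * z).
Proof.
pose r3 := z * y * x * y - (y * z * y * x + x * y * z * y - y * x * y * z).
pose r4 := z * z * y - ((q + q^-1) *: (z * y * z) - y * z * z).
apply/eqP; rewrite -subr_eq0.
have -> : z * y * z * y * x -
  ((q + q^-1) *: (z * y * x * z * y) - x * z * y * z * y + y * z * y * x * z
  + x * y * z * y * z - (q + q^-1) *: (y * x * z * y * z))
  = r4 * x * y - z * r3 + r3 * z - y * x * r4.
  by rewrite /r3 /r4; nc_solve q q0 qq zx.
by rewrite /r3 /r4 serre_zyxy zzy !subrr !mul0r !mulr0 subrr addr0 subr0.
Qed.
End Serre.

(** Positions 0 - 11 of an environment hold E_1, E_2, E_3, F_1, F_2, F_3, K_1,
   K_2, K_3 and their inverses, all shifted by o. *)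
Definition rE o (i : nat) := NGen (o + i).
Definition rF o (i : nat) := NGen (o + 3 + i).
Definition rK o (i : nat) := NGen (o + 6 + i).
Definition rK' o (i : nat) := NGen (o + 9 + i).

Definition ncart (i j : nat) : int :=
  if i == j then 2 else if (i.+1 == j) || (j.+1 == i) then -1 else 0.

(** The Serre relations of type A_3 for x, y, z, completed by the two
    relations above so that straightening decides them. *)
Definition rserre (x y z : nterm) : seq (nterm * nterm) :=
  let two := CAdd CVar CInv in
  [:: (NMul z x, NMul x z);
      (NMul (NMul y y) x, NAdd (NScale two (NMul (NMul y x) y)) (NOpp (NMul (NMul x y) y)));
      (NMul (NMul y x) x, NAdd (NScale two (NMul (NMul x y) x)) (NOpp (NMul (NMul x x) y)));
      (NMul (NMul z z) y, NAdd (NScale two (NMul (NMul z y) z)) (NOpp (NMul (NMul y z) z)));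
      (NMul (NMul z y) y, NAdd (NScale two (NMul (NMul y z) y)) (NOpp (NMul (NMul y y) z)));
      (NMul (NMul (NMul z y) x) y,
        NAdd (NAdd (NMul (NMul (NMul y z) y) x) (NMul (NMul (NMul x y) z) y))
             (NOpp (NMul (NMul (NMul y x) y) z)));
      (NMul (NMul (NMul (NMul z y) z) y) x,
        NAdd (NAdd (NAdd (NAdd
          (NScale two (NMul (NMul (NMul (NMul z y) x) z) y))
          (NOpp (NMul (NMul (NMul (NMul x z) y) z) y)))
          (NMul (NMul (NMul (NMul y z) y) x) z))
          (NMul (NMul (NMul (NMul x y) z) y) z))
          (NOpp (NScale two (NMul (NMul (NMul (NMul y x) z) y) z))))].

Definition ncartan_rules o : seq (nterm * nterm) :=
  let nodes := [:: 0; 1; 2]%N in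
  let pairs := [:: (1, 0); (2, 0); (2, 1)]%N in
  [seq (NMul (rK o i) (rK' o i), NOne) | i <- nodes] ++
  [seq (NMul (rK' o i) (rK o i), NOne) | i <- nodes] ++
  [seq (NMul (rK o p.1) (rK o p.2), NMul (rK o p.2) (rK o p.1)) | p <- pairs] ++
  [seq (NMul (rK' o p.1) (rK' o p.2), NMul (rK' o p.2) (rK' o p.1)) | p <- pairs] ++
  [seq (NMul (rK' o p.1) (rK o p.2), NMul (rK o p.2) (rK' o p.1)) | p <- pairs] ++
  [seq (NMul (rK o p.1) (rK' o p.2), NMul (rK' o p.2) (rK o p.1)) | p <- pairs].

Definition nroot_rules o : seq (nterm * nterm) :=
  let nodes := [:: 0; 1; 2]%N in
  [seq (NMul (rE o j) (rK o i), NScale (CPow (- ncart i j)) (NMul (rK o i) (rE o j)))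
    | i <- nodes, j <- nodes] ++
  [seq (NMul (rE o j) (rK' o i), NScale (CPow (ncart i j)) (NMul (rK' o i) (rE o j)))
    | i <- nodes, j <- nodes] ++
  [seq (NMul (rK o i) (rF o j), NScale (CPow (- ncart i j)) (NMul (rF o j) (rK o i)))
    | i <- nodes, j <- nodes] ++
  [seq (NMul (rK' o i) (rF o j), NScale (CPow (ncart i j)) (NMul (rF o j) (rK' o i)))
    | i <- nodes, j <- nodes] ++
  [seq (NMul (rE o i) (rF o j),
        NAdd (NMul (rF o j) (rE o i))
          (if i == j then NScale CDen (NAdd (rK o i) (NOpp (rK' o i))) else NZero))
    | i <- nodes, j <- nodes].

(** The rules move the F_i to the left and the E_i to the right, with the K_i
    between them. *)
Definition nrules o : seq (nterm * nterm) :=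
  ncartan_rules o ++ nroot_rules o ++
  rserre (rE o 0) (rE o 1) (rE o 2) ++ rserre (rF o 0) (rF o 1) (rF o 2).

Section Model.
Variables (F : fieldType) (q : F).
Hypothesis q0 : q != 0.
Hypothesis qq : q - q^-1 != 0.
Hypothesis q2 : q + q^-1 != 0.

Definition nlist (A : Type) (f : 'I_3 -> A) : seq A := [:: f node1; f node2; f node3].
Definition uenv (A : algType F) (f : Uq q -> A) : seq A :=
  nlist (f \o uE q) ++ nlist (f \o uF q) ++ nlist (f \o uK q) ++ nlist (f \o uK' q).

Lemma eqs_hold_cat T (ev : nterm -> T) s t :
  eqs_hold ev s -> eqs_hold ev t -> eqs_hold ev (s ++ t).
Proof. by elim: s => [//|e s IH] /= [-> hs] ht; split=> //; apply: IH. Qed.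

Definition alg_hom (A B : algType F) (f : A -> B) : Prop :=
  [/\ f 1 = 1, forall c x y, f (c *: x + y) = c *: f x + f y
    & forall x y, f (x * y) = f x * f y].

(** Commutation relations with k determine those with the inverse of k, so the
    defining relations with K_i give those with its inverse. *)
Lemma inv_qcomm (A : algType F) (k k' x : A) c : k * k' = 1 -> k' * k = 1 ->
  c != 0 -> k * x = c *: (x * k) -> k' * x = c^-1 *: (x * k').
Proof.
move=> kk' k'k c0 h; rewrite -[k' * x]mulr1 -kk' mulrA -(mulrA k' x).
have -> : x * k = c^-1 *: (k * x) by rewrite h scalerA mulVf // scale1r.
by rewrite -scalerAr -scalerAl mulrA k'k mul1r.
Qed.

Lemma inv_comm (A : algType F) (k k' x : A) : k * k' = 1 -> k' * k = 1 ->
  k * x = x * k -> k' * x = x * k'.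
Proof.
move=> kk' k'k h; rewrite (inv_qcomm kk' k'k (oner_neq0 F)) ?invr1 ?scale1r //.
Qed.

Lemma uK'_K i j : uK' q i * uK q j = uK q j * uK' q i.
Proof. exact: inv_comm (uKK' q i) (uK'K q i) (uKK q i j). Qed.
Lemma uK'_K' i j : uK' q i * uK' q j = uK' q j * uK' q i.
Proof.
apply: inv_comm (uKK' q i) (uK'K q i) _; apply: esym.
exact: inv_comm (uKK' q j) (uK'K q j) (uKK q j i).
Qed.

Lemma uE_K i j : uE q j * uK q i = q ^ (- cartan i j) *: (uK q i * uE q j).
Proof. by rewrite uKE scalerA -expfzDr // addNr expr0z scale1r. Qed.
Lemma uE_K' i j : uE q j * uK' q i = q ^ (cartan i j) *: (uK' q i * uE q j).
Proof.
rewrite (inv_qcomm (uKK' q i) (uK'K q i) _ (uKE q i j)) ?expfz_neq0 //.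
by rewrite scalerA mulfV ?scale1r // expfz_neq0.
Qed.
Lemma uK'_F i j : uK' q i * uF q j = q ^ (cartan i j) *: (uF q j * uK' q i).
Proof.
rewrite (inv_qcomm (uKK' q i) (uK'K q i) _ (uKF q i j)) ?expfz_neq0 //.
by rewrite invr_expz opprK.
Qed.

Section Hom.
Variables (A : algType F) (f : Uq q -> A).
Hypothesis fh : alg_hom f.

Lemma homM x y : f (x * y) = f x * f y. Proof. by case: fh. Qed.
Lemma hom1 : f 1 = 1. Proof. by case: fh. Qed.
Lemma hom0 : f 0 = 0.
Proof. by case: fh => _ /(_ (-1) 0 0) + _; rewrite scaler0 addr0 scaleN1r addNr. Qed.
Lemma homZ c x : f (c *: x) = c *: f x.
Proof. by case: fh => _ /(_ c x 0) + _; rewrite hom0 !addr0. Qed.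
Lemma homD x y : f (x + y) = f x + f y.
Proof. by case: fh => _ /(_ 1 x y) + _; rewrite !scale1r. Qed.
Lemma homN x : f (- x) = - f x.
Proof. by rewrite -!scaleN1r homZ. Qed.

Lemma hold3 T (ev : nterm -> T) (r : nat -> nterm * nterm) :
  (forall i : 'I_3, ev (r i).1 = ev (r i).2) ->
  eqs_hold ev [seq r i | i <- [:: 0; 1; 2]%N].
Proof.
by move=> H; split; [exact: (H node1)|split; [exact: (H node2)|split=> //; exact: (H node3)]].
Qed.
Lemma hold9 T (ev : nterm -> T) (r : nat -> nat -> nterm * nterm) :
  (forall i j : 'I_3, ev (r i j).1 = ev (r i j).2) ->
  eqs_hold ev [seq r i j | i <- [:: 0; 1; 2]%N, j <- [:: 0; 1; 2]%N].
Proof.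
by move=> H; do !apply: eqs_hold_cat => //; apply: (hold3 (r := r _)) => j;
  [exact: (H node1)|exact: (H node2)|exact: (H node3)].
Qed.
Lemma ncartE (i j : 'I_3) : ncart i j = cartan i j.
Proof. by elim/node_ind: i; elim/node_ind: j. Qed.

Lemma serre_hold o (x y z : Uq q) :
  z * x = x * z ->
  y * y * x = (q + q^-1) *: (y * x * y) - x * y * y ->
  y * x * x = (q + q^-1) *: (x * y * x) - x * x * y ->
  z * z * y = (q + q^-1) *: (z * y * z) - y * z * z ->
  z * y * y = (q + q^-1) *: (y * z * y) - y * y * z ->
  forall env : seq A, nth 0 env o = f x -> nth 0 env o.+1 = f y ->
  nth 0 env o.+2 = f z ->
  eqs_hold (aeval q env) (rserre (NGen o) (NGen o.+1) (NGen o.+2)).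
Proof.
move=> h1 h2 h3 h4 h5 env /= -> -> ->; rewrite -!(homM, homZ, homD, homN).
have h6 := serre_zyxy q0 qq q2 h2 h5 h1.
have h7 := serre_zyzyx q0 qq q2 h2 h4 h5 h1.
by do !split; congr f.
Qed.

Variables (o : nat) (env : seq A).
Hypothesis envE : forall i : 'I_3, nth 0 env (o + i) = f (uE q i).
Hypothesis envF : forall i : 'I_3, nth 0 env (o + 3 + i) = f (uF q i).
Hypothesis envK : forall i : 'I_3, nth 0 env (o + 6 + i) = f (uK q i).
Hypothesis envK' : forall i : 'I_3, nth 0 env (o + 9 + i) = f (uK' q i).

Lemma ncartan_hold : eqs_hold (aeval q env) (ncartan_rules o).
Proof.
apply: eqs_hold_cat; first by apply: hold3 => i /=; rewrite envK envK' -homM uKK' hom1.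
apply: eqs_hold_cat; first by apply: hold3 => i /=; rewrite envK envK' -homM uK'K hom1.
apply: eqs_hold_cat; first by do !split; rewrite /=
  ?(envK node1) ?(envK node2) ?(envK node3) -!homM uKK.
apply: eqs_hold_cat; first by do !split; rewrite /=
  ?(envK' node1) ?(envK' node2) ?(envK' node3) -!homM uK'_K'.
apply: eqs_hold_cat; by do !split; rewrite /= ?(envK node1) ?(envK node2) ?(envK node3)
  ?(envK' node1) ?(envK' node2) ?(envK' node3) -!homM uK'_K.
Qed.

Lemma nroot_hold : eqs_hold (aeval q env) (nroot_rules o).
Proof.
apply: eqs_hold_cat.
  by apply: hold9 => i j /=; rewrite envK envE ncartE -!homM -homZ uE_K.
apply: eqs_hold_cat.
  by apply: hold9 => i j /=; rewrite envK' envE ncartE -!homM -homZ uE_K'.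
apply: eqs_hold_cat.
  by apply: hold9 => i j /=; rewrite envK envF ncartE -!homM -homZ uKF.
apply: eqs_hold_cat.
  by apply: hold9 => i j /=; rewrite envK' envF ncartE -!homM -homZ uK'_F.
apply: hold9 => i j /=; rewrite envE envF -homM uEF homD homM homZ; congr (_ + _).
have -> : (i == j) = (i == j :> nat) by [].
case: eqP => _ /=; last by rewrite mul0r scale0r.
by rewrite envK envK' mul1r homD homN.
Qed.

(** Stated for the image of the generators under an algebra morphism, and at a
    position o of the environment, so that it serves U as well as both factors of
    U tensor U. *)
Lemma nrules_hold : eqs_hold (aeval q env) (nrules o).
Proof.
apply: (eqs_hold_cat ncartan_hold); apply: (eqs_hold_cat nroot_hold).
have swp (u v w : Uq q) : u = v - w -> w = v - u by move=> ->; rewrite subKr.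
apply: eqs_hold_cat.
- have -> : rserre (rE o 0) (rE o 1) (rE o 2) = rserre (NGen o) (NGen o.+1) (NGen o.+2).
    by rewrite /rE !(addn0, addn1, addn2).
  apply: (@serre_hold _ (uE q node1) (uE q node2) (uE q node3)).
  + exact: uEE0.
  + exact: uEE1.
  + by apply: swp; apply: uEE1.
  + exact: uEE1.
  + by apply: swp; apply: uEE1.
  + by have := envE node1; rewrite addn0.
  + by have := envE node2; rewrite addn1.
  + by have := envE node3; rewrite addn2.
- have -> : rserre (rF o 0) (rF o 1) (rF o 2)
      = rserre (NGen (o + 3)) (NGen (o + 3).+1) (NGen (o + 3).+2).
    by rewrite /rF !(addn0, addn1, addn2).
  apply: (@serre_hold _ (uF q node1) (uF q node2) (uF q node3)).
  + exact: uFF0.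
  + exact: uFF1.
  + by apply: swp; apply: uFF1.
  + exact: uFF1.
  + by apply: swp; apply: uFF1.
  + by have := envF node1; rewrite addn0.
  + by have := envF node2; rewrite addn1.
  + by have := envF node3; rewrite addn2.
Qed.

End Hom.

Lemma id_hom (A : algType F) : alg_hom (@id A). Proof. by []. Qed.

Lemma urules_hold : eqs_hold (aeval q (uenv (@id (Uq q)))) (nrules 0).
Proof. by apply: (nrules_hold (id_hom _)); elim/node_ind. Qed.

Lemma urules_check l r : ncheck 60 (nrules 0) l r ->
  aeval q (uenv (@id (Uq q))) l = aeval q (uenv (@id (Uq q))) r.
Proof. exact: (ncheck_alg q0 qq urules_hold). Qed.

End Model.

(** Decides equations between expressions in the generators of Uq q. *)
Ltac uq_atoms q := constr:([:: uE q node1; uE q node2; uE q node3;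
  uF q node1; uF q node2; uF q node3; uK q node1; uK q node2; uK q node3;
  uK' q node1; uK' q node2; uK' q node3]).
Ltac uq_solve q q0 qq q2 :=
  lazymatch goal with
  | |- @eq ?A ?l ?r =>
    let env := uq_atoms q in
    let l' := nc_reify q env l in
    let r' := nc_reify q env r in
    refine (@urules_check _ q q0 qq q2 l' r' _);
    vm_compute; exact (erefl true)
  end.

(** * The Hopf structure *)

Section TensorAlgebra.
Variables (F : fieldType) (q : F).
Notation U := (Uq q).

(** An alias of the tensor square which carries the algebra structure in which
    the two factors commute. *)
Definition U2 : Type := tensor U U.
HB.instance Definition _ := GRing.Lmodule.on U2.

Lemma tmul_in_bil (a b : U) :
  bilinear_for *:%R *:%R (fun a' b' : U => tens (a * a') (b * b') : U2).
Proof.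
split=> x c y z /=.
  by rewrite mulrDr -scalerAr (bilDl _ _ _ (tens_bil _ _)) (bilZl _ _ _ (tens_bil _ _)).
by rewrite mulrDr -scalerAr (bilDr _ _ _ (tens_bil _ _)) (bilZr _ _ _ (tens_bil _ _)).
Qed.

Definition tmulr (a b : U) (y : U2) : U2 := tlift (fun a' b' => tens (a * a') (b * b')) y.
Lemma tmulrD a b y y' : tmulr a b (y + y') = tmulr a b y + tmulr a b y'.
Proof. exact: tliftD (tmul_in_bil a b) _ _. Qed.
Lemma tmulrZ a b c y : tmulr a b (c *: y) = c *: tmulr a b y.
Proof. exact: tliftZ (tmul_in_bil a b) _ _. Qed.
Lemma tmulr0 a b : tmulr a b 0 = 0.
Proof. exact: tlift0 (tmul_in_bil a b). Qed.
Lemma tmulrE a b a' b' : tmulr a b (tens a' b') = tens (a * a') (b * b').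
Proof. exact: tlift_tens (tmul_in_bil a b) _ _. Qed.

Lemma tmulr_bil y : bilinear_for *:%R *:%R (fun a b => tmulr a b y).
Proof.
split=> x c u v /=; elim/tens_ind: y => [|y z IHy IHz|y z]; rewrite ?tmulr0 ?scaler0 ?addr0 //.
- by rewrite !tmulrD IHy IHz scalerDr addrACA.
- rewrite !tmulrE mulrDl -scalerAl.
  by rewrite (bilDl _ _ _ (tens_bil _ _)) (bilZl _ _ _ (tens_bil _ _)).
- by rewrite !tmulrD IHy IHz scalerDr addrACA.
- rewrite !tmulrE mulrDl -scalerAl.
  by rewrite (bilDr _ _ _ (tens_bil _ _)) (bilZr _ _ _ (tens_bil _ _)).
Qed.

Notation tm := (@tmul F q : U2 -> U2 -> U2).

Lemma tmulDl : left_distributive tm +%R.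
Proof. by move=> x y z; apply: tliftD; apply: tmulr_bil. Qed.
Lemma tmulZl c x y : tm (c *: x) y = c *: tm x y.
Proof. by apply: tliftZ; apply: tmulr_bil. Qed.
Lemma tmul0l x : tm (0 : U2) x = 0.
Proof. by apply: tlift0; apply: tmulr_bil. Qed.
Lemma tmul_tens (a b : U) y : tm (tens a b) y = tmulr a b y.
Proof. by rewrite /tmul tlift_tens //; apply: tmulr_bil. Qed.
Lemma tmulDr : right_distributive tm +%R.
Proof.
move=> x y z; elim/tens_ind: x => [|x x' IH IH'|a b].
- by rewrite !tmul0l addr0.
- by rewrite !tmulDl IH IH' addrACA.
- by rewrite !tmul_tens tmulrD.
Qed.
Lemma tmulZr c x y : tm x (c *: y) = c *: (tm x y : U2).
Proof.
elim/tens_ind: x => [|x x' IH IH'|a b].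
- by rewrite !tmul0l scaler0.
- by rewrite !tmulDl IH IH' scalerDr.
- by rewrite !tmul_tens tmulrZ.
Qed.
Lemma tmul0r x : tm x (0 : U2) = 0.
Proof. by have := tmulZr 0 x 0; rewrite !scale0r. Qed.
Lemma tmulA : associative tm.
Proof.
move=> x y z; elim/tens_ind: x => [|x x' IH IH'|a b]; first by rewrite !tmul0l.
  by rewrite !tmulDl IH IH'.
elim/tens_ind: y => [|y y' IH IH'|c d]; first by rewrite tmul0l !tmul0r tmul0l.
  by rewrite tmulDl !tmulDr tmulDl IH IH'.
elim/tens_ind: z => [|z z' IH IH'|e f]; first by rewrite !tmul0r.
  by rewrite !tmulDr IH IH'.
by rewrite !(tmul_tens, tmulrE) !mulrA.
Qed.
Lemma tmul1l : left_id (tens 1 1 : U2) tm.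
Proof.
move=> x; rewrite tmul_tens; elim/tens_ind: x => [|x y IH IH'|a b].
- by rewrite tmulr0.
- by rewrite tmulrD IH IH'.
- by rewrite tmulrE !mul1r.
Qed.
Lemma tmul1r : right_id (tens 1 1 : U2) tm.
Proof.
move=> x; elim/tens_ind: x => [|x y IH IH'|a b].
- by rewrite tmul0l.
- by rewrite tmulDl IH IH'.
- by rewrite tmul_tens tmulrE !mulr1.
Qed.

Lemma counit_ext : forall t u, urel q t u ->
  teval idfun (1 : F^o) *%R (@counit_gen F) t = teval idfun (1 : F^o) *%R (@counit_gen F) u.
Proof. by move=> t u h; apply: (counit_gen_ucong (uc_rel h)). Qed.
Let cbil := @bilinear_mul F (F^o : algType F).
Lemma counitM (x y : U) : counit (x * y) = counit x * counit y.
Proof. exact: (uextM cbil (@mulrA _) (@mul1r _) (@mulr1 _) counit_ext). Qed.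
Lemma counit1 : counit (1 : U) = 1.
Proof. exact: (uext1 cbil (@mulrA _) (@mul1r _) (@mulr1 _) counit_ext). Qed.
Lemma counit_lin c x y : counit (c *: x + y : U) = c *: counit x + counit y.
Proof.
rewrite /counit (uextD cbil (@mulrA _) (@mul1r _) (@mulr1 _) counit_ext).
by rewrite (uextZ cbil (@mulrA _) (@mul1r _) (@mulr1 _) counit_ext).
Qed.
Lemma counitE g : counit (ugenE q g) = counit_gen F g.
Proof. exact: (uext_gen cbil (@mulrA _) (@mul1r _) (@mulr1 _) counit_ext). Qed.

(** The counit applied to both factors maps 1 to 1. *)
Lemma U2_one_neq0 : (tens 1 1 : U2) != 0.
Proof.
pose b (x y : U) : F^o := counit x * counit y.
have bb : bilinear_for *:%R *:%R b.
  by split=> x c u v /=; rewrite /b counit_lin ?mulrDl ?mulrDr -?scalerAl -?scalerAr.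
apply/eqP => /(congr1 (tlift b)); rewrite tlift0 // tlift_tens // /b counit1 mulr1.
by apply/eqP; apply: oner_neq0.
Qed.

HB.instance Definition _ := GRing.Zmodule_isNzRing.Build U2
  tmulA tmul1l tmul1r tmulDl tmulDr U2_one_neq0.
Lemma U2_scaleAl (c : F) (x y : U2) : c *: (x * y) = (c *: x) * y.
Proof. by rewrite -[RHS]/(tm _ _) tmulZl. Qed.
HB.instance Definition _ := GRing.Lmodule_isLalgebra.Build F U2 U2_scaleAl.
Lemma U2_scaleAr (c : F) (x y : U2) : c *: (x * y) = x * (c *: y).
Proof. by rewrite -[RHS]/(tm _ _) tmulZr. Qed.
HB.instance Definition _ := GRing.Lalgebra_isAlgebra.Build F U2 U2_scaleAr.

Definition tL (a : U) : U2 := tens a 1.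
Definition tR (a : U) : U2 := tens 1 a.
Lemma tensLR a b : tens a b = tL a * tR b.
Proof. by rewrite -[RHS]/(tm _ _) tmul_tens tmulrE mulr1 mul1r. Qed.
Lemma tRL a b : tR b * tL a = tL a * tR b.
Proof. by rewrite -tensLR -[LHS]/(tm _ _) tmul_tens tmulrE mulr1 mul1r. Qed.
Lemma tL_hom : alg_hom tL.
Proof.
split=> // [c x y|x y]; last by rewrite -[RHS]/(tm _ _) tmul_tens tmulrE mulr1.
by rewrite /tL (bilDl _ _ _ (tens_bil _ _)) (bilZl _ _ _ (tens_bil _ _)).
Qed.
Lemma tR_hom : alg_hom tR.
Proof.
split=> // [c x y|x y]; last by rewrite -[RHS]/(tm _ _) tmul_tens tmulrE mulr1.
by rewrite /tR (bilDr _ _ _ (tens_bil _ _)) (bilZr _ _ _ (tens_bil _ _)).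
Qed.
End TensorAlgebra.

Definition ncomm_rules : seq (nterm * nterm) :=
  [seq (NMul (NGen i) (NGen j), NMul (NGen j) (NGen i)) | i <- iota 12 12, j <- iota 0 12].

Section Hopf.
Variables (F : fieldType) (q : F).
Hypothesis q0 : q != 0.
Hypothesis qq : q - q^-1 != 0.
Hypothesis q2 : q + q^-1 != 0.
Notation U := (Uq q).
Notation tL := (@tL F q).
Notation tR := (@tR F q).

Lemma u2rules_hold :
  eqs_hold (aeval q (uenv tL ++ uenv tR)) (nrules 0 ++ nrules 12 ++ ncomm_rules).
Proof.
apply: eqs_hold_cat; first by apply: (nrules_hold q0 qq q2 (tL_hom q)); elim/node_ind.
apply: eqs_hold_cat; first by apply: (nrules_hold q0 qq q2 (tR_hom q)); elim/node_ind.
by do !split; apply: tRL.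
Qed.

Lemma u2rules_check l r : ncheck 60 (nrules 0 ++ nrules 12 ++ ncomm_rules) l r ->
  aeval q (uenv tL ++ uenv tR) l = aeval q (uenv tL ++ uenv tR) r.
Proof. exact: (ncheck_alg q0 qq u2rules_hold). Qed.

End Hopf.

Ltac u2_atoms q := constr:([:: tL (uE q node1); tL (uE q node2); tL (uE q node3);
  tL (uF q node1); tL (uF q node2); tL (uF q node3); tL (uK q node1); tL (uK q node2);
  tL (uK q node3); tL (uK' q node1); tL (uK' q node2); tL (uK' q node3);
  tR (uE q node1); tR (uE q node2); tR (uE q node3);
  tR (uF q node1); tR (uF q node2); tR (uF q node3); tR (uK q node1); tR (uK q node2);
  tR (uK q node3); tR (uK' q node1); tR (uK' q node2); tR (uK' q node3)]).
Ltac u2_solve q q0 qq q2 :=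
  lazymatch goal with
  | |- @eq ?A ?l ?r =>
    let env := u2_atoms q in
    let l' := nc_reify q env l in
    let r' := nc_reify q env r in
    refine (@u2rules_check _ q q0 qq q2 l' r' _);
    vm_compute; exact (erefl true)
  end.

Section Hopf2.
Variables (F : fieldType) (q : F).
Hypothesis q0 : q != 0.
Hypothesis qq : q - q^-1 != 0.
Hypothesis q2 : q + q^-1 != 0.
Notation U := (Uq q).

(** The target is again a straightening problem: the letters of the second
    factor are moved to the right of those of the first. *)
Lemma comult_rel t u : urel q t u ->
  teval idfun (1 : U2 q) *%R (@comult_gen F q) t =
  teval idfun (1 : U2 q) *%R (@comult_gen F q) u.
Proof.
have L1 : tL (1 : U) = 1 by [].
have R1 : tR (1 : U) = 1 by [].
case; apply: node_ind; try apply: node_ind; try (by []);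
  try (let h := fresh in intro h; clear h);
  rewrite /= ?tensLR ?L1 ?R1 ?(mulr1, mul1r).
all: u2_solve q q0 qq q2.
Qed.

Let U2bil := @bilinear_mul F (U2 q).
Lemma comult_hom : alg_hom (@comult F q : U -> U2 q).
Proof.
split.
- exact: (@uext1 F q (U2 q) idfun 1 *%R _ U2bil (@mulrA _) (@mul1r _) (@mulr1 _) comult_rel).
- move=> c x y; rewrite -[LHS]/(@uext F q (U2 q) idfun 1 *%R _ _).
  rewrite (uextD U2bil (@mulrA _) (@mul1r _) (@mulr1 _) comult_rel).
  by rewrite (uextZ U2bil (@mulrA _) (@mul1r _) (@mulr1 _) comult_rel).
- exact: (@uextM F q (U2 q) idfun 1 *%R _ U2bil (@mulrA _) (@mul1r _) (@mulr1 _) comult_rel).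
Qed.
Lemma comult_genE g : comult (ugenE q g) = comult_gen q g.
Proof.
exact: (@uext_gen F q (U2 q) idfun 1 *%R _ U2bil (@mulrA _) (@mul1r _) (@mulr1 _) comult_rel).
Qed.

Lemma antipode_rel t u : urel q t u ->
  teval idfun (1 : U) (fun x y => y * x) (@antipode_gen F q) t =
  teval idfun (1 : U) (fun x y => y * x) (@antipode_gen F q) u.
Proof.
case; apply: node_ind; try apply: node_ind; try (by []);
  try (let h := fresh in intro h; clear h); rewrite /=.
all: uq_solve q q0 qq q2.
Qed.

Let opbil := @bilinear_mulop F U.
Let opA : associative (fun x y : U => y * x).
Proof. by move=> x y z; rewrite mulrA. Qed.
Let op1 : left_id 1 (fun x y : U => y * x). Proof. by move=> x; rewrite mulr1. Qed.
Let op1r : right_id 1 (fun x y : U => y * x). Proof. by move=> x; rewrite mul1r. Qed.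

Lemma antipode1 : antipode (1 : U) = 1.
Proof. exact: (uext1 opbil opA op1 op1r antipode_rel). Qed.
Lemma antipode_lin c x y : antipode (c *: x + y : U) = c *: antipode x + antipode y.
Proof.
rewrite /antipode (uextD opbil opA op1 op1r antipode_rel).
by rewrite (uextZ opbil opA op1 op1r antipode_rel).
Qed.
Lemma antipodeM x y : antipode (x * y : U) = antipode y * antipode x.
Proof. exact: (uextM opbil opA op1 op1r antipode_rel). Qed.
Lemma antipodeE g : antipode (ugenE q g) = antipode_gen q g.
Proof. exact: (uext_gen opbil opA op1 op1r antipode_rel). Qed.

(** The Chevalley involution. *)
Definition omega_gen (g : ugen) : U :=
  match g with GE i => uF q i | GF i => uE q i | GK i => uK' q i | GKinv i => uK q i end.
Definition omega : U -> U := uext idfun 1 *%R omega_gen.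
Lemma omega_rel t u : urel q t u ->
  teval idfun (1 : U) *%R omega_gen t = teval idfun (1 : U) *%R omega_gen u.
Proof.
case; apply: node_ind; try apply: node_ind; try (by []);
  try (let h := fresh in intro h; clear h); rewrite /=.
all: uq_solve q q0 qq q2.
Qed.

Lemma uext_hom (A : algType F) (g : ugen -> A) :
  (forall t u, urel q t u -> teval idfun 1 *%R g t = teval idfun 1 *%R g u) ->
  alg_hom (uext id 1 *%R g : U -> A).
Proof.
move=> h; have b := @bilinear_mul F A; split.
- exact: (uext1 b (@mulrA _) (@mul1r _) (@mulr1 _) h).
- move=> c x y; rewrite (uextD b (@mulrA _) (@mul1r _) (@mulr1 _) h).
  by rewrite (uextZ b (@mulrA _) (@mul1r _) (@mulr1 _) h).
- exact: (uextM b (@mulrA _) (@mul1r _) (@mulr1 _) h).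
Qed.
Lemma uext_genE (A : algType F) (g : ugen -> A) :
  (forall t u, urel q t u -> teval idfun 1 *%R g t = teval idfun 1 *%R g u) ->
  forall x, uext id 1 *%R g (ugenE q x) = g x.
Proof.
by move=> h x; apply: (uext_gen (@bilinear_mul F A) (@mulrA _) (@mul1r _) (@mulr1 _) h).
Qed.

Lemma omega_hom : alg_hom omega. Proof. exact: uext_hom omega_rel. Qed.
Lemma omegaE g : omega (ugenE q g) = omega_gen g. Proof. exact: uext_genE omega_rel _. Qed.

End Hopf2.

(** * The adjoint action *)

Section Adjoint.
Variables (F : fieldType) (q : F).
Hypothesis q0 : q != 0.
Hypothesis qq : q - q^-1 != 0.
Hypothesis q2 : q + q^-1 != 0.
Notation U := (Uq q).

Lemma antipodeD (x y : U) : antipode (x + y) = antipode x + antipode y.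
Proof. by have := antipode_lin q0 qq q2 1 x y; rewrite !scale1r. Qed.
Lemma antipodeZ c (x : U) : antipode (c *: x) = c *: antipode x.
Proof.
have a0 : antipode (0 : U) = 0.
  by have := antipode_lin q0 qq q2 (-1) (0 : U) 0; rewrite scaler0 addr0 scaleN1r addNr.
by have := antipode_lin q0 qq q2 c x 0; rewrite a0 !addr0.
Qed.

Lemma ad_bil (y : U) : bilinear_for *:%R *:%R (fun a b : U => a * y * antipode b).
Proof.
split=> x c u v /=; first by rewrite !mulrDl -!scalerAl.
by rewrite antipodeD antipodeZ mulrDr -scalerAr.
Qed.

Lemma ad_linl c x x' (y : U) : ad (c *: x + x') y = c *: ad x y + ad x' y.
Proof.
by rewrite /ad (homD (comult_hom q0 qq q2)) (homZ (comult_hom q0 qq q2))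
  (tliftD (ad_bil y)) (tliftZ (ad_bil y)).
Qed.
Lemma ad_linr c x (y y' : U) : ad x (c *: y + y') = c *: ad x y + ad x y'.
Proof.
rewrite /ad; elim/tens_ind: (comult x) => [|u v IHu IHv|a b].
- by rewrite !(tlift0 (ad_bil _)) scaler0 addr0.
- by rewrite !(tliftD (ad_bil _)) IHu IHv scalerDr addrACA.
- rewrite !(tlift_tens (ad_bil _)).
  by rewrite mulrDr mulrDl -scalerAr -scalerAl.
Qed.
Lemma ad1 (y : U) : ad 1 y = y.
Proof.
rewrite /ad (hom1 (comult_hom q0 qq q2)) -[1]/(tens 1 1) (tlift_tens (ad_bil _)).
by rewrite antipode1 // mul1r mulr1.
Qed.
(** The antipode reverses products, so the two outer factors of the adjoint
    action compose. *)
Lemma adM x x' (y : U) : ad (x * x') y = ad x (ad x' y).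
Proof.
rewrite /ad (homM (comult_hom q0 qq q2)).
elim/tens_ind: (comult x) => [|u v IHu IHv|a b].
- by rewrite mul0r !(tlift0 (ad_bil _)).
- by rewrite mulrDl !(tliftD (ad_bil _)) IHu IHv.
rewrite (tlift_tens (ad_bil _)) -[_ * _]/(tmul _ _) tmul_tens.
elim/tens_ind: (comult x') => [|u v IHu IHv|a' b'].
- by rewrite tmulr0 !(tlift0 (ad_bil _)) mulr0 mul0r.
- by rewrite tmulrD !(tliftD (ad_bil _)) IHu IHv mulrDr mulrDl.
by rewrite tmulrE !(tlift_tens (ad_bil _)) antipodeM // !mulrA.
Qed.

Lemma ad_E i (y : U) : ad (uE q i) y = uE q i * y - uK q i * y * uK' q i * uE q i.
Proof.
rewrite /ad comult_genE //= (tliftD (ad_bil _)) !(tlift_tens (ad_bil _)).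
by rewrite antipode1 // mulr1 antipodeE //= mulrN !mulrA.
Qed.
Lemma ad_F i (y : U) : ad (uF q i) y = uF q i * y * uK q i - y * uF q i * uK q i.
Proof.
rewrite /ad comult_genE //= (tliftD (ad_bil _)) !(tlift_tens (ad_bil _)).
by rewrite !antipodeE //= mul1r mulrN !mulrA.
Qed.
Lemma ad_K i (y : U) : ad (uK q i) y = uK q i * y * uK' q i.
Proof. by rewrite /ad comult_genE //= (tlift_tens (ad_bil _)) antipodeE. Qed.
Lemma ad_K' i (y : U) : ad (uK' q i) y = uK' q i * y * uK q i.
Proof. by rewrite /ad comult_genE //= (tlift_tens (ad_bil _)) antipodeE. Qed.

Lemma ad_E_mul i (y z : U) : ad (uE q i) (y * z) =
  ad (uE q i) y * z + ad (uK q i) y * ad (uE q i) z.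
Proof. by rewrite !ad_E ad_K; nc_solve q q0 qq (uK'K q i). Qed.
Lemma ad_F_mul i (y z : U) : ad (uF q i) (y * z) =
  ad (uF q i) y * ad (uK' q i) z + y * ad (uF q i) z.
Proof. by rewrite !ad_F ad_K'; nc_solve q q0 qq (uKK' q i). Qed.
Lemma ad_K_mul i (y z : U) : ad (uK q i) (y * z) = ad (uK q i) y * ad (uK q i) z.
Proof. by rewrite !ad_K; nc_solve q q0 qq (uK'K q i). Qed.
Lemma ad_K'_mul i (y z : U) : ad (uK' q i) (y * z) = ad (uK' q i) y * ad (uK' q i) z.
Proof. by rewrite !ad_K'; nc_solve q q0 qq (uKK' q i). Qed.

End Adjoint.

(** * The four-dimensional representation of the Levi subalgebra *)

Definition levi (g : ugen) : bool :=
  match g with GE i | GF i => i != node2 | _ => true end.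

Section Levi.
Variables (F : fieldType) (q : F).
Hypothesis q0 : q != 0.
Hypothesis qq : q - q^-1 != 0.
Notation U := (Uq q).
Variables (N : lmodType F) (P : N -> Prop) (act : U -> N -> N).

(** A representation on the part P of N, for operators defined on all of N:
    the action on forms is defined for all functions on V(0), but the axioms hold
    only for the linear ones. *)
Record is_rep : Prop := IsRep {
  rep_P0 : P 0;
  repP : forall x n, P n -> P (act x n);
  repPl : forall c m n, P m -> P n -> P (c *: m + n);
  rep1 : forall n, P n -> act 1 n = n;
  repM : forall x y n, P n -> act (x * y) n = act x (act y n);
  repL : forall c x y n, P n -> act (c *: x + y) n = c *: act x n + act y n;
  repR : forall c x m n, P m -> P n -> act x (c *: m + n) = c *: act x m + act x n }.

Variable e : N.
(** A lowest weight vector with the weight of E_2 for the Levi subalgebra,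
    annihilated by E_1^2 and E_3^2. If nonzero, it generates the tensor product of
    two two-dimensional representations. *)
Record levi_lowest : Prop := LeviLowest {
  lowP : P e;
  lowF : forall i, i != node2 -> act (uF q i) e = 0;
  lowK : forall i, act (uK q i) e = q ^ cartan i node2 *: e;
  lowE : forall i, i != node2 -> act (uE q i) (act (uE q i) e) = 0 }.

(** The pair of booleans tells which of E_1 and E_3 are applied to the lowest
    weight vector. *)
Definition levi_vec (s : bool * bool) : N :=
  let n := if s.2 then act (uE q node3) e else e in
  if s.1 then act (uE q node1) n else n.

(** The coefficient and the index of the image of a basis vector: every
    generator maps basis vectors to multiples of basis vectors. *)
Definition levi_table (g : ugen) (s : bool * bool) : F * (bool * bool) :=
  match g with
  | GE i => if i == node1 then ((~~ s.1)%:R, (true, s.2)) else ((~~ s.2)%:R, (s.1, true))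
  | GF i => if i == node1 then (s.1%:R, (false, s.2)) else (s.2%:R, (s.1, false))
  | GK i => (q ^ (cartan i node1 * s.1 + cartan i node2 + cartan i node3 * s.2), s)
  | GKinv i => (q ^ (- (cartan i node1 * s.1 + cartan i node2 + cartan i node3 * s.2)), s)
  end.

Hypothesis rep : is_rep.
Hypothesis low : levi_lowest.

Lemma rep0 x : act x 0 = 0.
Proof.
have := repR rep (-1) x (rep_P0 rep) (rep_P0 rep).
by rewrite scaler0 addr0 scaleN1r addNr.
Qed.
Lemma rep0l n : P n -> act 0 n = 0.
Proof.
move=> Pn; have := repL rep (-1) 0 0 Pn.
by rewrite scaler0 addr0 scaleN1r addNr.
Qed.
Lemma repZ c x n : P n -> act x (c *: n) = c *: act x n.
Proof. by move=> Pn; have := repR rep c x Pn (rep_P0 rep); rewrite rep0 !addr0. Qed.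
Lemma repZl c x n : P n -> act (c *: x) n = c *: act x n.
Proof. by move=> Pn; have := repL rep c x 0 Pn; rewrite rep0l // !addr0. Qed.
Lemma repD x y n : P n -> act (x + y) n = act x n + act y n.
Proof. by move=> Pn; have := repL rep 1 x y Pn; rewrite !scale1r. Qed.
Lemma repN x n : P n -> act (- x) n = - act x n.
Proof. by move=> Pn; rewrite -!scaleN1r repZl. Qed.

Lemma levi_vecP s : P (levi_vec s).
Proof.
have Pe := lowP low.
by case: s => [] [] [] /=; rewrite /levi_vec /=; do ?apply: (repP rep).
Qed.

Lemma rep_K' i n c : P n -> c != 0 -> act (uK q i) n = c *: n ->
  act (uK' q i) n = c^-1 *: n.
Proof.
move=> Pn c0 h; rewrite -{1}[n]scale1r -(mulVf c0) -scalerA -h repZ; last exact: repP.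
by rewrite -repM // uK'K rep1.
Qed.

Lemma rep_KE i j n c : P n -> act (uK q i) n = c *: n ->
  act (uK q i) (act (uE q j) n) = (q ^ cartan i j * c) *: act (uE q j) n.
Proof. by move=> Pn h; rewrite -repM // uKE repZl // repM // h repZ // scalerA. Qed.

Lemma levi_K i s : act (uK q i) (levi_vec s) =
  q ^ (cartan i node1 * s.1 + cartan i node2 + cartan i node3 * s.2) *: levi_vec s.
Proof.
have Pe := lowP low; have hK := lowK low i.
case: s => [] [] [] /=; rewrite /levi_vec /= ?(mulr0, mulr1, addr0, add0r) //.
- rewrite (rep_KE _ _ (rep_KE _ Pe hK)); last exact: (repP rep).
  by rewrite -!expfzDr // addrA addrAC -addrA.
- by rewrite (rep_KE _ Pe hK) -expfzDr.
- by rewrite (rep_KE _ Pe hK) -expfzDr // addrC.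
Qed.

Lemma rep_FE i j n : P n -> act (uF q i) (act (uE q j) n) =
  act (uE q j) (act (uF q i) n) -
  ((j == i)%:R / (q - q^-1)) *: (act (uK q j) n - act (uK' q j) n).
Proof.
move=> Pn; rewrite -!repM // uEF repD // repM // repZl // repD // repN //.
by rewrite addrK.
Qed.

Lemma rep_EE n : P n ->
  act (uE q node3) (act (uE q node1) n) = act (uE q node1) (act (uE q node3) n).
Proof. by move=> Pn; rewrite -!repM // uEE0. Qed.

Lemma rep_FE_low i n : P n -> act (uF q i) n = 0 -> act (uK q i) n = q^-1 *: n ->
  act (uF q i) (act (uE q i) n) = n.
Proof.
move=> Pn hF hK; rewrite rep_FE // hF rep0 sub0r hK (rep_K' Pn _ hK) ?invr_eq0 //.
rewrite invrK eqxx mul1r -scalerBl scalerA -scaleNr -mulrN opprB mulVf //.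
by rewrite scale1r.
Qed.

(** The table follows from the lowest weight conditions alone. It is used
    twice, for the adjoint action on E_2 and for the action on the coordinate
    functions, and this common source is why the two actions match. *)
Lemma levi_tableP g s : levi g ->
  act (ugenE q g) (levi_vec s) = (levi_table g s).1 *: levi_vec (levi_table g s).2.
Proof.
have Pe := lowP low; have Pv := repP rep.
have E11 := lowE low (isT : node1 != node2); have E33 := lowE low (isT : node3 != node2).
have F1 := lowF low (isT : node1 != node2); have F3 := lowF low (isT : node3 != node2).
have FE1 : act (uF q node1) (act (uE q node3) e) = 0.
  by rewrite rep_FE // F1 rep0 mul0r scale0r subr0.
have K1 := levi_K node1; have K3 := levi_K node3.
case: g => i /=.
- move: i; apply: node_ind => // _; case: s => [] [] [] /=; rewrite /levi_vec /=
    ?scale1r ?scale0r //.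
  + by rewrite -/(uE q _) -(rep_EE Pe) -(rep_EE (Pv _ _ Pe)) E11 rep0.
  + by rewrite -/(uE q _) (rep_EE (Pv _ _ Pe)) E33 rep0.
  + by rewrite -/(uE q _) (rep_EE Pe).
- move: i; apply: node_ind => // _; case: s => [] [] [] /=; rewrite /levi_vec /=
    ?scale1r ?scale0r //; rewrite -/(uF q _).
  + by apply: rep_FE_low => //; [apply: Pv|have := K1 (false, true)].
  + by apply: rep_FE_low => //; have := K1 (false, false).
  + rewrite (rep_FE _ _ (Pv _ _ Pe)) mul0r scale0r subr0.
    by rewrite rep_FE_low //; have := K3 (false, false).
  + by rewrite rep_FE // F3 rep0 mul0r scale0r subr0.
  + by apply: rep_FE_low => //; have := K3 (false, false).
- by move=> _; apply: levi_K.
- by move=> _; rewrite -/(uK' q _) (rep_K' (levi_vecP s) _ (levi_K i s))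
  ?expfz_neq0 // invr_expz.
Qed.

End Levi.

(** * Representations given by operators *)

Section Lin.
Variables (F : fieldType) (V W : lmodType F) (f : V -> W).
Hypothesis fl : forall c u v, f (c *: u + v) = c *: f u + f v.
Lemma lin0 : f 0 = 0.
Proof. by have := fl (-1) 0 0; rewrite scaler0 addr0 scaleN1r addNr. Qed.
Lemma linZ c u : f (c *: u) = c *: f u.
Proof. by have := fl c u 0; rewrite lin0 !addr0. Qed.
Lemma linD u v : f (u + v) = f u + f v.
Proof. by have := fl 1 u v; rewrite !scale1r. Qed.
Lemma linN u : f (- u) = - f u.
Proof. by rewrite -!scaleN1r linZ. Qed.
Lemma linB u v : f (u - v) = f u - f v.
Proof. by rewrite linD linN. Qed.
End Lin.

Section RightRep.
Variables (F : fieldType) (q : F) (V : lmodType F) (P : V -> Prop) (g : ugen -> V -> V).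
Hypothesis P0 : P 0.
Hypothesis PL : forall c v w, P v -> P w -> P (c *: v + w).
Hypothesis Pg : forall x v, P v -> P (g x v).
Hypothesis gl : forall x c v w, g x (c *: v + w) = c *: g x v + g x w.

(** The product is reversed: the operators act on the right. *)
Definition rterm (t : uterm F) : V -> V :=
  teval idfun (@id V) (fun a b => b \o a) g t.

Hypothesis rel : forall t u, urel q t u -> forall v, P v -> rterm t v = rterm u v.

Lemma stableD v w : P v -> P w -> P (v + w).
Proof. by move=> Pv Pw; rewrite -[v]scale1r; apply: PL. Qed.
Lemma stableZ c v : P v -> P (c *: v).
Proof. by move=> Pv; rewrite -[_ *: _]addr0; apply: PL. Qed.

Lemma rterm_P t v : P v -> P (rterm t v).
Proof.
elim: t v => [x|||t IHt u IHu|t IHt u IHu|c t IHt] v Pv //=.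
- exact: Pg.
- by apply: stableD; [apply: IHt|apply: IHu].
- by apply: IHu; apply: IHt.
- by apply: stableZ; apply: IHt.
Qed.

Lemma rterm_lin t c v w : rterm t (c *: v + w) = c *: rterm t v + rterm t w.
Proof.
elim: t v w => [x|||t IHt u IHu|t IHt u IHu|d t IHt] v w //=.
- exact: gl.
- by rewrite -[LHS]/(0 : V) -[rterm _ v]/(0 : V) -[rterm _ w]/(0 : V) scaler0 addr0.
- rewrite -[LHS]/(rterm t _ + rterm u _) IHt IHu.
  by rewrite -[rterm (TAdd _ _) _]/(rterm t v + rterm u v) scalerDr addrACA.
- by rewrite -[LHS]/(rterm u (rterm t _)) IHt IHu.
- rewrite -[LHS]/(d *: rterm t _) IHt scalerDr.
  by rewrite -[rterm (TScale _ _) v]/(d *: rterm t v) !scalerA mulrC.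
Qed.

(** The operators need to satisfy the defining relations only on the stable
    part P, so the universal property for maps into an algebra does not apply; the
    congruence is followed rule by rule instead. *)
Lemma rterm_ucong t u : ucong q t u -> forall v, P v -> rterm t v = rterm u v.
Proof.
have D a b v : rterm (TAdd a b) v = rterm a v + rterm b v by [].
have M a b v : rterm (TMul a b) v = rterm b (rterm a v) by [].
have Z c a v : rterm (TScale c a) v = c *: rterm a v by [].
have z v : rterm TZero v = 0 by [].
have o v : rterm TOne v = v by [].
have LD a v w : rterm a (v + w) = rterm a v + rterm a w.
  by have := rterm_lin a 1 v w; rewrite !scale1r.
have LZ a c v : rterm a (c *: v) = c *: rterm a v.
  have L0 : rterm a 0 = 0 by apply: (@addrI _ (rterm a 0)); rewrite -LD !addr0.
  by have := rterm_lin a c v 0; rewrite L0 !addr0.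
elim=> {t u}; do ?[by move=> *; rewrite !(D, M, Z, z, o, LD, LZ)
  ?(addrA, add0r, scaleN1r, addNr, scalerA, scale1r, scalerDr, scalerDl)].
- by move=> t u /rel.
- by [].
- by move=> t u _ IH v Pv; rewrite IH.
- by move=> t u w _ IH1 _ IH2 v Pv; rewrite IH1 ?IH2.
- by move=> t t' u u' _ IH1 _ IH2 v Pv; rewrite !D IH1 ?IH2.
- by move=> t t' u u' _ IH1 _ IH2 v Pv; rewrite !M IH1 ?IH2 //; apply: rterm_P.
- by move=> c t t' _ IH v Pv; rewrite !Z IH.
- by move=> t u v _; rewrite !D addrC.
Qed.

Definition ract (x : Uq q) (v : V) : V := rterm (repr x) v.

Lemma ractE t v : P v -> ract (\pi_(Uq q) t) v = rterm t v.
Proof. by move=> Pv; apply: rterm_ucong => //; apply: Uq_repr. Qed.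
Lemma ract_gen x v : P v -> ract (ugenE q x) v = g x v.
Proof. exact: ractE. Qed.
Lemma ract1 v : P v -> ract 1 v = v.
Proof. exact: (ractE TOne). Qed.
Lemma ractM x y v : P v -> ract (x * y) v = ract y (ract x v).
Proof.
elim/quotW: x => x; elim/quotW: y => y Pv; rewrite -piM !ractE //.
exact: rterm_P.
Qed.
Lemma ractL c x y v : P v -> ract (c *: x + y) v = c *: ract x v + ract y v.
Proof.
elim/quotW: x => x; elim/quotW: y => y Pv.
by rewrite -piZ -piD !ractE.
Qed.
Lemma ract_P x v : P v -> P (ract x v).
Proof. exact: rterm_P. Qed.
Lemma ract_lin x c v w : ract x (c *: v + w) = c *: ract x v + ract x w.
Proof. exact: rterm_lin. Qed.
End RightRep.

(** * Functions on words *)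

Section Words.
Variables (F : fieldType) (q : F).
Hypothesis q0 : q != 0.
Hypothesis qq : q - q^-1 != 0.
Variable X : lmodType F.
Notation word := (seq 'I_3).
Notation fn := (word -> X).

(** The exponent of q in the action of K_i on the word w of the F_j applied to
    a vector of weight 0. *)
Definition wwt (i : 'I_3) (w : word) : int := \sum_(j <- w) - cartan i j.
Definition wF i (f : fn) : fn := fun w => f (i :: w).
Definition wK i (f : fn) : fn := fun w => q ^ wwt i w *: f w.
Definition wK' i (f : fn) : fn := fun w => q ^ (- wwt i w) *: f w.
(** A function on words is a linear form on the module with basis the words in
    the F_j applied to a vacuum vector of weight 0 killed by all E_i, and the
    operators are the transposes of those of this module. This one moves E_i to
    the right through the word. *)
Fixpoint wEval (i : 'I_3) (w : word) (f : fn) : X :=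
  if w is j :: w' then
    wEval i w' (wF j f) + ((i == j)%:R / (q - q^-1)) *: (wK i f w' - wK' i f w')
  else 0.
Definition wE i (f : fn) : fn := fun w => wEval i w f.

Definition wgen (g : ugen) : fn -> fn :=
  match g with GE i => wE i | GF i => wF i | GK i => wK i | GKinv i => wK' i end.

Definition wcoef (i j : 'I_3) (w : word) : F :=
  (i == j)%:R / (q - q^-1) * (q ^ wwt i w - q ^ (- wwt i w)).

Lemma wE_cons i j w f : wE i f (j :: w) = wE i (wF j f) w + wcoef i j w *: f w.
Proof. by rewrite /wE /= /wK /wK' -scalerBl scalerA. Qed.

Lemma wE_lin i c f h : wE i (c *: f + h) = c *: wE i f + wE i h.
Proof.
apply/funext => w; rewrite -[RHS]/(c *: wE i f w + wE i h w).
elim: w f h => [|j w IH] f h; first by rewrite /wE /= scaler0 addr0.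
rewrite !wE_cons -[wF j _]/(c *: wF j f + wF j h) IH.
rewrite -[(c *: f + h) w]/(c *: f w + h w) !scalerDr !scalerA [_ * c]mulrC.
by rewrite addrACA.
Qed.

Lemma wK_lin i c f h : wK i (c *: f + h) = c *: wK i f + wK i h.
Proof.
apply/funext => w; rewrite -[RHS]/(c *: wK i f w + wK i h w) /wK.
by rewrite -[(c *: f + h) w]/(c *: f w + h w) scalerDr !scalerA [_ * c]mulrC.
Qed.

Lemma wK'_lin i c f h : wK' i (c *: f + h) = c *: wK' i f + wK' i h.
Proof.
apply/funext => w; rewrite -[RHS]/(c *: wK' i f w + wK' i h w) /wK'.
by rewrite -[(c *: f + h) w]/(c *: f w + h w) scalerDr !scalerA [_ * c]mulrC.
Qed.

Lemma wgen_lin g c f h : wgen g (c *: f + h) = c *: wgen g f + wgen g h.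
Proof. by case: g => i /=; rewrite ?(wE_lin, wK_lin, wK'_lin). Qed.

Lemma wwt_cons i j w : wwt i (j :: w) = - cartan i j + wwt i w.
Proof. by rewrite /wwt big_cons. Qed.

Lemma wFK i j f : wF j (wK i f) = q ^ (- cartan i j) *: wK i (wF j f).
Proof.
apply/funext => w; rewrite -[RHS]/(_ *: wK i (wF j f) w) /wF /wK.
by rewrite wwt_cons expfzDr // scalerA.
Qed.
Lemma wFK' i j f : wF j (wK' i f) = q ^ cartan i j *: wK' i (wF j f).
Proof.
apply/funext => w; rewrite -[RHS]/(_ *: wK' i (wF j f) w) /wF /wK'.
by rewrite wwt_cons opprD opprK expfzDr // scalerA.
Qed.
Lemma wFE i j f : wF j (wE i f) =
  wE i (wF j f) + ((i == j)%:R / (q - q^-1)) *: (wK i f - wK' i f).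
Proof. by []. Qed.

Lemma wKK' i f : wK i (wK' i f) = f.
Proof. by apply/funext => w; rewrite /wK /wK' scalerA -expfzDr // addrN expr0z scale1r. Qed.
Lemma wK'K i f : wK' i (wK i f) = f.
Proof. by apply/funext => w; rewrite /wK /wK' scalerA -expfzDr // addNr expr0z scale1r. Qed.
Lemma wKK i j f : wK i (wK j f) = wK j (wK i f).
Proof. by apply/funext => w; rewrite /wK !scalerA mulrC. Qed.

Lemma fnZ c (f : fn) w : (c *: f) w = c *: f w. Proof. by []. Qed.

(** Induction on the word; the correction terms agree because they occur only
    when the letter is that of E_j, and then the two powers of q cancel. *)
Lemma wEK i j f : wE j (wK i f) = q ^ cartan i j *: wK i (wE j f).
Proof.
apply/funext => w; rewrite fnZ; elim: w f => [|k w IH] f.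
  by rewrite /wE /wK /= !scaler0.
have wEZ c h : wE j (c *: h) w = c *: wE j h w by rewrite (linZ (wE_lin j)).
rewrite wE_cons wFK wEZ IH.
rewrite -[wK i (wE j f) (k :: w)]/(q ^ wwt i (k :: w) *: wE j f (k :: w)).
rewrite wE_cons scalerDr scalerDr.
rewrite /wK !scalerA wwt_cons expfzDr //; congr (_ *: _ + _ *: _).
  by ring.
rewrite /wcoef; case: eqP => [->|_]; last by rewrite !(mul0r, mulr0).
set c := _ / _ * _; have -> : q ^ cartan i k * (q ^ (- cartan i k) * q ^ wwt i w) * c
    = (q ^ cartan i k * q ^ (- cartan i k)) * (q ^ wwt i w * c) by ring.
by rewrite -expfzDr // addrN expr0z mul1r mulrC.
Qed.

(* The operators are numbered as in the environments of the straightening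
   rules, so that only the order of the letters differs. *)
Definition wop (k : nat) : fn -> fn :=
  wgen (nth (GE node1) [:: GE node1; GE node2; GE node3; GF node1; GF node2; GF node3;
    GK node1; GK node2; GK node3; GKinv node1; GKinv node2; GKinv node3] k).

Definition wrules : seq (nterm * nterm) :=
  let nodes := [:: 0; 1; 2]%N in
  [seq (NMul (rF 0 j) (rE 0 i),
        NAdd (NMul (rE 0 i) (rF 0 j))
          (if i == j then NScale CDen (NAdd (rK 0 i) (NOpp (rK' 0 i))) else NZero))
    | i <- nodes, j <- nodes] ++
  [seq (NMul (rF 0 j) (rK 0 i), NScale (CPow (- ncart i j)) (NMul (rK 0 i) (rF 0 j)))
    | i <- nodes, j <- nodes] ++
  [seq (NMul (rF 0 j) (rK' 0 i), NScale (CPow (ncart i j)) (NMul (rK' 0 i) (rF 0 j)))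
    | i <- nodes, j <- nodes] ++
  [seq (NMul (rE 0 j) (rK 0 i), NScale (CPow (ncart i j)) (NMul (rK 0 i) (rE 0 j)))
    | i <- nodes, j <- nodes] ++
  [seq (NMul (rE 0 j) (rK' 0 i), NScale (CPow (- ncart i j)) (NMul (rK' 0 i) (rE 0 j)))
    | i <- nodes, j <- nodes].

Lemma wopE (i : 'I_3) : (wop i = wE i) * (wop (3 + i) = wF i) *
  (wop (6 + i) = wK i) * (wop (9 + i) = wK' i).
Proof. by elim/node_ind: i. Qed.

Lemma wEK' i j f : wE j (wK' i f) = q ^ (- cartan i j) *: wK' i (wE j f).
Proof.
rewrite -[RHS]/(_ *: wK' i (wE j _)) -[in RHS](wKK' i f) wEK (linZ (wK'_lin i)) wK'K scalerA.
by rewrite -expfzDr // addNr expr0z scale1r.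
Qed.

Lemma wrules_hold f : eqs_hold (fun t => neval q wop t f) wrules.
Proof.
apply: eqs_hold_cat.
  apply: hold9 => i j /=; rewrite add0n !wopE wFE; congr (_ + _).
  have -> : (i == j) = (i == j :> nat) by [].
  by case: eqP => _ /=; rewrite ?wopE ?mul1r ?mul0r ?scale0r.
apply: eqs_hold_cat.
  by apply: hold9 => i j /=; rewrite !wopE ncartE wFK.
apply: eqs_hold_cat.
  by apply: hold9 => i j /=; rewrite !wopE ncartE wFK'.
apply: eqs_hold_cat.
  by apply: hold9 => i j /=; rewrite !wopE ncartE wEK.
by apply: hold9 => i j /=; rewrite !wopE ncartE wEK'.
Qed.

Lemma wrules_check l r : ncheck 60 wrules l r ->
  forall f, neval q wop l f = neval q wop r f.
Proof.
move=> chk f; apply: (ncheckP q0 qq (P := fun _ => True)) chk _ _ => // [k c g h|g _];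
  first exact: wgen_lin.
exact: wrules_hold.
Qed.

Definition wserre (x y : fn -> fn) (a : int) (f : fn) : fn :=
  if a == 0 then y (x f) - x (y f)
  else if a == -1 then
    y (x (x f)) + (- (q + q^-1)) *: x (y (x f)) + x (x (y f))
  else 0.
Definition tserre (x y : nterm) (a : int) : nterm :=
  if a == 0 then NAdd (NMul y x) (NOpp (NMul x y))
  else if a == -1 then
    NAdd (NAdd (NMul y (NMul x x)) (NScale (COpp (CAdd CVar CInv)) (NMul x (NMul y x))))
      (NMul x (NMul x y))
  else NZero.

Definition serreE i j := wserre (wE i) (wE j) (cartan i j).
Definition serreF i j := wserre (wF i) (wF j) (cartan i j).

(** The rules for the right action straighten both sides to the same
    expression, in each of the 27 cases. *)
Lemma serreF_E i j k f : serreF i j (wE k f) = wE k (serreF i j f).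
Proof.
have := @wrules_check (NMul (tserre (rF 0 i) (rF 0 j) (ncart i j)) (rE 0 k))
  (NMul (rE 0 k) (tserre (rF 0 i) (rF 0 j) (ncart i j))).
rewrite /serreF; move: i j k; do 3!apply: node_ind; move=> /(_ (erefl true) f) h; exact: h.
Qed.

Lemma serreE_F i j k f : wF k (serreE i j f) = serreE i j (wF k f).
Proof.
have := @wrules_check (NMul (rF 0 k) (tserre (rE 0 i) (rE 0 j) (ncart i j)))
  (NMul (tserre (rE 0 i) (rE 0 j) (ncart i j)) (rF 0 k)).
rewrite /serreE; move: i j k; do 3!apply: node_ind; move=> /(_ (erefl true) f) h; exact: h.
Qed.

Lemma wserre_lin x y a : (forall c f h, x (c *: f + h) = c *: x f + x h) ->
  (forall c f h, y (c *: f + h) = c *: y f + y h) ->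
  forall c f h, wserre x y a (c *: f + h) = c *: wserre x y a f + wserre x y a h.
Proof.
move=> xl yl c f h; rewrite /wserre; case: ifP => _.
  by rewrite !(xl, yl) scalerBr opprD addrACA.
case: ifP => _; last by rewrite scaler0 addr0.
rewrite !(xl, yl) !scalerDr !scalerA [_ * c]mulrC.
by rewrite [X in X + _ = _]addrACA [LHS]addrACA.
Qed.

Lemma wF_lin i c f h : wF i (c *: f + h) = c *: wF i f + wF i h. Proof. by []. Qed.

(** The Serre element in the E_i commutes with all F_k and kills the vacuum,
    so it vanishes on all functions. Only the Serre relations in the F_i restrict
    the functions. *)
Lemma serreE0 i j f : serreE i j f = 0.
Proof.
apply/funext => w; elim: w f => [|k w IH] f; last by rewrite -[LHS]/(wF k (serreE i j f) w) serreE_F IH.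
rewrite /serreE /wserre; case: ifP => _; first by rewrite -[LHS]/(0 - 0 : X) subr0.
case: ifP => // _.
by rewrite -[LHS]/((0 : X) + _ *: (0 : X) + 0) scaler0 !addr0.
Qed.

Lemma serreF_K i j k f : exists c, serreF i j (wK k f) = c *: wK k (serreF i j f).
Proof.
pose n := -(ncart k i * (if ncart i j == 0 then 1 else 2) + ncart k j).
have := @wrules_check (NMul (tserre (rF 0 i) (rF 0 j) (ncart i j)) (rK 0 k))
  (NScale (CPow n) (NMul (rK 0 k) (tserre (rF 0 i) (rF 0 j) (ncart i j)))).
rewrite /serreF /n; move: i j k @n; do 3!apply: node_ind; move=> n /(_ (erefl true) f) h;
  eexists; exact: h.
Qed.
Lemma serreF_K' i j k f : exists c, serreF i j (wK' k f) = c *: wK' k (serreF i j f).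
Proof.
pose n := (ncart k i * (if ncart i j == 0 then 1 else 2) + ncart k j).
have := @wrules_check (NMul (tserre (rF 0 i) (rF 0 j) (ncart i j)) (rK' 0 k))
  (NScale (CPow n) (NMul (rK' 0 k) (tserre (rF 0 i) (rF 0 j) (ncart i j)))).
rewrite /serreF /n; move: i j k @n; do 3!apply: node_ind; move=> n /(_ (erefl true) f) h;
  eexists; exact: h.
Qed.

Definition wFs (a : word) (f : fn) : fn := fun w => f (a ++ w).

(** The functions that vanish on the two-sided ideal of the Serre relations.
    On them the relations in the F_i hold, and they form a stable subspace
    since the Serre elements commute with the E_k, and with the K_k up to a
    scalar. *)
Definition serre_fn (f : fn) : Prop := forall a i j, serreF i j (wFs a f) = 0.

Lemma serreF_lin i j c f h :
  serreF i j (c *: f + h) = c *: serreF i j f + serreF i j h.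
Proof. exact: (wserre_lin _ (wF_lin i) (wF_lin j)). Qed.

Lemma serre_fn0 : serre_fn 0.
Proof. by move=> a i j; rewrite -[wFs a 0]/(0 : fn) (lin0 (serreF_lin i j)). Qed.
Lemma serre_fnL c f h : serre_fn f -> serre_fn h -> serre_fn (c *: f + h).
Proof.
move=> Pf Ph a i j; rewrite -[wFs a _]/(c *: wFs a f + wFs a h).
by rewrite serreF_lin Pf Ph scaler0 addr0.
Qed.
Lemma serre_fnF k f : serre_fn f -> serre_fn (wF k f).
Proof. by move=> Pf a i j; have := Pf (k :: a) i j. Qed.
Lemma serre_fnK k f : serre_fn f -> serre_fn (wK k f).
Proof.
move=> Pf a; elim: a f Pf => [|b a IH] f Pf i j.
  have [c h] := serreF_K i j k f; rewrite -[wFs _ _]/(wK k f) h.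
  by rewrite (Pf [::] i j : serreF i j f = 0) (lin0 (wK_lin k)) scaler0.
rewrite -[wFs _ _]/(wFs a (wF b (wK k f))) wFK.
rewrite -[wFs a _]/(_ *: wFs a (wK k (wF b f))) (linZ (serreF_lin i j)) IH ?scaler0 //.
exact: serre_fnF.
Qed.
Lemma serre_fnK' k f : serre_fn f -> serre_fn (wK' k f).
Proof.
move=> Pf a; elim: a f Pf => [|b a IH] f Pf i j.
  have [c h] := serreF_K' i j k f; rewrite -[wFs _ _]/(wK' k f) h.
  by rewrite (Pf [::] i j : serreF i j f = 0) (lin0 (wK'_lin k)) scaler0.
rewrite -[wFs _ _]/(wFs a (wF b (wK' k f))) wFK'.
rewrite -[wFs a _]/(_ *: wFs a (wK' k (wF b f))) (linZ (serreF_lin i j)) IH ?scaler0 //.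
exact: serre_fnF.
Qed.
Lemma serre_fnE k f : serre_fn f -> serre_fn (wE k f).
Proof.
move=> Pf a; elim: a f Pf => [|b a IH] f Pf i j.
  rewrite -[wFs _ _]/(wE k f) serreF_E (Pf [::] i j : serreF i j f = 0).
  exact: lin0 (wE_lin k).
rewrite -[wFs _ _]/(wFs a (wF b (wE k f))) wFE addrC.
rewrite -[wFs a _]/(_ *: (wFs a (wK k f) - wFs a (wK' k f)) + wFs a (wE k (wF b f))).
rewrite serreF_lin IH ?addr0; last exact: serre_fnF.
by rewrite (linB (serreF_lin i j)) serre_fnK // serre_fnK' // subrr scaler0.
Qed.
Lemma serre_fn_gen x f : serre_fn f -> serre_fn (wgen x f).
Proof. by case: x => i /= h; [exact: serre_fnE|exact: serre_fnF|exact: serre_fnK|exact: serre_fnK']. Qed.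

Lemma wrel t u : urel q t u -> forall f, serre_fn f -> rterm wgen t f = rterm wgen u f.
Proof.
have D a b v : rterm wgen (TAdd a b) v = rterm wgen a v + rterm wgen b v by [].
have M a b v : rterm wgen (TMul a b) v = rterm wgen b (rterm wgen a v) by [].
have Z c a v : rterm wgen (TScale c a) v = c *: rterm wgen a v by [].
have z v : rterm wgen TZero v = 0 by [].
have o v : rterm wgen TOne v = v by [].
have G x v : rterm wgen (TGen x) v = wgen x v by [].
case=> {t u} [i|i|i j|i j|i j|i j|i j h|i j h|i j h|i j h] f Pf;
  rewrite !(D, M, Z, z, o, G) /= ?scaleN1r.
- exact: wK'K.
- exact: wKK'.
- exact: wKK.
- exact: wEK.
- exact: wFK.
- by rewrite wFE addrC addKr.
- have := serreE0 i j f; rewrite /serreE /wserre h eqxx.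
  by move=> /eqP; rewrite subr_eq0 => /eqP.
- have := Pf [::] i j; rewrite -[wFs _ _]/f /serreF /wserre h eqxx.
  by move=> /eqP; rewrite subr_eq0 => /eqP.
- by have := serreE0 i j f; rewrite /serreE /wserre h.
- by have := Pf [::] i j; rewrite -[wFs _ _]/f /serreF /wserre h.
Qed.

(** The right action of the quantum group on functions on words that vanish on
    the Serre ideal: the full dual of the Verma module of highest weight 0,
    obtained without a basis of that module. *)
Definition word_act : Uq q -> fn -> fn := ract wgen.
Lemma word_act_gen x f : serre_fn f -> word_act (ugenE q x) f = wgen x f.
Proof. exact: (ract_gen serre_fn0 serre_fnL serre_fn_gen wgen_lin wrel). Qed.
Lemma word_act1 f : serre_fn f -> word_act 1 f = f.
Proof. exact: (ract1 serre_fn0 serre_fnL serre_fn_gen wgen_lin wrel). Qed.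
Lemma word_actM x y f : serre_fn f -> word_act (x * y) f = word_act y (word_act x f).
Proof. exact: (ractM serre_fn0 serre_fnL serre_fn_gen wgen_lin wrel). Qed.
Lemma word_actL c x y f : serre_fn f ->
  word_act (c *: x + y) f = c *: word_act x f + word_act y f.
Proof. exact: (ractL serre_fn0 serre_fnL serre_fn_gen wgen_lin wrel). Qed.
Lemma word_actP x f : serre_fn f -> serre_fn (word_act x f).
Proof. exact: (ract_P serre_fn0 serre_fnL serre_fn_gen). Qed.
End Words.

(** * Maps out of the positive part *)

Section Induced.
Variables (F : fieldType) (q : F).
Hypothesis q0 : q != 0.
Hypothesis qq : q - q^-1 != 0.
Hypothesis q2 : q + q^-1 != 0.
Notation U := (Uq q).
Variables (X : lmodType F) (op : 'I_3 -> X -> X) (x0 : X) (P : X -> Prop).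
Hypothesis opl : forall i c v w, op i (c *: v + w) = c *: op i v + op i w.
Hypothesis Pop : forall i v, P v -> P (op i v).
Hypothesis Px0 : P x0.
Hypothesis op_serre0 : forall i j v, P v -> cartan i j = 0 -> op i (op j v) = op j (op i v).
Hypothesis op_serre1 : forall i j v, P v -> cartan i j = -1 ->
  op i (op i (op j v)) - (q + q^-1) *: op i (op j (op i v)) + op j (op i (op i v)) = 0.

Definition op_word (w : seq 'I_3) : X := foldr op x0 w.

(** The Serre relations of the operators, applied in the middle of a word. *)
Lemma op_word_serre : serre_fn q op_word.
Proof.
have P' w : P (op_word w) by elim: w => [//|i w IH]; apply: Pop.
have Z i := linZ (opl i); have D i := linD (opl i); have O i := lin0 (opl i).
move=> a i j; apply/funext => w; rewrite -[RHS]/(0 : X) /serreF /wserre.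
have opB k u v : op k (u - v) = op k u - op k v by apply: linB (opl k) _ _.
case: eqP => [h|_].
  rewrite -[LHS]/(op_word (a ++ [:: i, j & w]) - op_word (a ++ [:: j, i & w])).
  elim: a => [|k a IH] /=; last by rewrite -opB IH O.
  by rewrite op_serre0 // subrr.
case: eqP => // h.
rewrite -[LHS]/(op_word (a ++ [:: i, i, j & w])
  + (- (q + q^-1)) *: op_word (a ++ [:: i, j, i & w]) + op_word (a ++ [:: j, i, i & w])).
elim: a => [|k a IH] /=; last by rewrite -Z -!D IH O.
by rewrite scaleNr op_serre1.
Qed.

(** If the operators op satisfy the Serre relations, the words in them applied
    to x0 form a function on words, and x is mapped to the value of this function
    at omega(x) applied to the vacuum. A word in the E_i is mapped to the same
    word in the operators, and multiples of F_i on the right are killed since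
    omega maps F_i to E_i. This takes the place of the isomorphism of U+ with the
    algebra generated by the E_i and the Serre relations, and of the triangular
    decomposition. *)
Definition induced (x : U) : X := word_act (omega x) op_word [::].

(** The action on functions uses only their linear structure, so it commutes
    with linear maps between the spaces of values. *)
Lemma word_act_comp (f : X -> X) (x : U) (h : seq 'I_3 -> X) :
  (forall c v w, f (c *: v + w) = c *: f v + f w) ->
  word_act x (f \o h) = f \o word_act x h.
Proof.
move=> fl; rewrite /word_act /ract.
elim: (repr x) h => [g|||t IHt u IHu|t IHt u IHu|c t IHt] h //=.
- case: g => i //=; apply/funext => w /=.
  + rewrite /wE; elim: w h => [|j w IH] h /=; first by rewrite (lin0 fl).
    rewrite (linD fl) (linZ fl) (linB fl) -IH /wK /wK' /= !(linZ fl).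
    by [].
  + by rewrite /wK /= (linZ fl).
  + by rewrite /wK' /= (linZ fl).
- by apply/funext => w /=; rewrite -[LHS]/(0 : X) -[rterm _ _ _ _]/(0 : X) (lin0 fl).
- apply/funext => w; rewrite -[LHS]/(rterm (wgen q (X:=X)) t (f \o h) w
     + rterm (wgen q (X:=X)) u (f \o h) w) IHt IHu /=.
  by rewrite -(linD fl).
- by rewrite -[LHS]/(rterm (wgen q (X:=X)) u (rterm (wgen q (X:=X)) t (f \o h))) IHt IHu.
- apply/funext => w; rewrite -[LHS]/(c *: rterm (wgen q (X:=X)) t (f \o h) w) IHt /=.
  by rewrite -(linZ fl).
Qed.

Lemma induced_lin c x y : induced (c *: x + y) = c *: induced x + induced y.
Proof.
rewrite /induced (homD (omega_hom q0 qq q2)) (homZ (omega_hom q0 qq q2)).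
by rewrite (word_actL q0 qq) //; apply: op_word_serre.
Qed.

Lemma induced1 : induced 1 = x0.
Proof.
by rewrite /induced (hom1 (omega_hom q0 qq q2)) (word_act1 q0 qq) //; apply: op_word_serre.
Qed.

Lemma induced_E i x : induced (uE q i * x) = op i (induced x).
Proof.
rewrite /induced (homM (omega_hom q0 qq q2)) omegaE //=.
rewrite (word_actM q0 qq); last exact: op_word_serre.
rewrite (word_act_gen q0 qq) /=; last exact: op_word_serre.
by rewrite -[wF i op_word]/(op i \o op_word) word_act_comp.
Qed.

Lemma induced_F i x : induced (x * uF q i) = 0.
Proof.
rewrite /induced (homM (omega_hom q0 qq q2)) omegaE //=.
rewrite (word_actM q0 qq); last exact: op_word_serre.
rewrite (word_act_gen q0 qq) //.
by apply: word_actP => //; apply: op_word_serre.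
Qed.
End Induced.

(** * Generated subalgebras *)

Section Subalg.
Local Open Scope classical_set_scope.
Variables (F : fieldType).

Lemma subalg_gen_is (A : lalgType F) (G : set A) : is_subalg (subalg_gen G).
Proof.
split=> [S [[]]//|c x y hx hy S [SA SG]|x y hx hy S [SA SG]]; have [S1 SL SM] := SA.
  by apply: SL; [exact: hx|exact: hy].
by apply: SM; [exact: hx|exact: hy].
Qed.
Lemma subalg_gen_sub (A : lalgType F) (G : set A) : G `<=` subalg_gen G.
Proof. by move=> x Gx S [_]; apply. Qed.
Lemma subalg_gen_min (A : lalgType F) (G S : set A) :
  is_subalg S -> G `<=` S -> subalg_gen G `<=` S.
Proof. by move=> SA SG x; apply. Qed.

Section Closure.
Variables (A : lalgType F) (S : set A).
Hypothesis SA : is_subalg S.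
Lemma subalg1 : S 1. Proof. by case: SA. Qed.
Lemma subalgM x y : S x -> S y -> S (x * y). Proof. by case: SA => _ _; apply. Qed.
Lemma subalgL c x y : S x -> S y -> S (c *: x + y). Proof. by case: SA => _ + _; apply. Qed.
Lemma subalg0 : S 0.
Proof. by have := subalgL (-1) subalg1 subalg1; rewrite scaleN1r addNr. Qed.
Lemma subalgD x y : S x -> S y -> S (x + y).
Proof. by move=> Sx Sy; rewrite -[x]scale1r; apply: subalgL. Qed.
Lemma subalgZ c x : S x -> S (c *: x).
Proof. by move=> Sx; rewrite -[_ *: _]addr0; apply: subalgL => //; apply: subalg0. Qed.
Lemma subalgB x y : S x -> S y -> S (x - y).
Proof. by move=> Sx Sy; apply: subalgD => //; rewrite -scaleN1r; apply: subalgZ. Qed.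
End Closure.
End Subalg.

Section Sets.
Local Open Scope classical_set_scope.
Variables (F : fieldType) (q : F).
Hypothesis q0 : q != 0.
Hypothesis qq : q - q^-1 != 0.
Hypothesis q2 : q + q^-1 != 0.
Notation U := (Uq q).

Lemma Uplus_is : is_subalg (@Uplus F q). Proof. exact: subalg_gen_is. Qed.
Lemma Uplus_E i : Uplus (uE q i). Proof. by apply: subalg_gen_sub; exists i. Qed.

Lemma U0_gen (S : set U) : is_subalg S -> (forall g, levi g -> S (ugenE q g)) ->
  @U0 F q `<=` S.
Proof.
move=> SA Sg; apply: subalg_gen_min => // x [[[[i _ <-]|[i _ <-]]|]|].
- exact: Sg (GK i) isT.
- exact: Sg (GKinv i) isT.
- by move=> [i [->|->] <-]; apply: Sg (GE _) _.
- by move=> [i [->|->] <-]; apply: Sg (GF _) _.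
Qed.
Lemma U0_E i : i != node2 -> U0 (uE q i).
Proof.
move=> h; apply: subalg_gen_sub; left; right; exists i => //.
by elim/node_ind: i h => // _; [left|right].
Qed.
Lemma U0_is : is_subalg (@U0 F q). Proof. exact: subalg_gen_is. Qed.

(** The construction above for the left multiplications by the E_i on U
    itself. *)
Lemma Uplus_tautological : exists f : U -> U,
  [/\ forall c x y, f (c *: x + y) = c *: f x + f y,
      forall x, Uplus x -> f x = x & forall i x, f (x * uF q i) = 0].
Proof.
pose op i (x : U) := uE q i * x.
have opl i c v w : op i (c *: v + w) = c *: op i v + op i w.
  by rewrite /op mulrDr -scalerAr.
have s0 i j v : True -> cartan i j = 0 -> op i (op j v) = op j (op i v).
  by move=> _ h; rewrite /op !mulrA uEE0.
have s1 i j v : True -> cartan i j = -1 -> op i (op i (op j v))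
    - (q + q^-1) *: op i (op j (op i v)) + op j (op i (op i v)) = 0.
  by move=> _ h; rewrite /op !mulrA uEE1 // mulrBl -scalerAl addrAC subrK subrr.
pose f : U -> U := induced op 1.
have E := induced_E q0 qq q2 opl (fun _ _ _ => I) I s0 s1.
have fl c x y : f (c *: x + y) = c *: f x + f y.
  exact: (induced_lin q0 qq q2 opl (fun _ _ _ => I) I s0 s1).
have f1 : f 1 = 1 := induced1 q0 qq q2 opl (fun _ _ _ => I) I s0 s1.
exists f; split=> //.
  move=> x Ux.
  suff h : forall y, f (x * y) = x * f y.
    by rewrite -[in LHS](mulr1 x) h f1 mulr1.
  move: x Ux; apply: subalg_gen_min => [|_ [i _ <-] y]; last exact: E.
  split=> [y|c x x' hx hx' y|x x' hx hx' y]; first by rewrite !mul1r.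
    by rewrite mulrDl -scalerAl fl hx hx' mulrDl scalerAl.
  by rewrite -!mulrA hx hx'.
exact: (induced_F q0 qq q2 opl (fun _ _ _ => I) I s0 s1).
Qed.

Lemma ad_rep : is_rep (fun _ => True) (@ad F q).
Proof.
split=> // [n _|x y n _|c x y n _|c x m n _ _].
- exact: ad1.
- exact: adM.
- exact: ad_linl.
- exact: ad_linr.
Qed.

Lemma ad_low : levi_lowest (fun _ => True) (@ad F q) (uE q node2).
Proof.
split=> //.
- apply: node_ind => // _; rewrite ad_F //; uq_solve q q0 qq q2.
- by apply: node_ind; rewrite ad_K //; uq_solve q q0 qq q2.
- by apply: node_ind => // _; rewrite !ad_E //; uq_solve q q0 qq q2.
Qed.

Definition zU (s : bool * bool) : U := levi_vec (@ad F q) (uE q node2) s.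
(** This is the algebra generated by the orbit of E_2 under the Levi
    subalgebra, with the orbit replaced by a basis of its span. *)
Definition Zalg : set U := subalg_gen (range zU).

Lemma Zalg_is : is_subalg Zalg. Proof. exact: subalg_gen_is. Qed.
Lemma Zalg_z s : Zalg (zU s). Proof. by apply: subalg_gen_sub; exists s. Qed.

Lemma ad_zU g s : levi g ->
  ad (ugenE q g) (zU s) = (levi_table q g s).1 *: zU (levi_table q g s).2.
Proof. exact: levi_tableP ad_rep ad_low _ _. Qed.

Lemma ad_one g : levi g -> ad (ugenE q g) 1 = (counit_gen F g : F) *: (1 : U).
Proof.
case: g => i _ /=; rewrite ?scale0r ?scale1r.
- by rewrite ad_E // !mulr1 uKK' mul1r subrr.
- by rewrite ad_F // mulr1 mul1r subrr.
- by rewrite ad_K // mulr1 uKK'.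
- by rewrite ad_K' // mulr1 uK'K.
Qed.

(** The Levi subalgebra acts on products through the coproduct, and on the
    four generators by the table. *)
Lemma Zalg_ad_gen g x : levi g -> Zalg x -> Zalg (ad (ugenE q g) x).
Proof.
have [Z1 ZL ZM] := Zalg_is.
suff h : Zalg `<=` [set x | Zalg x /\ forall g, levi g -> Zalg (ad (ugenE q g) x)].
  by move=> lg /h[_]; apply.
apply: subalg_gen_min => [|_ [s _ <-]]; last first.
  split=> [|{}g lg]; first exact: Zalg_z.
  by rewrite ad_zU //; apply: (subalgZ Zalg_is); apply: Zalg_z.
split=> [|c y z [Zy hy] [Zz hz]|y z [Zy hy] [Zz hz]].
- by split=> // {}g lg; rewrite ad_one //; apply: (subalgZ Zalg_is).
- by split=> [|{}g lg]; [exact: ZL|rewrite ad_linr //; apply: ZL; [exact: hy|exact: hz]].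
- split=> [|{}g lg]; first exact: ZM.
  case: g lg => i lg.
  + rewrite ad_E_mul //; apply: (subalgD Zalg_is); apply: ZM => //.
    * exact: (hy (GE i)).
    * exact: (hy (GK i)).
    * exact: (hz (GE i)).
  + rewrite ad_F_mul //; apply: (subalgD Zalg_is); apply: ZM => //.
    * exact: (hy (GF i)).
    * exact: (hz (GKinv i)).
    * exact: (hz (GF i)).
  + by rewrite ad_K_mul //; apply: ZM; [exact: (hy (GK i))|exact: (hz (GK i))].
  + by rewrite ad_K'_mul //; apply: ZM; [exact: (hy (GKinv i))|exact: (hz (GKinv i))].
Qed.

Lemma Zalg_ad xi x : U0 xi -> Zalg x -> Zalg (ad xi x).
Proof.
move=> h Zx; move: xi h x Zx; apply: U0_gen => [|g lg x Zx]; last exact: Zalg_ad_gen.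
split=> [x Zx|c a b ha hb x Zx|a b ha hb x Zx].
- by rewrite ad1.
- by rewrite ad_linl //; apply: (subalgL Zalg_is); [exact: ha|exact: hb].
- by rewrite adM //; apply: ha; apply: hb.
Qed.

Lemma CgI_setE : subalg_gen [set ad xi (uE q node2) | xi in @U0 F q] = Zalg.
Proof.
apply/seteqP; split; apply: subalg_gen_min; try exact: subalg_gen_is.
  move=> _ [xi hxi <-]; apply: Zalg_ad => //.
  exact: (Zalg_z (false, false)).
move=> _ [s _ <-]; apply: subalg_gen_sub.
have U1 := subalg1 U0_is; have UM := subalgM U0_is.
case: s => a b; exists ((if a then uE q node1 else 1) * (if b then uE q node3 else 1)).
  by apply: UM; [case: a|case: b] => //; apply: U0_E.
by rewrite adM // /zU /levi_vec /=; case: a; case: b => //; rewrite ?ad1.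
Qed.

(** On a weight vector of the adjoint action ad E_i is a q-commutator with
    E_i, so it preserves U+. *)
Lemma Zalg_Uplus : Zalg `<=` @Uplus F q.
Proof.
apply: subalg_gen_min => [|_ [s _ <-]]; first exact: Uplus_is.
have UB := subalgB Uplus_is; have UM := subalgM Uplus_is; have UZ := subalgZ Uplus_is.
have h i x c : Uplus x -> uK q i * x * uK' q i = c *: x -> Uplus (ad (uE q i) x).
  move=> Ux hx; rewrite ad_E // hx.
  by apply: UB; rewrite -?scalerAl; [|apply: UZ]; apply: UM => //; apply: Uplus_E.
have hK i t c : levi_table q (GK i) t = (c, t) -> uK q i * zU t * uK' q i = c *: zU t.
  by move=> e; rewrite -ad_K // ad_zU // e.
have z00 : Uplus (zU (false, false)) by apply: Uplus_E.
have z01 : Uplus (zU (false, true)).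
  exact: (h _ _ _ z00 (hK node3 (false, false) _ erefl)).
case: s => [] [] [] //.
  exact: (h _ _ _ z01 (hK node1 (false, true) _ erefl)).
exact: (h _ _ _ z00 (hK node1 (false, false) _ erefl)).
Qed.
End Sets.

(** * The Lusztig automorphisms *)

Section Lusztig.
Local Open Scope classical_set_scope.
Variables (F : fieldType) (q : F).
Hypothesis q0 : q != 0.
Hypothesis qq : q - q^-1 != 0.
Hypothesis q2 : q + q^-1 != 0.
Variable bar : {rmorphism F -> F}.
Hypothesis bar_q : bar q = q^-1.
Notation U := (Uq q).

Lemma bar_pow e : bar (q ^ e) = q ^ (- e).
Proof.
case: e => n; first by rewrite -exprnP rmorphXn bar_q exprVn -exprnN.
by rewrite NegzE opprK -exprnN fmorphV rmorphXn bar_q exprVn invrK.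
Qed.

Lemma bar_den : bar (q - q^-1)^-1 = - (q - q^-1)^-1.
Proof. by rewrite fmorphV rmorphB fmorphV bar_q invrK -opprB invrN. Qed.

(** Being a bar-semilinear antiautomorphism is compatible with the relations
    because bar inverts q and changes the sign of q - q^-1. *)
Lemma kconj_rel t u : urel q t u ->
  teval bar (1 : U) (fun x y => y * x) (@kconj_gen F q) t =
  teval bar (1 : U) (fun x y => y * x) (@kconj_gen F q) u.
Proof.
case; apply: node_ind; try apply: node_ind; try (by []);
  try (let h := fresh in intro h; clear h);
  rewrite /= ?rmorphN1 ?bar_pow ?rmorphM ?bar_den ?rmorph_nat ?rmorphN ?rmorphD
    ?fmorphV ?bar_q ?invrK.
all: uq_solve q q0 qq q2.
Qed.

(** The images of the generators, computed: k reverses the q-commutators and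
    inverts q. *)
Definition Tgen (i : 'I_3) (g : ugen) : U :=
  match g with
  | GE j => if i == j then - (uF q i * uK q i)
            else if j == node2 then - (uE q i * uE q j - q^-1 *: (uE q j * uE q i))
            else uE q j
  | GF j => if i == j then - (uK' q i * uE q i)
            else if j == node2 then - (uF q j * uF q i - q *: (uF q i * uF q j))
            else uF q j
  | GK j => if i == j then uK' q i else if j == node2 then uK q j * uK q i else uK q j
  | GKinv j => if i == j then uK q i else if j == node2 then uK' q j * uK' q i
               else uK' q j
  end.

Lemma Tgen_rel i : i != node2 -> forall t u, urel q t u ->
  teval idfun (1 : U) *%R (Tgen i) t = teval idfun (1 : U) *%R (Tgen i) u.
Proof.
move=> hi t u h; move: i hi; apply: node_ind => // _; move: h;
case; apply: node_ind; try apply: node_ind; try (by []);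
  try (let h := fresh in intro h; clear h); rewrite /=.
all: uq_solve q q0 qq q2.
Qed.

Let opbil := @bilinear_mulop F U.
Let opA : associative (fun x y : U => y * x).
Proof. by move=> x y z; rewrite mulrA. Qed.
Let op1 : left_id 1 (fun x y : U => y * x). Proof. by move=> x; rewrite mulr1. Qed.
Let op1r : right_id 1 (fun x y : U => y * x). Proof. by move=> x; rewrite mul1r. Qed.

Lemma kconjM (x y : U) : kconj bar (x * y) = kconj bar y * kconj bar x.
Proof. exact: (uextM opbil opA op1 op1r kconj_rel). Qed.
Lemma kconjD (x y : U) : kconj bar (x + y) = kconj bar x + kconj bar y.
Proof. exact: (uextD opbil opA op1 op1r kconj_rel). Qed.
Lemma kconjZ c (x : U) : kconj bar (c *: x) = bar c *: kconj bar x.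
Proof. exact: (uextZ opbil opA op1 op1r kconj_rel). Qed.
Lemma kconjN (x : U) : kconj bar (- x) = - kconj bar x.
Proof. by rewrite -scaleN1r kconjZ rmorphN1 scaleN1r. Qed.
Lemma kconjE g : kconj bar (ugenE q g) = kconj_gen q g.
Proof. exact: (uext_gen opbil opA op1 op1r kconj_rel). Qed.

Lemma lusztigE_Tgen i j : i != node2 -> lusztigE q i j = Tgen i (GE j).
Proof.
move: i j; apply: node_ind => //; apply: node_ind => // _;
  rewrite -[lusztigE _ _ _]/(- ad _ _) ad_E //=; uq_solve q q0 qq q2.
Qed.

Lemma lusztig_gen_Tgen i g : i != node2 -> lusztig_gen q bar i g = Tgen i g.
Proof.
move=> hi; case: g => j; first exact: lusztigE_Tgen.
- rewrite -[LHS]/(kconj bar (lusztigE q i j)) lusztigE_Tgen //.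
  have E k := kconjE (GE k); have F' k := kconjE (GF k); have K k := kconjE (GK k).
  by rewrite /Tgen; do ![case: ifP => _]; rewrite ?kconjN ?kconjD ?kconjN ?kconjZ
    ?kconjM ?E ?F' ?K ?fmorphV ?bar_q ?invrK.
- move: i j hi; apply: node_ind => //; apply: node_ind => // _;
    rewrite /= ?expr2 ?expr1 ?expr0 ?mulr1; uq_solve q q0 qq q2.
- move: i j hi; apply: node_ind => //; apply: node_ind => // _;
    rewrite /= ?expr2 ?expr1 ?expr0 ?mulr1; uq_solve q q0 qq q2.
Qed.

Lemma lusztig_rel i : i != node2 -> forall t u, urel q t u ->
  teval idfun (1 : U) *%R (lusztig_gen q bar i) t =
  teval idfun (1 : U) *%R (lusztig_gen q bar i) u.
Proof.
move=> hi; have -> : lusztig_gen q bar i = Tgen i by apply/funext => g; apply: lusztig_gen_Tgen.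
exact: Tgen_rel.
Qed.

Lemma lusztig_hom i : i != node2 -> alg_hom (lusztig bar i : U -> U).
Proof. by move=> hi; apply: uext_hom (lusztig_rel hi). Qed.
Lemma lusztig_E i j : i != node2 -> lusztig bar i (uE q j) = Tgen i (GE j).
Proof. by move=> hi; rewrite -lusztig_gen_Tgen //; apply: uext_genE (lusztig_rel hi) _. Qed.
Lemma lusztig_F i j : i != node2 -> lusztig bar i (uF q j) = Tgen i (GF j).
Proof. by move=> hi; rewrite -lusztig_gen_Tgen //; apply: uext_genE (lusztig_rel hi) _. Qed.
Lemma lusztig_K i j : i != node2 -> lusztig bar i (uK q j) = Tgen i (GK j).
Proof. by move=> hi; rewrite -lusztig_gen_Tgen //; apply: uext_genE (lusztig_rel hi) _. Qed.

Notation T := (Tw0' bar : U -> U).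
Let l1 := lusztig_hom (isT : node1 != node2).
Let l3 := lusztig_hom (isT : node3 != node2).

Lemma Tw0'_hom : alg_hom T.
Proof.
by split=> [|c x y|x y]; rewrite /Tw0' ?(hom1 l3, hom1 l1) ?(homM l3, homM l1)
  ?(homD l3, homZ l3) ?(homD l1, homZ l1).
Qed.

Lemma Tw0'_E1 : T (uE q node1) = - (uF q node1 * uK q node1).
Proof. by rewrite /Tw0' lusztig_E //= lusztig_E. Qed.
Lemma Tw0'_E3 : T (uE q node3) = - (uF q node3 * uK q node3).
Proof. by rewrite /Tw0' lusztig_E //= (homN l1) (homM l1) lusztig_F // lusztig_K. Qed.
Lemma Tw0'_E2 : T (uE q node2) = zU q (true, true).
Proof.
rewrite /Tw0' lusztig_E //= (homN l1) (homD l1) (homN l1) (homZ l1) !(homM l1).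
by rewrite !lusztig_E //= /zU /levi_vec /= !ad_E //; uq_solve q q0 qq q2.
Qed.

(** On a weight vector y, ad F_i (y) is a combination of F_i K_i y and y F_i
    K_i. *)
Lemma adF_closed (S : set U) i y c : is_subalg S -> S y -> S (uF q i * uK q i) ->
  c != 0 -> ad (uK q i) y = c *: y -> S (ad (uF q i) y).
Proof.
move=> SA Sy SF c0; rewrite ad_K // ad_F // => h.
have e : uK q i * y = c *: (y * uK q i) by rewrite scalerAl -h -[RHS]mulrA uK'K mulr1.
have -> : uF q i * y * uK q i = c^-1 *: (uF q i * uK q i * y).
  by rewrite -(mulrA (uF q i) (uK q i)) e -scalerAr scalerA mulVf // scale1r mulrA.
rewrite -[y * _ * _]mulrA; apply: (subalgB SA); last exact: (subalgM SA).
by apply: (subalgZ SA); apply: (subalgM SA).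
Qed.

(** The image of T contains z_11 = T(E_2) and F_i K_i = - T(E_i) for i = 1, 3,
    and ad F_1 and ad F_3 lower z_11 to the other generators. *)
Lemma Zalg_Tw0' : @Zalg F q `<=` T @` @Uplus F q.
Proof.
have Th := Tw0'_hom; have UA := @Uplus_is F q.
have SA : is_subalg (T @` @Uplus F q).
  split=> [|c _ _ [x Ux <-] [y Uy <-]|_ _ [x Ux <-] [y Uy <-]].
  - by exists 1; [exact: subalg1 UA|rewrite (hom1 Th)].
  - by exists (c *: x + y); [exact: (subalgL UA)|rewrite (homD Th) (homZ Th)].
  - by exists (x * y); [exact: (subalgM UA)|rewrite (homM Th)].
have S11 : (T @` @Uplus F q) (zU q (true, true)).
  by exists (uE q node2); [exact: Uplus_E|exact: Tw0'_E2].
have SF i : i != node2 -> (T @` @Uplus F q) (uF q i * uK q i).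
  move=> hi; exists (- uE q i); first by rewrite -scaleN1r; apply: (subalgZ UA); exact: Uplus_E.
  by move: i hi; apply: node_ind => // _; rewrite (homN Th) ?Tw0'_E1 ?Tw0'_E3 opprK.
have step i s c t : i != node2 -> (T @` @Uplus F q) (zU q s) ->
    levi_table q (GF i) s = (c, t) -> c = 1 -> (T @` @Uplus F q) (zU q t).
  move=> hi Ss e c1; have := ad_zU q0 qq q2 s (hi : levi (GF i)).
  rewrite e /= c1 scale1r => <-; apply: (adF_closed SA Ss (SF _ hi) _ _);
    last exact: (ad_zU q0 qq q2 s (isT : levi (GK i))).
  exact: expfz_neq0.
have S01 := step node1 _ _ _ isT S11 erefl erefl.
have S10 := step node3 _ _ _ isT S11 erefl erefl.
have S00 := step node1 _ _ _ isT S10 erefl erefl.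
by apply: subalg_gen_min => // _ [[[] []] _ <-].
Qed.

(** The subspace W = Z + U F_1 + U F_3 is stable under the left
    multiplications by T(E_1), T(E_3) and T(E_2) = z_11: the factors F_i K_i are
    moved to the right through Z by the adjoint action. So T(U+) is contained in
    W. The tautological map of U+ kills U F_1 + U F_3 and fixes Z and U+, hence
    the elements of W in U+ are in Z. *)
Lemma Tw0'_Uplus_Zalg : @Uplus F q `&` (T @` @Uplus F q) `<=` @Zalg F q.
Proof.
have Th := Tw0'_hom; have ZA := @Zalg_is F q.
pose W := [set x : U | exists y a b, Zalg y /\ x = y + a * uF q node1 + b * uF q node3].
have WL c x y : W x -> W y -> W (c *: x + y).
  move=> [y1 [a1 [b1 [Z1 ->]]]] [y2 [a2 [b2 [Z2 ->]]]].
  exists (c *: y1 + y2), (c *: a1 + a2), (c *: b1 + b2); split; first exact: (subalgL ZA).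
  by rewrite !scalerDr !mulrDl !scalerAl [LHS]addrACA [X in X + _ = _]addrACA.
have WF i x : i != node2 -> W x -> W (uF q i * uK q i * x).
  move=> hi [y [a [b [Zy ->]]]].
  pose y' := ad (uK q i) y.
  have Zy' : Zalg y' by apply: (Zalg_ad_gen q0 qq q2 (isT : levi (GK i))).
  have Zy'' : Zalg (ad (uF q i) y') by apply: (Zalg_ad_gen q0 qq q2 (hi : levi (GF i))).
  have E : uF q i * uK q i * y = ad (uF q i) y' + q ^ 2 *: (y' * uK q i * uF q i).
    rewrite ad_F // /y' ad_K //; have e := uK'_F q0 i i; rewrite /cartan eqxx in e.
    nc_solve q q0 qq (uK'K q i, e).
  move: hi Zy'' E; move: (ad (uF q i) y') => y'' hi Zy'' E.
  have -> : uF q i * uK q i * (y + a * uF q node1 + b * uF q node3) =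
    y'' + (uF q i * uK q i * a) * uF q node1 + (uF q i * uK q i * b) * uF q node3
      + (q ^ 2 *: (y' * uK q i)) * uF q i by nc_solve q q0 qq E.
  have D u u' v (w : U) : u * w + v * w + u' * w = (u + v + u') * w by rewrite !mulrDl.
  clearbody y'; move: i hi {E} (_ *: _) (_ * _ * a) (_ * _ * b); apply: node_ind => // _ d a' b'.
    by exists y'', (a' + d), b'; split=> //; nc_solve q q0 qq tt.
  by exists y'', a', (b' + d); split=> //; nc_solve q q0 qq tt.
move=> x [Ux [u Uu ux]].
have h : @Uplus F q `<=` [set v | forall w, W w -> W (T v * w)].
  apply: subalg_gen_min.
    split=> [w Ww|c v v' hv hv' w Ww|v v' hv hv' w Ww].
    - by rewrite (hom1 Th) mul1r.
    - rewrite (homD Th) (homZ Th) mulrDl -scalerAl.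
      by apply: WL; [exact: hv|exact: hv'].
    - by rewrite (homM Th) -mulrA; apply: hv; apply: hv'.
  move=> _ [i _ <-] w Ww; move: i; apply: node_ind.
  - rewrite Tw0'_E1 mulNr -scaleN1r -[_ *: _]addr0; apply: WL; first exact: WF.
    by exists 0, 0, 0; split; [exact: subalg0 ZA|rewrite !mul0r !addr0].
  - rewrite Tw0'_E2; have [y [a [b [Zy ->]]]] := Ww.
    exists (zU q (true, true) * y), (zU q (true, true) * a), (zU q (true, true) * b).
    split; first by apply: (subalgM ZA) => //; apply: Zalg_z.
    by nc_solve q q0 qq tt.
  - rewrite Tw0'_E3 mulNr -scaleN1r -[_ *: _]addr0; apply: WL; first exact: WF.
    by exists 0, 0, 0; split; [exact: subalg0 ZA|rewrite !mul0r !addr0].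
have W1 : W 1 by exists 1, 0, 0; split; [exact: subalg1 ZA|rewrite !mul0r !addr0].
have := h u Uu 1 W1; rewrite mulr1 ux => -[y [a [b [Zy e]]]].
have [f [fl fU fF]] := Uplus_tautological q0 qq q2.
suff -> : x = y by [].
rewrite -(fU x Ux) e !(linD fl) !fF !addr0; apply: fU.
exact: (Zalg_Uplus q0 qq q2).
Qed.

Lemma CgII_setE : @Uplus F q `&` (T @` @Uplus F q) = @Zalg F q.
Proof.
apply/seteqP; split; first exact: Tw0'_Uplus_Zalg.
by move=> x Zx; split; [exact: (Zalg_Uplus q0 qq q2)|exact: Zalg_Tw0'].
Qed.

Lemma CgI_CgII : CgI q = CgII q bar.
Proof. by rewrite /CgI /CgII CgI_setE // CgII_setE. Qed.
End Lusztig.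

(** * Ordered monomials *)

Section Monomials.
Variables (F : fieldType) (A : algType F).
Variables (a b c d : A).

Definition exps : Type := (nat * nat * nat * nat)%type.
Definition mon (n : exps) : A :=
  let: (n1, n2, n3, n4) := n in a ^+ n1 * b ^+ n2 * c ^+ n3 * d ^+ n4.

Variables (s1 s2 s3 s4 s5 s6 s7 : F).
Hypothesis ba : b * a = s1 *: (a * b).
Hypothesis ca : c * a = s2 *: (a * c).
Hypothesis cb : c * b = s3 *: (b * c).
Hypothesis da : d * a = s4 *: (a * d) + s5 *: (b * c).
Hypothesis db : d * b = s6 *: (b * d).
Hypothesis dc : d * c = s7 *: (c * d).

Definition mon_span (x : A) : Prop :=
  exists s : seq (F * exps), x = \sum_(p <- s) p.1 *: mon p.2.

Lemma mon_spanL k x y : mon_span x -> mon_span y -> mon_span (k *: x + y).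
Proof.
move=> [s ->] [t ->]; exists ([seq (k * p.1, p.2) | p <- s] ++ t).
rewrite big_cat big_map scaler_sumr /=; congr (_ + _).
by apply: eq_bigr => p _; rewrite scalerA.
Qed.
Lemma mon_span_mon n : mon_span (mon n).
Proof. by exists [:: (1, n)]; rewrite big_seq1 scale1r. Qed.
Lemma mon_span0 : mon_span 0.
Proof. by exists [::]; rewrite big_nil. Qed.
Lemma mon_spanZ k x : mon_span x -> mon_span (k *: x).
Proof. by move=> h; rewrite -[_ *: _]addr0; apply: mon_spanL => //; apply: mon_span0. Qed.

Lemma mon_span_mull g x : (forall n, mon_span (g * mon n)) -> mon_span x -> mon_span (g * x).
Proof.
move=> h [s ->]; rewrite mulr_sumr; elim: s => [|p s IH]; first by rewrite big_nil; apply: mon_span0.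
by rewrite big_cons -scalerAr; apply: mon_spanL.
Qed.

Lemma qcomm_exp (g x : A) s n : g * x = s *: (x * g) -> g * x ^+ n = s ^+ n *: (x ^+ n * g).
Proof.
move=> h; elim: n => [|n IH]; first by rewrite !expr0 mulr1 mul1r scale1r.
by rewrite !exprS mulrA h -scalerAl -(mulrA x g) IH -scalerAr scalerA mulrA.
Qed.

Lemma mon_a n : mon_span (a * mon n).
Proof.
case: n => [[[n1 n2] n3] n4].
by have := mon_span_mon (n1.+1, n2, n3, n4); rewrite /mon exprS !mulrA.
Qed.
Lemma mon_b n : mon_span (b * mon n).
Proof.
case: n => [[[n1 n2] n3] n4] /=; rewrite !mulrA (qcomm_exp _ ba) -!scalerAl.
apply: mon_spanZ; have := mon_span_mon (n1, n2.+1, n3, n4).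
by rewrite /mon exprS !mulrA.
Qed.
Lemma mon_c n : mon_span (c * mon n).
Proof.
case: n => [[[n1 n2] n3] n4] /=; rewrite !mulrA (qcomm_exp _ ca) -!scalerAl.
apply: mon_spanZ; rewrite -(mulrA _ c) (qcomm_exp _ cb) -scalerAr -!scalerAl.
apply: mon_spanZ; have := mon_span_mon (n1, n2, n3.+1, n4).
by rewrite /mon exprS !mulrA.
Qed.
(** Moving d through a power of a creates b c, of the same total degree, at
    each step; the induction on this power absorbs it. *)
Lemma mon_d n : mon_span (d * mon n).
Proof.
case: n => [[[n1 n2] n3] n4] /=; elim: n1 => [|n1 IH].
  rewrite expr0 mul1r !mulrA (qcomm_exp _ db) -!scalerAl.
  apply: mon_spanZ; rewrite -(mulrA _ d) (qcomm_exp _ dc) -scalerAr -!scalerAl.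
  apply: mon_spanZ; have := mon_span_mon (0, n2, n3, n4.+1)%N.
  by rewrite /mon expr0 mul1r exprS !mulrA.
have -> : d * (a ^+ n1.+1 * b ^+ n2 * c ^+ n3 * d ^+ n4) =
    s4 *: (a * (d * mon (n1, n2, n3, n4))) + s5 *: (b * (c * mon (n1, n2, n3, n4))).
  rewrite exprS /= !mulrA da mulrDl mulrDl mulrDl mulrDl.
  by rewrite -!scalerAl.
apply: mon_spanL; first by apply: mon_span_mull mon_a IH.
by apply: mon_spanZ; apply: mon_span_mull mon_b _; apply: mon_c.
Qed.

(** The span of the ordered monomials is stable under left multiplication by
    the generators and contains 1. *)
Lemma mon_span_subalg (G : set A) :
  (forall x, G x -> x = a \/ x = b \/ x = c \/ x = d) ->
  forall x, subalg_gen G x -> mon_span x.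
Proof.
move=> hG x Gx.
have h : (subalg_gen G `<=` [set x | forall y, mon_span y -> mon_span (x * y)])%classic.
  apply: subalg_gen_min => [|g /hG[->|[->|[->|->]]] y hy].
  - split=> [y hy|k u v hu hv y hy|u v hu hv y hy]; first by rewrite mul1r.
      by rewrite mulrDl -scalerAl; apply: mon_spanL; [exact: hu|exact: hv].
    by rewrite -mulrA; apply: hu; apply: hv.
  - exact: mon_span_mull mon_a hy.
  - exact: mon_span_mull mon_b hy.
  - exact: mon_span_mull mon_c hy.
  - exact: mon_span_mull mon_d hy.
rewrite -[x]mulr1; apply: h => //.
by have := mon_span_mon (0, 0, 0, 0)%N; rewrite /mon !expr0 !mulr1.
Qed.

Lemma mon_span_uniq x : mon_span x ->
  exists (t : seq exps) (k : exps -> F), uniq t /\ x = \sum_(n <- t) k n *: mon n.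
Proof.
move=> [s ->]; elim: s => [|[k0 n0] s [t [k [ut e]]]].
  by exists [::], (fun _ => 0); rewrite !big_nil.
rewrite big_cons e; have [n0t|n0t] := boolP (n0 \in t); last first.
  exists (n0 :: t), (fun n => if n == n0 then k0 else k n); rewrite /= n0t ut; split=> //.
  rewrite big_cons eqxx; congr (_ + _); apply: eq_big_seq => n nt.
  by case: eqP => // en; rewrite -en nt in n0t.
exists t, (fun n => if n == n0 then k0 + k n else k n); split=> //.
rewrite !(bigD1_seq n0) //= eqxx scalerDl addrA; congr (_ + _).
by apply: eq_bigr => n /negPf->.
Qed.
End Monomials.

Section Zmon.
Local Open Scope classical_set_scope.
Variables (F : fieldType) (q : F).
Hypothesis q0 : q != 0.
Hypothesis qq : q - q^-1 != 0.
Hypothesis q2 : q + q^-1 != 0.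
Notation U := (Uq q).

Definition zmon : exps -> U :=
  mon (zU q (true, true)) (zU q (true, false)) (zU q (false, true)) (zU q (false, false)).

(** The four generators satisfy the relations of quantum two by two matrices.
    *)
Lemma Zalg_span x : Zalg x -> mon_span (zU q (true, true)) (zU q (true, false))
   (zU q (false, true)) (zU q (false, false)) x.
Proof.
have E s : zU q s = levi_vec (@ad F q) (uE q node2) s by [].
apply: (@mon_span_subalg _ _ _ _ _ _ q^-1 q^-1 1 1 (q^-1 - q) q^-1 q^-1).
1-6: rewrite !E /levi_vec /= !ad_E //; uq_solve q q0 qq q2.
by move=> _ [[[] []] _ <-]; auto.
Qed.
End Zmon.

(** * Linear forms on the generalized Verma module *)

Section Forms.
Local Open Scope classical_set_scope.
Variables (F : fieldType) (q : F).
Hypothesis q0 : q != 0.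
Hypothesis qq : q - q^-1 != 0.
Hypothesis q2 : q + q^-1 != 0.
Notation U := (Uq q).
Notation V := (V0 q).
Notation V2 := (tensor V V).
Notation form := (V -> F^o).

Let piV (x : U) : V := \pi_(lquot (@V0_relators F q)) x.

Lemma V0_ind (P : V -> Prop) : (forall x, P (piV x)) -> forall v, P v.
Proof. by move=> h v; rewrite -[v](reprK (v : lquot (@V0_relators F q))); apply: h. Qed.

Lemma V0act_pi (x y : U) : V0act x (piV y) = piV (x * y).
Proof. exact: lquot_actE. Qed.
Lemma piVD x y : piV (x + y) = piV x + piV y.
Proof. by rewrite /piV -lquot_piD. Qed.
Lemma piVZ c x : piV (c *: x) = c *: piV x.
Proof. by rewrite -[c *: piV x]/(lquot_act c%:A (piV x)) lquot_actE mulr_algl. Qed.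
Lemma piV1 : piV 1 = v0 q. Proof. by []. Qed.
Lemma piV0 (x : U) : lideal_gen (@V0_relators F q) x -> piV x = 0.
Proof. by move=> h; apply/lquotP; rewrite subr0. Qed.

Lemma V0act_linl c x y (v : V) : V0act (c *: x + y) v = c *: V0act x v + V0act y v.
Proof.
elim/V0_ind: v => z.
by rewrite !V0act_pi mulrDl piVD -scalerAl piVZ.
Qed.
Lemma V0act_linr x c (v w : V) : V0act x (c *: v + w) = c *: V0act x v + V0act x w.
Proof.
elim/V0_ind: v => y; elim/V0_ind: w => z.
by rewrite -piVZ -piVD !V0act_pi mulrDr -scalerAr piVD piVZ.
Qed.
Lemma V0actM x y (v : V) : V0act (x * y) v = V0act x (V0act y v).
Proof. by elim/V0_ind: v => z; rewrite !V0act_pi mulrA. Qed.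
Lemma V0act1 (v : V) : V0act 1 v = v.
Proof. by elim/V0_ind: v => z; rewrite V0act_pi mul1r. Qed.
Definition V0actZ x := linZ (V0act_linr x).
Definition V0act0 x := lin0 (V0act_linr x).
Lemma V0actZl c x (v : V) : V0act (c *: x) v = c *: V0act x v.
Proof. exact: (linZ (fun c x y => V0act_linl c x y v)). Qed.
Lemma V0actDl x y (v : V) : V0act (x + y) v = V0act x v + V0act y v.
Proof. exact: (linD (fun c x y => V0act_linl c x y v)). Qed.
Lemma V0actNl x (v : V) : V0act (- x) v = - V0act x v.
Proof. exact: (linN (fun c x y => V0act_linl c x y v)). Qed.

Lemma lideal_in (x : U) : V0_relators x -> piV x = 0.
Proof. by move=> h; apply: piV0 => J [_]; apply. Qed.
Lemma v0_E i : V0act (uE q i) (v0 q) = 0.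
Proof. by rewrite V0act_pi mulr1 lideal_in //; left; exists i. Qed.
Lemma v0_K i : V0act (uK q i) (v0 q) = v0 q.
Proof.
rewrite V0act_pi mulr1 -[uK q i](subrK 1) piVD (_ : piV (uK q i - 1) = 0) ?add0r //.
by apply: lideal_in; right; left; exists i.
Qed.
Lemma v0_K' i : V0act (uK' q i) (v0 q) = v0 q.
Proof. by rewrite -{1}(v0_K i) -V0actM uK'K V0act1. Qed.
Lemma v0_F i : i != node2 -> V0act (uF q i) (v0 q) = 0.
Proof. by move=> h; rewrite V0act_pi mulr1 lideal_in //; right; right; exists i. Qed.

Definition Fword (w : seq 'I_3) : V := foldr (fun i => V0act (uF q i)) (v0 q) w.
Inductive Fspan : V -> Prop :=
| Fspan_word w : Fspan (Fword w)
| Fspan_0 : Fspan 0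
| Fspan_lin c v w : Fspan v -> Fspan w -> Fspan (c *: v + w).

Lemma FspanZ c v : Fspan v -> Fspan (c *: v).
Proof. by move=> h; rewrite -[_ *: _]addr0; apply: Fspan_lin => //; apply: Fspan_0. Qed.

Lemma Fword_K i w : V0act (uK q i) (Fword w) = q ^ wwt i w *: Fword w.
Proof.
elim: w => [|j w IH] /=; first by rewrite v0_K /wwt big_nil expr0z scale1r.
by rewrite -V0actM uKF V0actZl V0actM IH V0actZ scalerA wwt_cons expfzDr.
Qed.
Lemma Fword_K' i w : V0act (uK' q i) (Fword w) = q ^ (- wwt i w) *: Fword w.
Proof.
elim: w => [|j w IH] /=; first by rewrite v0_K' /wwt big_nil oppr0 expr0z scale1r.
by rewrite -V0actM uK'_F // V0actZl V0actM IH V0actZ scalerA wwt_cons opprD opprK expfzDr.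
Qed.

(** E_i moves to the right through a word in the F_j until it kills the
    generator. *)
Lemma Fspan_all v : Fspan v.
Proof.
have gen x w : Fspan (V0act (ugenE q x) (Fword w)).
  case: x => i.
  - elim: w => [|j w IH] /=; first by rewrite v0_E; apply: Fspan_0.
    rewrite -V0actM uEF V0actDl V0actM V0actZl addrC; apply: Fspan_lin.
      rewrite V0actDl V0actNl Fword_K Fword_K' -scaleNr; apply: Fspan_lin; first exact: Fspan_word.
      by apply: FspanZ; apply: Fspan_word.
    elim: IH => [u||c u u' _ h _ h']; first exact: (Fspan_word (j :: u)).
      by rewrite V0act0; apply: Fspan_0.
    by rewrite V0act_linr; apply: Fspan_lin.
  - exact: (Fspan_word (i :: w)).
  - by rewrite Fword_K; apply: FspanZ; apply: Fspan_word.
  - by rewrite Fword_K'; apply: FspanZ; apply: Fspan_word.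
have h x u : Fspan u -> Fspan (V0act x u).
  elim/Uq_ind: x u => [x|||x y hx hy|x y hx hy|c x hx] u hu //.
  - elim: hu => [w||c u1 u2 _ h1 _ h2]; first exact: gen.
      by rewrite V0act0; apply: Fspan_0.
    by rewrite V0act_linr; apply: Fspan_lin.
  - by rewrite -[0](scale0r (1 : U)) V0actZl scale0r; apply: Fspan_0.
  - by rewrite V0act1.
  - by rewrite V0actDl -[V0act x u]scale1r; apply: Fspan_lin; [exact: hx|exact: hy].
  - by rewrite V0actM; apply: hx; apply: hy.
  - by rewrite V0actZl; apply: FspanZ; apply: hx.
elim/V0_ind: v => x; rewrite -[x]mulr1 -V0act_pi; apply: h.
exact: (Fspan_word [::]).
Qed.

Definition LF (f : form) : Prop := forall c v w, f (c *: v + w) = c *: f v + f w.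
(** The transposed operators act on the right. *)
Definition pre (f : form) (x : U) : form := fun v => f (V0act x v).

Lemma LF_pre f x : LF f -> LF (pre f x).
Proof. by move=> fl c v w; rewrite /pre V0act_linr fl. Qed.
Lemma LF_lin c f g : LF f -> LF g -> LF (c *: f + g).
Proof.
move=> fl gl k v w; rewrite -[LHS]/(c *: f (k *: v + w) + g (k *: v + w)) fl gl.
rewrite -[(_ + _) v]/(c *: f v + g v) -[(_ + _) w]/(c *: f w + g w).
rewrite !scalerDr addrACA !scalerA; congr (_ + _ + (_ + _)); by rewrite mulrC.
Qed.
Lemma LF0 : LF 0.
Proof. by move=> c v w; rewrite -[RHS]/(c *: (0 : F^o) + 0) scaler0 addr0. Qed.
Lemma preM f x y : pre f (x * y) = pre (pre f x) y.
Proof. by apply/funext => v; rewrite /pre V0actM. Qed.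
Lemma preZ f c x : LF f -> pre f (c *: x) = c *: pre f x.
Proof. by move=> fl; apply/funext => v; rewrite /pre V0actZl (linZ fl). Qed.
Lemma preD f x y : LF f -> pre f (x + y) = pre f x + pre f y.
Proof. by move=> fl; apply/funext => v; rewrite /pre V0actDl (linD fl). Qed.
Lemma preN f x : LF f -> pre f (- x) = - pre f x.
Proof. by move=> fl; apply/funext => v; rewrite /pre V0actNl (linN fl). Qed.
Lemma pre1 f : pre f 1 = f.
Proof. by apply/funext => v; rewrite /pre V0act1. Qed.

Lemma form_ext f g : LF f -> LF g -> (forall w, f (Fword w) = g (Fword w)) -> f = g.
Proof.
move=> fl gl h; apply/funext => v.
elim: (Fspan_all v) => [w||c u u' _ h1 _ h2]; first exact: h.
  by rewrite (lin0 fl) (lin0 gl).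
by rewrite fl gl h1 h2.
Qed.
(** The main tool for equations between forms: the transposes of the F_i
    satisfy a twisted Leibniz rule, so both sides can be compared by induction on
    words. *)
Lemma form_eq f g : LF f -> LF g -> f (v0 q) = g (v0 q) ->
  (forall i, pre f (uF q i) = pre g (uF q i)) -> f = g.
Proof.
move=> fl gl h0 h; apply: form_ext => // -[|i w] //=.
exact: (congr1 (fun u : form => u (Fword w)) (h i)).
Qed.

(** * The product of forms *)

Lemma V0tens_bil (a b : U) :
  bilinear_for *:%R *:%R (fun v w : V => tens (V0act b v) (V0act a w) : V2).
Proof.
split=> x c y z /=; rewrite V0act_linr.
  by rewrite (bilDl _ _ _ (tens_bil _ _)) (bilZl _ _ _ (tens_bil _ _)).
by rewrite (bilDr _ _ _ (tens_bil _ _)) (bilZr _ _ _ (tens_bil _ _)).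
Qed.
Definition V0pair (a b : U) (t : V2) : V2 :=
  tlift (fun v w : V => tens (V0act b v) (V0act a w)) t.
Lemma V0pair_lin a b c t t' : V0pair a b (c *: t + t') = c *: V0pair a b t + V0pair a b t'.
Proof. by rewrite /V0pair (tliftD (V0tens_bil a b)) (tliftZ (V0tens_bil a b)). Qed.
Lemma V0pairE a b v w : V0pair a b (tens v w) = tens (V0act b v) (V0act a w).
Proof. exact: tlift_tens (V0tens_bil a b) _ _. Qed.
Lemma V0pair_bil t : bilinear_for *:%R *:%R (fun a b => V0pair a b t).
Proof.
split=> x c u v /=; elim/tens_ind: t => [|y z IHy IHz|y z];
  rewrite ?(lin0 (V0pair_lin _ _)) ?scaler0 ?addr0 //.
- by rewrite !(linD (V0pair_lin _ _)) IHy IHz scalerDr addrACA.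
- rewrite !V0pairE V0act_linl.
  by rewrite (bilDr _ _ _ (tens_bil _ _)) (bilZr _ _ _ (tens_bil _ _)).
- by rewrite !(linD (V0pair_lin _ _)) IHy IHz scalerDr addrACA.
- rewrite !V0pairE V0act_linl.
  by rewrite (bilDl _ _ _ (tens_bil _ _)) (bilZl _ _ _ (tens_bil _ _)).
Qed.

Lemma V0act2_linl c (x y : U) (t : V2) : V0act2 (c *: x + y) t = c *: V0act2 x t + V0act2 y t.
Proof.
rewrite /V0act2 (homD (comult_hom q0 qq q2)) (homZ (comult_hom q0 qq q2)).
by rewrite (tliftD (V0pair_bil t)) (tliftZ (V0pair_bil t)).
Qed.
Lemma V0act2_linr (x : U) c (t t' : V2) : V0act2 x (c *: t + t') = c *: V0act2 x t + V0act2 x t'.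
Proof.
rewrite /V0act2; elim/tens_ind: (comult x) => [|u v IHu IHv|a b].
- by rewrite !(tlift0 (V0pair_bil _)) scaler0 addr0.
- by rewrite !(tliftD (V0pair_bil _)) IHu IHv scalerDr addrACA.
- by rewrite !(tlift_tens (V0pair_bil _)) V0pair_lin.
Qed.
Lemma V0act2_1 (t : V2) : V0act2 (1 : U) t = t.
Proof.
rewrite /V0act2 (hom1 (comult_hom q0 qq q2)) -[1]/(tens 1 1) (tlift_tens (V0pair_bil _)).
elim/tens_ind: t => [|u v IHu IHv|a b].
- exact: lin0 (V0pair_lin _ _).
- by rewrite (linD (V0pair_lin _ _)) IHu IHv.
- by rewrite V0pairE !V0act1.
Qed.
Lemma V0act2M (x y : U) (t : V2) : V0act2 (x * y) t = V0act2 x (V0act2 y t).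
Proof.
rewrite /V0act2 (homM (comult_hom q0 qq q2)).
elim/tens_ind: (comult x) => [|u v IHu IHv|a b].
- by rewrite mul0r !(tlift0 (V0pair_bil _)).
- by rewrite mulrDl !(tliftD (V0pair_bil _)) IHu IHv.
rewrite (tlift_tens (V0pair_bil _)) -[_ * _]/(tmul _ _) tmul_tens.
elim/tens_ind: (comult y) => [|u v IHu IHv|a' b'].
- by rewrite tmulr0 !(tlift0 (V0pair_bil _)) (lin0 (V0pair_lin _ _)).
- by rewrite tmulrD !(tliftD (V0pair_bil _)) IHu IHv (linD (V0pair_lin _ _)).
rewrite tmulrE !(tlift_tens (V0pair_bil _)).
elim/tens_ind: t => [|u v IHu IHv|v w].
- by rewrite !(lin0 (V0pair_lin _ _)).
- by rewrite !(linD (V0pair_lin _ _)) IHu IHv.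
- by rewrite !V0pairE !V0actM.
Qed.
Lemma V0act2E g (t : V2) : V0act2 (ugenE q g) t =
  match g with
  | GE i => V0pair (uE q i) 1 t + V0pair (uK q i) (uE q i) t
  | GF i => V0pair (uF q i) (uK' q i) t + V0pair 1 (uF q i) t
  | GK i => V0pair (uK q i) (uK q i) t
  | GKinv i => V0pair (uK' q i) (uK' q i) t
  end.
Proof.
rewrite /V0act2 comult_genE //; case: g => i /=;
by rewrite ?(tliftD (V0pair_bil t)) !(tlift_tens (V0pair_bil t)).
Qed.

(** The vector v0 tensor v0 satisfies the relations of the generator, so x v0
    has x (v0 tensor v0) as its image. *)
Lemma V0comult_pi x : V0comult (piV x) = V0act2 x (tens (v0 q) (v0 q)).
Proof.
set t := tens _ _.
have tl := fun c x y => V0act2_linl c x y t.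
suff h : forall y, lideal_gen (@V0_relators F q) y -> V0act2 y t = 0.
  rewrite /V0comult -/t; apply/eqP; rewrite -subr_eq0 -(linB tl); apply/eqP.
  by apply: h; apply: lquot_repr.
move=> y /(_ [set u | V0act2 u t = 0]); apply; split.
  split; first exact: lin0 tl.
    by move=> u u' /= hu hu'; rewrite (linD tl) hu hu' addr0.
  by move=> a u /= hu; rewrite V0act2M hu; apply: lin0 (V0act2_linr a).
have t0l v : tens 0 v = 0 :> V2 by rewrite -(scale0r (0 : V)) (bilZl _ _ _ (tens_bil _ _)) scale0r.
have t0r v : tens v 0 = 0 :> V2 by rewrite -(scale0r (0 : V)) (bilZr _ _ _ (tens_bil _ _)) scale0r.
move=> {}y [[i ->]|[[i ->]|[i hi ->]]] /=.
- by rewrite V0act2E !V0pairE !v0_E t0l t0r addr0.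
- by rewrite (linB tl) V0act2E V0act2_1 V0pairE v0_K subrr.
- by rewrite V0act2E !V0pairE !(v0_F hi) t0l t0r addr0.
Qed.

Lemma V0comult_act x (v : V) : V0comult (V0act x v) = V0act2 x (V0comult v).
Proof. by elim/V0_ind: v => y; rewrite V0act_pi !V0comult_pi V0act2M. Qed.
Lemma V0comult_lin c (v w : V) : V0comult (c *: v + w) = c *: V0comult v + V0comult w.
Proof.
elim/V0_ind: v => x; elim/V0_ind: w => y.
by rewrite -piVZ -piVD !V0comult_pi V0act2_linl.
Qed.
Lemma V0comult_v0 : V0comult (v0 q) = tens (v0 q) (v0 q).
Proof. by rewrite -piV1 V0comult_pi V0act2_1. Qed.

(** The product of Cg, extended to arbitrary functions. *)
Definition fmul (f g : form) : form := @ma_mul F q (Cg q) f g.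
Definition fbil (f g : form) (v w : V) : F^o := f v * g w.
Lemma fbil_bil f g : LF f -> LF g -> bilinear_for *:%R *:%R (fbil f g).
Proof.
move=> fl gl; split=> x c y z /=; rewrite /fbil ?fl ?gl ?mulrDl ?mulrDr.
  by rewrite -scalerAl.
by rewrite -scalerAr.
Qed.
Lemma fmulE f g v : fmul f g v = tlift (fbil f g) (V0comult v). Proof. by []. Qed.

Lemma fmul_LF f g : LF f -> LF g -> LF (fmul f g).
Proof.
move=> fl gl c v w; rewrite !fmulE V0comult_lin.
by rewrite (tliftD (fbil_bil fl gl)) (tliftZ (fbil_bil fl gl)).
Qed.
Lemma fmul_linl c f f' g : fmul (c *: f + f') g = c *: fmul f g + fmul f' g.
Proof.
apply/funext => v; rewrite fmulE -[RHS]/(c *: fmul f g v + fmul f' g v) !fmulE.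
rewrite /tlift /tensor_sum scaler_sumr -big_split; apply: eq_bigr => p _.
by rewrite /fbil -[(_ + _) _]/(c *: f p.1 + f' p.1) mulrDl scalerAl.
Qed.
Lemma fmul_linr c f g g' : fmul f (c *: g + g') = c *: fmul f g + fmul f g'.
Proof.
apply/funext => v; rewrite fmulE -[RHS]/(c *: fmul f g v + fmul f g' v) !fmulE.
rewrite /tlift /tensor_sum scaler_sumr -big_split; apply: eq_bigr => p _.
by rewrite /fbil -[(_ + _) _]/(c *: g p.2 + g' p.2) mulrDr scalerAr.
Qed.

Lemma tlift_pair f g a b t : LF f -> LF g ->
  tlift (fbil f g) (V0pair a b t) = tlift (fbil (pre f b) (pre g a)) t.
Proof.
move=> fl gl; have bb := fbil_bil fl gl; have bb' := fbil_bil (LF_pre b fl) (LF_pre a gl).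
elim/tens_ind: t => [|u v IHu IHv|v w].
- by rewrite (lin0 (V0pair_lin _ _)) (tlift0 bb) (tlift0 bb').
- by rewrite (linD (V0pair_lin _ _)) (tliftD bb) (tliftD bb') IHu IHv.
- by rewrite V0pairE (tlift_tens bb) (tlift_tens bb').
Qed.

Section Product.
Variables (f g : form).
Hypotheses (fl : LF f) (gl : LF g).
Lemma fmul_v0 : fmul f g (v0 q) = f (v0 q) * g (v0 q).
Proof. by rewrite fmulE V0comult_v0 (tlift_tens (fbil_bil fl gl)). Qed.
Lemma fmul_preE i : pre (fmul f g) (uE q i) =
  fmul f (pre g (uE q i)) + fmul (pre f (uE q i)) (pre g (uK q i)).
Proof.
apply/funext => v; rewrite /pre fmulE V0comult_act V0act2E (tliftD (fbil_bil fl gl)).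
by rewrite !tlift_pair // pre1.
Qed.
Lemma fmul_preF i : pre (fmul f g) (uF q i) =
  fmul (pre f (uK' q i)) (pre g (uF q i)) + fmul (pre f (uF q i)) g.
Proof.
apply/funext => v; rewrite /pre fmulE V0comult_act V0act2E (tliftD (fbil_bil fl gl)).
by rewrite !tlift_pair // pre1.
Qed.
Lemma fmul_preK i : pre (fmul f g) (uK q i) = fmul (pre f (uK q i)) (pre g (uK q i)).
Proof.
by apply/funext => v; rewrite /pre fmulE V0comult_act V0act2E tlift_pair.
Qed.
Lemma fmul_preK' i : pre (fmul f g) (uK' q i) = fmul (pre f (uK' q i)) (pre g (uK' q i)).
Proof.
by apply/funext => v; rewrite /pre fmulE V0comult_act V0act2E tlift_pair.
Qed.
End Product.

(** Both sides have the same value on the generator, and the transpose of F_i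
    acts on both by the same iterated Leibniz rule. *)
Lemma fmulA f g h : LF f -> LF g -> LF h -> fmul f (fmul g h) = fmul (fmul f g) h.
Proof.
move=> fl gl hl; apply: form_ext; do ?[apply: fmul_LF => //].
move=> w; elim: w f g h fl gl hl => [|i w IH] f g h fl gl hl /=.
  by rewrite !fmul_v0 ?mulrA //; apply: fmul_LF.
have fK := LF_pre (uK' q i) fl; have gK := LF_pre (uK' q i) gl.
have fF := LF_pre (uF q i) fl; have gF := LF_pre (uF q i) gl; have hF := LF_pre (uF q i) hl.
have gh := fmul_LF gl hl; have fg := fmul_LF fl gl.
rewrite -[LHS]/(pre (fmul f (fmul g h)) (uF q i) (Fword w)).
rewrite -[RHS]/(pre (fmul (fmul f g) h) (uF q i) (Fword w)).
rewrite (fmul_preF fl gh) (fmul_preF gl hl) (fmul_preF fg hl) (fmul_preF fl gl).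
rewrite (fmul_preK' fl gl) (linD (fun c => fmul_linr c _)).
rewrite (linD (fun c u v => fmul_linl c u v _)).
rewrite -[LHS]/(fmul _ _ _ + fmul _ _ _ + fmul _ _ _).
rewrite -[RHS]/(fmul _ _ _ + (fmul _ _ _ + fmul _ _ _)) !IH // addrA.
by [].
Qed.

(** * The unit *)

Definition feps : form := @V0counit F q.

Lemma counitD (x y : U) : counit (x + y) = counit x + counit y.
Proof. exact: (linD (f := @counit F q) (@counit_lin F q) x y). Qed.

Lemma feps_pi x : feps (piV x) = counit x.
Proof.
suff h : forall y, lideal_gen (@V0_relators F q) y -> counit y = 0.
  apply/eqP; rewrite -subr_eq0 -(linB (@counit_lin F q)); apply/eqP.
  by apply: h; apply: lquot_repr.
move=> y /(_ [set u | counit u = 0]); apply; split.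
  split=> [|u u' /= hu hu'|a u /= hu]; first exact: lin0 (@counit_lin F q).
    by rewrite counitD hu hu' addr0.
  by rewrite counitM hu mulr0.
move=> {}y [[i ->]|[[i ->]|[i hi ->]]] /=; rewrite ?(linB (@counit_lin F q)) ?counitE //.
by rewrite counit1 subrr.
Qed.
Lemma feps_LF : LF feps.
Proof.
move=> c; elim/V0_ind=> x; elim/V0_ind=> y.
by rewrite -piVZ -piVD !feps_pi counit_lin.
Qed.
Lemma feps_act x v : feps (V0act x v) = counit x * feps v.
Proof. by elim/V0_ind: v => y; rewrite V0act_pi !feps_pi counitM. Qed.
Lemma feps_v0 : feps (v0 q) = 1.
Proof. by rewrite -piV1 feps_pi counit1. Qed.
Lemma feps_pre x : pre feps x = (counit x : F) *: feps.
Proof. by apply/funext => v; rewrite /pre feps_act. Qed.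

Lemma fmul1f f : LF f -> fmul feps f = f.
Proof.
move=> fl; have el := feps_LF.
apply: form_ext => //; first exact: fmul_LF.
move=> w; elim: w f fl => [|i w IH] f fl /=; first by rewrite fmul_v0 // feps_v0 mul1r.
rewrite -[LHS]/(pre _ _ _) (fmul_preF el fl) !feps_pre !counitE scale0r scale1r.
rewrite -[LHS]/(fmul feps (pre f (uF q i)) (Fword w) + fmul 0 f (Fword w)).
rewrite IH; last exact: LF_pre.
by rewrite (lin0 (fun c u v => fmul_linl c u v f)) addr0.
Qed.
Lemma fmulf1 f : LF f -> fmul f feps = f.
Proof.
move=> fl; have el := feps_LF.
apply: form_ext => //; first exact: fmul_LF.
move=> w; elim: w f fl => [|i w IH] f fl /=; first by rewrite fmul_v0 // feps_v0 mulr1.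
rewrite -[LHS]/(pre _ _ _) (fmul_preF fl el) !feps_pre !counitE scale0r.
rewrite (lin0 (fun c => fmul_linr c _)) add0r IH //; exact: LF_pre.
Qed.

(** * The action on forms *)

(** The action on Cg, extended to arbitrary functions. *)
Definition fact (x : U) (f : form) : form := @ma_act F q (Cg q) x f.
Lemma factE x f : fact x f = pre f (antipode x). Proof. by []. Qed.

Lemma fact_rep : is_rep LF fact.
Proof.
split=> [|x f fl|c f g|f fl|x y f fl|c x y f fl|c x f g fl gl].
- exact: LF0.
- exact: LF_pre.
- exact: LF_lin.
- by rewrite factE antipode1 // pre1.
- by rewrite !factE antipodeM // preM.
- by rewrite !factE antipode_lin // preD // preZ.
- by [].
Qed.

Lemma fact_E i f : LF f -> fact (uE q i) f = - pre (pre f (uK' q i)) (uE q i).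
Proof. by move=> fl; rewrite factE antipodeE //= preN // preM. Qed.
Lemma fact_F i f : LF f -> fact (uF q i) f = - pre (pre f (uF q i)) (uK q i).
Proof. by move=> fl; rewrite factE antipodeE //= preN // preM. Qed.
Lemma fact_K i f : fact (uK q i) f = pre f (uK' q i).
Proof. by rewrite factE antipodeE. Qed.
Lemma fact_K' i f : fact (uK' q i) f = pre f (uK q i).
Proof. by rewrite factE antipodeE. Qed.

Lemma pre_F i f : LF f -> pre f (uF q i) = - fact (uK q i) (fact (uF q i) f).
Proof.
move=> fl; rewrite fact_K fact_F //.
by rewrite -[RHS]/(- - pre (pre (pre f (uF q i)) (uK q i)) (uK' q i)) opprK -preM uKK' pre1.
Qed.

Lemma form_eq0 f : LF f -> f (v0 q) = 0 -> (forall i, fact (uF q i) f = 0) -> f = 0.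
Proof.
move=> fl h0 h; apply: form_eq => // [|i]; first exact: LF0.
by rewrite pre_F // h; apply/funext => v; rewrite /pre -[LHS]/(- (0 : F^o)) oppr0.
Qed.

Section FactMul.
Variables (f g : form).
Hypotheses (fl : LF f) (gl : LF g).
Let fK i := LF_pre (uK' q i) fl.
Let gK i := LF_pre (uK' q i) gl.
Lemma fact_K_mul i : fact (uK q i) (fmul f g) = fmul (fact (uK q i) f) (fact (uK q i) g).
Proof. by rewrite !fact_K fmul_preK'. Qed.
Lemma fact_K'_mul i : fact (uK' q i) (fmul f g) = fmul (fact (uK' q i) f) (fact (uK' q i) g).
Proof. by rewrite !fact_K' fmul_preK. Qed.
Lemma fmulNl u v : fmul (- u) v = - fmul u v.
Proof. exact: (linN (fun c u v' => fmul_linl c u v' v)). Qed.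
Lemma fmulNr u v : fmul u (- v) = - fmul u v.
Proof. exact: (linN (fun c => fmul_linr c u)). Qed.
Lemma fact_E_mul i : fact (uE q i) (fmul f g) =
  fmul (fact (uE q i) f) g + fmul (fact (uK q i) f) (fact (uE q i) g).
Proof.
rewrite (fact_E _ (fmul_LF fl gl)) fmul_preK' // fmul_preE // fact_K !fact_E //.
by rewrite -[pre (pre g _) (uK q i)]preM uK'K pre1 fmulNl fmulNr opprD addrC.
Qed.
Lemma fact_F_mul i : fact (uF q i) (fmul f g) =
  fmul (fact (uF q i) f) (fact (uK' q i) g) + fmul f (fact (uF q i) g).
Proof.
rewrite (fact_F _ (fmul_LF fl gl)) fmul_preF //.
rewrite -[pre (_ + _) _]/(pre (fmul (pre f (uK' q i)) (pre g (uF q i))) (uK q i)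
  + pre (fmul (pre f (uF q i)) g) (uK q i)).
have h := LF_pre (uF q i) gl; have h' := LF_pre (uF q i) fl.
rewrite !fmul_preK // fact_K' !fact_F //.
by rewrite -[pre (pre f _) (uK q i)]preM uK'K pre1 fmulNl fmulNr opprD addrC.
Qed.
End FactMul.

(** * Forms from functions on words *)

Notation fn := (seq 'I_3 -> F^o).
(** The functions on words which, as forms on the Verma module, vanish on its
    submodule generated by the vectors F_i v0, i = 1, 3: the words ending in such
    a letter span it. *)
Definition vac (h : fn) : Prop :=
  serre_fn q h /\ forall w i, i != node2 -> h (rcons w i) = 0.

Lemma vac0 : vac 0.
Proof. by split; [exact: serre_fn0|]. Qed.
Lemma vacL c h h' : vac h -> vac h' -> vac (c *: h + h').
Proof.
move=> [S V] [S' V']; split; first exact: serre_fnL.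
by move=> w i hi; rewrite -[LHS]/(c *: h (rcons w i) + h' (rcons w i)) V // V' // scaler0 addr0.
Qed.
Lemma vac_gen g h : vac h -> vac (wgen q g h).
Proof.
move=> [S V]; split; first exact: serre_fn_gen.
case: g => i /=.
- move=> w j hj; elim: w h {S} V => [|k w IH] h V; rewrite [rcons _ _]/= wE_cons.
    by rewrite /wE /= /wcoef /wwt big_nil oppr0 subrr mulr0 scale0r addr0.
  rewrite V // scaler0 addr0; apply: IH => w' j' hj'.
  exact: (V (k :: w') j' hj').
- by move=> w j hj; apply: (V (i :: w)).
- by move=> w j hj; rewrite /wK V // scaler0.
- by move=> w j hj; rewrite /wK' V // scaler0.
Qed.

(** The form on V(0) with prescribed values on the words in the F_i. *)
Definition fword (h : fn) : form := fun v => word_act (V0coef v) h [::].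

Lemma fword_pi h x : vac h -> fword h (piV x) = word_act x h [::].
Proof.
move=> Vh.
have wl c (u u' : U) : word_act (c *: u + u') h [::] = c *: word_act u h [::] + word_act u' h [::].
  by have [Sh _] := Vh; rewrite (word_actL q0 qq).
suff H : forall y, lideal_gen (@V0_relators F q) y ->
    forall h, vac h -> word_act y h [::] = 0.
  apply/eqP; rewrite -subr_eq0 -(linB wl); apply/eqP.
  by apply: (H _ _ h Vh); apply: lquot_repr.
move=> y /(_ [set u | forall h, vac h -> word_act u h [::] = 0]); apply; split.
  have L k (u u' : U) (k1 : vac k) c : word_act (c *: u + u') k [::]
     = c *: word_act u k [::] + word_act u' k [::].
    by have [Sk _] := k1; rewrite (word_actL q0 qq).
  split=> [k Vk|u u' /= hu hu' k Vk|a u /= hu k Vk].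
  - have := L k 0 0 Vk (-1); rewrite scaler0 addr0 => ->; by rewrite scaleN1r addNr.
  - by have := L k u u' Vk 1; rewrite !scale1r => ->; rewrite hu // hu' // addr0.
  - have [Sk _] := Vk; rewrite word_actM //; apply: hu.
    exact: (ract_P vac0 vacL vac_gen).
move=> {}y [[i ->]|[[i ->]|[i hi ->]]] k [Sk Vk] /=.
- by rewrite word_act_gen.
- have := word_actL q0 qq (-1) 1 (uK q i) Sk; rewrite scaleN1r addrC => ->.
  rewrite word_act1 // word_act_gen //= scaleN1r.
  rewrite -[LHS]/(- k [::] + wK q i k [::]) /wK /wwt big_nil expr0z scale1r.
  by rewrite addNr.
- by rewrite word_act_gen //=; apply: (Vk [::]).
Qed.

Lemma fword_LF h : vac h -> LF (fword h).
Proof.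
move=> Vh c; elim/V0_ind=> x; elim/V0_ind=> y; have [Sh _] := Vh.
by rewrite -piVZ -piVD !fword_pi // word_actL.
Qed.
Lemma fword_v0 h : vac h -> fword h (v0 q) = h [::].
Proof. by move=> Vh; have [Sh _] := Vh; rewrite -piV1 fword_pi // word_act1. Qed.
Lemma fword_pre h i : vac h -> pre (fword h) (uF q i) = fword (wF i h).
Proof.
move=> Vh; apply/funext; elim/V0_ind=> x; have [Sh _] := Vh.
rewrite /pre V0act_pi !fword_pi //; last exact: (vac_gen (GF i)).
by rewrite word_actM // word_act_gen.
Qed.
Lemma fword0 : fword 0 = 0.
Proof. by apply/funext => v; rewrite /fword /word_act (lin0 (ract_lin (wgen_lin q (X := F^o)) _)). Qed.

Definition one_letter : fn := fun w => (w == [:: node2])%:R.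
Definition no_letter : fn := fun w => (w == [::])%:R.

Lemma vac_no_letter : vac no_letter.
Proof.
split=> [a i j|w i _]; last by rewrite /no_letter; case: w.
apply/funext => w; rewrite /serreF /wserre; case: ifP => _.
  by rewrite -[LHS]/(no_letter (a ++ [:: i, j & w]) - no_letter (a ++ [:: j, i & w]));
    case: a => *; rewrite /no_letter /= subrr.
case: ifP => // _.
rewrite -[LHS]/(no_letter (a ++ [:: i, i, j & w])
  + (- (q + q^-1)) *: no_letter (a ++ [:: i, j, i & w]) + no_letter (a ++ [:: j, i, i & w])).
by case: a => *; rewrite /no_letter /= scaler0 !addr0.
Qed.
Lemma vac_one_letter : vac one_letter.
Proof.
split=> [a i j|w i]; last first.
  move: i; apply: node_ind => // _; rewrite /one_letter; case: w => [|k [|k' w]] //=;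
   by rewrite ?eqseq_cons ?andbF.
apply/funext => w; rewrite /serreF /wserre; case: ifP => _.
  rewrite -[LHS]/(one_letter (a ++ [:: i, j & w]) - one_letter (a ++ [:: j, i & w])).
  by case: a => [|k [|k' a]]; rewrite /one_letter /= !eqseq_cons /= ?andbF subrr.
case: ifP => // _.
rewrite -[LHS]/(one_letter (a ++ [:: i, i, j & w])
  + (- (q + q^-1)) *: one_letter (a ++ [:: i, j, i & w]) + one_letter (a ++ [:: j, i, i & w])).
by case: a => [|k [|k' a]]; rewrite /one_letter /= !eqseq_cons /= ?andbF scaler0 !addr0.
Qed.

(** The form with value 1 on F_2 v0 and 0 on all other words. Its orbit under
    the Levi subalgebra spans the coordinate functions on g_{-1}. *)
Definition zeta0 : form := fword one_letter.

Lemma zeta0_LF : LF zeta0. Proof. exact: fword_LF vac_one_letter. Qed.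
Lemma zeta0_v0 : zeta0 (v0 q) = 0. Proof. exact: fword_v0 vac_one_letter. Qed.
Lemma feps_word : feps = fword no_letter.
Proof.
have Vn := vac_no_letter.
apply: form_eq; [exact: feps_LF|exact: fword_LF|by rewrite feps_v0 fword_v0|move=> i].
rewrite feps_pre counitE scale0r fword_pre // -[wF i _]/(0 : fn) fword0 //.
Qed.
Lemma zeta0_pre i : pre zeta0 (uF q i) = (i == node2)%:R *: feps.
Proof.
have Vo := vac_one_letter; rewrite fword_pre // feps_word.
have -> : wF i one_letter = (i == node2)%:R *: no_letter.
  apply/funext => w; rewrite -[RHS]/((i == node2)%:R * no_letter w) /wF /one_letter eqseq_cons.
  by rewrite /no_letter; case: (i == node2); rewrite /= ?mul1r ?mul0r.
case: (i == node2); first by rewrite !scale1r.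
by rewrite !scale0r fword0.
Qed.

Lemma form_opp (f : form) v : (- f) v = - f v. Proof. by []. Qed.
Lemma preNf (f : form) x : pre (- f) x = - pre f x. Proof. by []. Qed.
Lemma preZf c (f : form) x : pre (c *: f) x = c *: pre f x. Proof. by []. Qed.

Lemma zeta0_preK' i : pre zeta0 (uK' q i) = q ^ cartan i node2 *: zeta0.
Proof.
have zl := zeta0_LF; apply: form_eq.
- exact: LF_pre.
- by rewrite -[_ *: _]addr0; apply: LF_lin => //; apply: LF0.
- by rewrite /pre v0_K' -[RHS]/(_ * zeta0 (v0 q)) zeta0_v0 mulr0.
- move=> j; rewrite -preM uK'_F // preZ // preM zeta0_pre !preZf zeta0_pre feps_pre counitE /=.
  by rewrite scale1r; case: eqP => [->//|_]; rewrite !scale0r !scaler0.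
Qed.

Lemma fact_F_feps i : fact (uF q i) zeta0 = - ((i == node2)%:R *: feps).
Proof. by rewrite (fact_F _ zeta0_LF) zeta0_pre preZf feps_pre counitE scale1r. Qed.
Lemma fact_E_feps i : fact (uE q i) feps = 0.
Proof. by rewrite (fact_E _ feps_LF) !feps_pre preZf feps_pre !counitE scale0r scaler0 oppr0. Qed.

Lemma fact_E_v0 i f : LF f -> fact (uE q i) f (v0 q) = 0.
Proof.
move=> fl; rewrite fact_E // form_opp /pre v0_E V0act0.
by rewrite (lin0 fl) oppr0.
Qed.

(** E_i^2 zeta0 is annihilated by all F_j and vanishes on the generator, so it
    is 0; this is the computation in the two-dimensional representation of the
    i-th sl_2. *)
Lemma zeta_low : levi_lowest LF fact zeta0.
Proof.
have zl := zeta0_LF; have fr := fact_rep.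
have lowF i : i != node2 -> fact (uF q i) zeta0 = 0.
  by move=> hi; rewrite fact_F_feps (negPf hi) scale0r oppr0.
have lowK i : fact (uK q i) zeta0 = q ^ cartan i node2 *: zeta0.
  by rewrite fact_K zeta0_preK'.
split=> // i hi; have El : LF (fact (uE q i) zeta0) by apply: LF_pre.
have Ki : fact (uK q i) zeta0 = q^-1 *: zeta0.
  by rewrite lowK; congr (_ *: _); move: i hi {El}; apply: node_ind.
have KE : fact (uK q i) (fact (uE q i) zeta0) = q *: fact (uE q i) zeta0.
  rewrite (rep_KE fr i zl Ki) /cartan eqxx; congr (_ *: _).
  by rewrite -exprnP expr2 -mulrA mulfV // mulr1.
apply: form_eq0 => [||j].
- by apply: LF_pre.
- exact: fact_E_v0.
rewrite (rep_FE fr j i El); have [<-|ji] := eqVneq i j.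
  rewrite (rep_FE_low q0 qq fr zl (lowF _ hi) Ki) KE (rep_K' fr El q0 KE).
  by rewrite -scalerBl scalerA mul1r mulVf // scale1r subrr.
rewrite mul0r scale0r subr0 (rep_FE fr j i zl) (negPf ji) mul0r scale0r subr0.
by rewrite fact_F_feps -scaleNr (repZ fr _ _ feps_LF) fact_E_feps scaler0 (rep0 fr).
Qed.

Definition zeta (s : bool * bool) : form := levi_vec fact zeta0 s.

Lemma zeta_LF s : LF (zeta s).
Proof. exact: levi_vecP fact_rep zeta_low s. Qed.
Lemma fact_zeta g s : levi g ->
  fact (ugenE q g) (zeta s) = (levi_table q g s).1 *: zeta (levi_table q g s).2.
Proof. by move=> lg; apply: (levi_tableP q0 qq fact_rep zeta_low). Qed.

(** For i = 1, 3 the transpose of F_2 commutes with the action of E_i up to a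
    power of q, and E_i kills the unit of the algebra. *)
Lemma zeta_pre2 s : pre (zeta s) (uF q node2) = (s == (false, false))%:R *: feps.
Proof.
have zl := zeta0_LF; have el := feps_LF.
have comm i f c : i != node2 -> LF f -> pre f (uF q node2) = c *: feps ->
    pre (fact (uE q i) f) (uF q node2) = 0 *: feps.
  move=> hi fl h; rewrite fact_E // -!preM preNf -preM.
  have -> : uK' q i * uE q i * uF q node2
      = q ^ cartan i node2 *: (uF q node2 * (uK' q i * uE q i)).
    rewrite -mulrA uEF (negPf hi) mul0r scale0r addr0 mulrA uK'_F //.
    by rewrite -scalerAl mulrA.
  rewrite preZ // preM h preZf feps_pre counitM !counitE mulr0 scale0r !scaler0.
  by rewrite oppr0.
have z00 : pre zeta0 (uF q node2) = 1 *: feps by rewrite zeta0_pre.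
have z01 := comm _ _ _ (isT : node3 != node2) zl z00.
case: s => [] [] [].
- apply: (comm _ _ _ (isT : node1 != node2) _ z01); exact: LF_pre.
- exact: (comm _ _ _ (isT : node1 != node2) zl z00).
- exact: z01.
- exact: z00.
Qed.

End Forms.

(** * The map from the generated algebra to forms *)

Section Psi.
Local Open Scope classical_set_scope.
Variables (F : fieldType) (q : F).
Hypothesis q0 : q != 0.
Hypothesis qq : q - q^-1 != 0.
Hypothesis q2 : q + q^-1 != 0.
Notation U := (Uq q).
Notation V := (V0 q).
Notation form := (V -> F^o).
Notation zeta := (@zeta F q).
Notation zeta0 := (@zeta0 F q).
Notation feps := (@feps F q).
Notation LF := (@LF F q).

Let Dl g : {morph (fun f : form => fmul f g) : u v / u + v} :=
  linD (fun c u v => fmul_linl c u v g).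
Let Zl g c u : fmul (c *: u) g = c *: (fmul u g : form) :=
  linZ (fun c u v => fmul_linl c u v g) c u.
Let Zr g c u : fmul g (c *: u) = c *: (fmul g u : form) :=
  linZ (fun c u v => fmul_linr c g u v) c u.

Lemma fmul0l u : fmul (0 : form) u = 0.
Proof. exact: (lin0 (fun c u' v => fmul_linl c u' v u)). Qed.
Lemma fmul0r u : fmul u (0 : form) = 0.
Proof. exact: (lin0 (fun c => fmul_linr c u)). Qed.

Definition zeta1 (i : 'I_3) : form := fact (uE q i) zeta0.

Lemma zeta1_LF i : LF (zeta1 i).
Proof. by apply: LF_pre; apply: zeta0_LF. Qed.

Lemma zeta1E i : i != node2 -> zeta1 i = zeta (i == node1, i == node3).
Proof. by move: i; apply: node_ind. Qed.

Lemma fact_F2_zeta s : fact (uF q node2) (zeta s) = (s == (false, false))%:R *: - feps.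
Proof.
have zl := zeta_LF q0 qq q2 s.
rewrite (fact_F q0 qq q2) // zeta_pre2 // preZf feps_pre counitE scale1r.
by rewrite scalerN.
Qed.

(** Both sides vanish on the generator, and F_j maps the difference to 0: for
    j = 2 each side gives a multiple of zeta1, for j = i a multiple of the square
    of zeta0. *)
Lemma zeta_comm i : i != node2 -> fmul zeta0 (zeta1 i) = q^-1 *: fmul (zeta1 i) zeta0.
Proof.
move=> hi; have zl := zeta0_LF q0 qq; have z1l := zeta1_LF i.
have L1 := fmul_LF q0 qq q2 zl z1l; have L2 := fmul_LF q0 qq q2 z1l zl.
suff : fmul zeta0 (zeta1 i) + (- q^-1) *: fmul (zeta1 i) zeta0 = 0.
  by move=> /eqP; rewrite scaleNr subr_eq0 => /eqP.
rewrite addrC; apply: (form_eq0 q0 qq q2) => [||j]; first exact: LF_lin.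
  rewrite -[LHS]/(_ *: (fmul (zeta1 i) zeta0 (v0 q)) + fmul zeta0 (zeta1 i) (v0 q)).
  by rewrite !fmul_v0 // zeta0_v0 // mul0r mulr0 scaler0 addr0.
have fr := fact_rep q0 qq q2.
rewrite (repR fr) // !(fact_F_mul q0 qq q2) //.
have lv g (lg : levi g) := fact_zeta q0 qq q2 (false, false) lg : fact (ugenE q g) zeta0 = _.
have lv1 g : levi g -> fact (ugenE q g) (zeta1 i) =
    (levi_table q g (i == node1, i == node3)).1 *:
    zeta (levi_table q g (i == node1, i == node3)).2.
  by rewrite zeta1E //; apply: fact_zeta.
have N0 := fmul0l; have N0' := fmul0r.
have i13 : i = node1 \/ i = node3 by move: i hi {z1l L1 L2 lv1}; apply: node_ind; auto.
have [j2|j2] := eqVneq j node2.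
  have -> : fact (uK' q j) (zeta1 i) = q^-1 *: zeta1 i.
    rewrite (lv1 (GKinv j)) // zeta1E // j2.
    by case: i13 => ->.
  have -> : fact (uF q j) (zeta1 i) = 0.
    by rewrite j2 zeta1E // fact_F2_zeta; case: i13 => -> /=; rewrite scale0r.
  have -> : fact (uF q j) zeta0 = - feps.
    by rewrite j2 (fact_F2_zeta (false, false)) scale1r.
  rewrite fmulNl fmulNr Zr (fmul1f q0 qq q2) // (fmulf1 q0 qq q2) // N0 N0' add0r addr0.
  by rewrite scaleNr scalerN opprK subrr.
have -> : fact (uF q j) zeta0 = 0.
  have := lv (GF j) j2; rewrite [levi_table _ _ _]surjective_pairing /=.
  by case: ifP => _ /= ->; rewrite scale0r.
rewrite N0 N0' addr0 add0r; have [ji|ji] := eqVneq j i; last first.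
  have -> : fact (uF q j) (zeta1 i) = 0.
    have := lv1 (GF j) j2; move: j j2 ji; apply: node_ind => //; case: i13 => -> //= _ _ ->;
    by rewrite scale0r.
  by rewrite N0 N0' scaler0 addr0.
have -> : fact (uF q j) (zeta1 i) = zeta0.
  by have := lv1 (GF j) j2; rewrite ji; case: i13 => -> /= ->; rewrite scale1r.
have -> : fact (uK' q j) zeta0 = q *: zeta0.
  by have := lv (GKinv j) isT; rewrite ji; case: i13 => -> /= ->.
by rewrite Zr scalerA mulNr mulVf // scaleN1r addNr.
Qed.

(** E_2 is replaced by the multiplication by zeta0, since E_2 is to be mapped
    to zeta0; E_1 and E_3 act on forms as they should act on the subalgebra Z
    through ad, up to terms with E_1 and E_3 on the right, which kill 1 in the
    target. *)
Definition psi_op (i : 'I_3) : form -> form :=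
  if i == node2 then fmul zeta0 else fact (uE q i).

Lemma psi_op_lin i c f g : psi_op i (c *: f + g) = c *: psi_op i f + psi_op i g.
Proof. by rewrite /psi_op; case: ifP => // _; apply: fmul_linr. Qed.
Lemma psi_op_LF i f : LF f -> LF (psi_op i f).
Proof.
move=> fl; rewrite /psi_op; case: ifP => _; last exact: LF_pre.
by apply: fmul_LF => //; apply: zeta0_LF.
Qed.

Section Serre.
Variable i : 'I_3.
Hypothesis hi : i != node2.
Let op (k : nat) : form -> form :=
  match k with 0 => fmul zeta0 | 1 => fmul (zeta1 i) | _ => fact (uE q i) end.

Lemma zeta1_tab : [/\ fact (uK q i) zeta0 = q^-1 *: zeta0,
  fact (uK q i) (zeta1 i) = q *: zeta1 i & fact (uE q i) (zeta1 i) = 0].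
Proof.
have lv g (lg : levi g) := fact_zeta q0 qq q2 (false, false) lg : fact (ugenE q g) zeta0 = _.
have lv1 g : levi g -> fact (ugenE q g) (zeta1 i) =
    (levi_table q g (i == node1, i == node3)).1 *:
    zeta (levi_table q g (i == node1, i == node3)).2.
  by rewrite zeta1E //; apply: fact_zeta.
have := lv (GK i) isT; have := lv1 (GK i) isT; have := lv1 (GE i) hi; rewrite zeta1E //.
by move: i hi {lv lv1}; apply: node_ind => // _ /= -> -> ->; rewrite scale0r.
Qed.

Let serre_eqs : seq (nterm * nterm) :=
  [:: (NMul (NGen 2) (NGen 0),
        NAdd (NGen 1) (NScale CInv (NMul (NGen 0) (NGen 2))));
      (NMul (NGen 2) (NGen 1), NScale CVar (NMul (NGen 1) (NGen 2)));
      (NMul (NGen 0) (NGen 1), NScale CInv (NMul (NGen 1) (NGen 0)))].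

Lemma serre_eqs_hold f : LF f -> eqs_hold (fun t => neval q op t f) serre_eqs.
Proof.
move=> fl; have zl := zeta0_LF q0 qq; have z1l := zeta1_LF i.
have [K0 K1 E1] := zeta1_tab.
split; first by rewrite /= (fact_E_mul q0 qq q2) // K0 Zl.
split; first by rewrite /= (fact_E_mul q0 qq q2) // K1 E1 Zl
  fmul0l add0r.
by split=> //; rewrite /= !(fmulA q0 qq q2) // zeta_comm // Zl.
Qed.

Lemma psi_serre_check l r : ncheck 20 serre_eqs l r ->
  forall f, LF f -> neval q op l f = neval q op r f.
Proof.
move=> chk; apply: (ncheckP q0 qq) _ _ serre_eqs_hold chk.
  move=> [|[|k]] f fl; [| |exact: LF_pre]; apply: (fmul_LF q0 qq q2) => //.
    exact: zeta0_LF.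
  exact: zeta1_LF.
by move=> [|[|k]] c f g //; apply: fmul_linr.
Qed.
End Serre.

Lemma psi_serre0 i j f : LF f -> cartan i j = 0 ->
  psi_op i (psi_op j f) = psi_op j (psi_op i f).
Proof.
move=> fl; have fr := fact_rep q0 qq q2.
by move: i j; do 2!apply: node_ind => //; move=> h; rewrite /psi_op /= -!(repM fr) // uEE0.
Qed.

(** With zeta1 = E_i zeta0, the operators satisfy E_i zeta0 = zeta1 + q^-1
    zeta0 E_i, E_i zeta1 = q zeta1 E_i and zeta0 zeta1 = q^-1 zeta1 zeta0 as
    operators; these are the relations of E_2, ad E_i (E_2) and E_i in U+, and
    they imply the Serre relations. *)
Lemma psi_serre1 i j f : LF f -> cartan i j = -1 ->
  psi_op i (psi_op i (psi_op j f)) - (q + q^-1) *: psi_op i (psi_op j (psi_op i f))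
  + psi_op j (psi_op i (psi_op i f)) = 0.
Proof.
move=> fl h;
pose T a b := NAdd (NAdd (NMul a (NMul a b))
  (NOpp (NScale (CAdd CVar CInv) (NMul a (NMul b a))))) (NMul b (NMul a a)).
have [hi|hi] := boolP (i == node2); have [hj|hj] := boolP (j == node2).
- by move: h; rewrite (eqP hi) (eqP hj).
- rewrite /psi_op hi (negPf hj).
  exact: (@psi_serre_check j hj (T (NGen 0) (NGen 2)) NZero (erefl true) f fl).
- rewrite /psi_op hj (negPf hi).
  exact: (@psi_serre_check i hi (T (NGen 2) (NGen 0)) NZero (erefl true) f fl).
- by move: i j hi hj h; do 2!apply: node_ind => //.
Qed.

Let epsl := @feps_LF F q.
Definition psi : U -> form := induced psi_op feps.
Lemma psi_lin c x y : psi (c *: x + y) = c *: psi x + psi y.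
Proof. exact: (induced_lin q0 qq q2 psi_op_lin psi_op_LF epsl psi_serre0 psi_serre1). Qed.
Lemma psi1 : psi 1 = feps.
Proof. exact: (induced1 q0 qq q2 psi_op_lin psi_op_LF epsl psi_serre0 psi_serre1). Qed.
Lemma psi_E i x : psi (uE q i * x) = psi_op i (psi x).
Proof. exact: (induced_E q0 qq q2 psi_op_lin psi_op_LF epsl psi_serre0 psi_serre1). Qed.

(** zU s is an iterated q-commutator of E_2 with E_1 and E_3, and the Leibniz
    rule for E_i on forms says that the q-commutator of E_i with a multiplication
    operator is the multiplication by the image under E_i. *)
Lemma psi_z s x : LF (psi x) -> psi (zU q s * x) = fmul (zeta s) (psi x).
Proof.
move=> xl; have zl := zeta0_LF q0 qq; have fr := fact_rep q0 qq q2.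
have step i (A : U) a c : i != node2 -> LF a ->
    (forall x, LF (psi x) -> psi (A * x) = fmul a (psi x)) ->
    ad (uK q i) A = c *: A -> fact (uK q i) a = c *: a ->
    forall x, LF (psi x) -> psi (ad (uE q i) A * x) = fmul (fact (uE q i) a) (psi x).
  move=> hi al H KA Ka {xl}x xl; rewrite ad_E // -(ad_K q0 qq q2) // KA.
  rewrite mulrBl -!mulrA -!scalerAl.
  have El : LF (psi (uE q i * x)) by rewrite psi_E; apply: psi_op_LF.
  rewrite (linB psi_lin) (linZ psi_lin) psi_E !H // psi_E /psi_op (negPf hi).
  by rewrite (fact_E_mul q0 qq q2) // Ka Zl addrK.
have adK := ad_zU q0 qq q2; have faK := fact_zeta q0 qq q2.
have h00 y : LF (psi y) -> psi (zU q (false, false) * y) = fmul (zeta (false, false)) (psi y).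
  by move=> _; apply: psi_E.
have h01 y : LF (psi y) -> psi (zU q (false, true) * y) = fmul (zeta (false, true)) (psi y).
  apply: (step node3 (zU q (false, false)) (zeta (false, false)) _ isT) => //.
  - exact: (adK (GK node3)).
  - exact: (faK (GK node3) (false, false)).
case: s => [] [] [].
- apply: (step node1 (zU q (false, true)) (zeta (false, true)) _ isT) => //.
  + exact: zeta_LF.
  + exact: (adK (GK node1)).
  + exact: (faK (GK node1) (false, true)).
- apply: (step node1 (zU q (false, false)) (zeta (false, false)) _ isT) => //.
  + exact: (adK (GK node1)).
  + exact: (faK (GK node1) (false, false)).
- exact: h01.
- exact: h00.
Qed.

Lemma psi_zE s : psi (zU q s) = zeta s.
Proof.
have zl := zeta_LF q0 qq q2 s.
by rewrite -[zU q s]mulr1 psi_z psi1 // (fmulf1 q0 qq q2).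
Qed.

(** The elements x for which psi turns left multiplication by x into the
    multiplication by psi x form a subalgebra containing the generators. *)
Lemma psi_mul_LF x : Zalg x ->
  LF (psi x) /\ forall y, LF (psi y) -> psi (x * y) = fmul (psi x) (psi y).
Proof.
pose M := [set x : U | LF (psi x) /\ forall y, LF (psi y) -> psi (x * y) = fmul (psi x) (psi y)].
suff h : @Zalg F q `<=` M by apply: h.
apply: subalg_gen_min => [|_ [s _ <-]]; last first.
  by split; [rewrite psi_zE; apply: zeta_LF|move=> y yl; rewrite psi_zE psi_z].
split.
- by split; rewrite psi1 // => y yl; rewrite mul1r fmul1f.
- move=> c x1 x2 [l1 h1] [l2 h2]; split; first by rewrite psi_lin; apply: LF_lin.
  by move=> y yl; rewrite mulrDl -scalerAl !psi_lin h1 // h2 // Dl Zl.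
- move=> x1 x2 [l1 h1] [l2 h2]; have l12 := fmul_LF q0 qq q2 l1 l2; split; first by rewrite h1.
  move=> y yl; rewrite -mulrA h1; last by rewrite h2 //; apply: fmul_LF.
  by rewrite h2 // h1 // fmulA.
Qed.
Lemma psi_LF x : Zalg x -> LF (psi x).
Proof. by case/psi_mul_LF. Qed.
Lemma psiM x y : Zalg x -> Zalg y -> psi (x * y) = fmul (psi x) (psi y).
Proof. by case/psi_mul_LF=> _ h /psi_LF; apply: h. Qed.

Lemma fact_feps g : fact (ugenE q g) feps = (counit_gen F g : F) *: feps.
Proof.
rewrite factE feps_pre; congr (_ *: _); rewrite antipodeE //.
case: g => i /=; rewrite ?counitE // (linN (@counit_lin F q)) counitM !counitE /=.
  by rewrite mulr0 oppr0.
by rewrite mul0r oppr0.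
Qed.

(** Both sides satisfy the same Leibniz rule, and on the generators both are
    given by the same table. *)
Lemma psi_ad_gen g x : levi g -> Zalg x -> psi (ad (ugenE q g) x) = fact (ugenE q g) (psi x).
Proof.
pose M := [set x : U | Zalg x /\ forall g, levi g ->
  psi (ad (ugenE q g) x) = fact (ugenE q g) (psi x)].
suff h : @Zalg F q `<=` M by move=> lg /h[_]; apply.
have ZA := @Zalg_is F q; have fr := fact_rep q0 qq q2.
apply: subalg_gen_min => [|_ [s _ <-]]; last first.
  split=> [|{}g lg]; first exact: Zalg_z.
  by rewrite ad_zU // (linZ psi_lin) !psi_zE fact_zeta.
split.
- split=> [|{}g lg]; first exact: subalg1 ZA.
  by rewrite ad_one // (linZ psi_lin) psi1 fact_feps.
- move=> c x1 x2 [Z1 h1] [Z2 h2]; split=> [|{}g lg]; first exact: (subalgL ZA).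
  rewrite ad_linr // !psi_lin h1 // h2 // (repR fr) //; exact: psi_LF.
- move=> x1 x2 [Z1 h1] [Z2 h2]; split=> [|{}g lg]; first exact: (subalgM ZA).
  have A1 k lk := Zalg_ad_gen q0 qq q2 (g := k) lk Z1.
  have A2 k lk := Zalg_ad_gen q0 qq q2 (g := k) lk Z2.
  have l1 := psi_LF Z1; have l2 := psi_LF Z2.
  rewrite (psiM Z1 Z2); case: g lg => i lg.
  + have a1 := A1 (GE i) lg; have a2 := A1 (GK i) isT; have a3 := A2 (GE i) lg.
    rewrite ad_E_mul // (linD psi_lin) (psiM a1 Z2) (psiM a2 a3).
    by rewrite (h1 (GE i) lg) (h1 (GK i) isT) (h2 (GE i) lg) fact_E_mul.
  + have a1 := A1 (GF i) lg; have a2 := A2 (GKinv i) isT; have a3 := A2 (GF i) lg.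
    rewrite ad_F_mul // (linD psi_lin) (psiM a1 a2) (psiM Z1 a3).
    by rewrite (h1 (GF i) lg) (h2 (GKinv i) isT) (h2 (GF i) lg) fact_F_mul.
  + have a1 := A1 (GK i) isT; have a2 := A2 (GK i) isT.
    by rewrite ad_K_mul // (psiM a1 a2) (h1 (GK i) isT) (h2 (GK i) isT) fact_K_mul.
  + have a1 := A1 (GKinv i) isT; have a2 := A2 (GKinv i) isT.
    by rewrite ad_K'_mul // (psiM a1 a2) (h1 (GKinv i) isT) (h2 (GKinv i) isT) fact_K'_mul.
Qed.

Lemma psi_ad xi x : U0 xi -> Zalg x -> psi (ad xi x) = fact xi (psi x).
Proof.
pose M := [set xi : U | forall x, Zalg x ->
  Zalg (ad xi x) /\ psi (ad xi x) = fact xi (psi x)].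
have ZA := @Zalg_is F q; have fr := fact_rep q0 qq q2.
suff h : @U0 F q `<=` M by move=> /h hxi /hxi[].
apply: U0_gen => [|g lg {}x Zx]; last first.
  by split; [exact: Zalg_ad_gen|exact: psi_ad_gen].
split=> [{}x Zx|c a b ha hb {}x Zx|a b ha hb {}x Zx].
- by rewrite ad1 // (rep1 fr) //; apply: psi_LF.
- have [Za ea] := ha x Zx; have [Zb eb] := hb x Zx.
  rewrite ad_linl // psi_lin ea eb (repL fr); last exact: psi_LF.
  by split=> //; apply: (subalgL ZA).
- have [Zb eb] := hb x Zx; have [Za ea] := ha _ Zb.
  by rewrite adM // ea eb (repM fr) //; apply: psi_LF.
Qed.

End Psi.

(** * Nondegeneracy *)

Section Gauss.
Variables (F : fieldType) (t : F).

Definition qint (n : nat) : F := \sum_(j < n) t ^+ j.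
Definition qfact (n : nat) : F := \prod_(j < n) qint j.+1.

Lemma qint_neq0 n : t != 1 -> t ^+ n != 1 -> qint n != 0.
Proof.
move=> t1 tn; apply/eqP => h; have := subrX1 t n.
by rewrite -/(qint n) h mulr0 => /eqP; rewrite subr_eq0 (negPf tn).
Qed.

Lemma qintD m n : qint (m + n) = qint n + t ^+ n * qint m.
Proof.
rewrite addnC /qint big_split_ord /= mulr_sumr; congr (_ + _).
by apply: eq_bigr => j _; rewrite exprD.
Qed.

(** The Gaussian binomial coefficients, indexed by the two lower parts. *)
Fixpoint gauss (m : nat) : nat -> F :=
  match m with
  | 0 => fun _ => 1
  | m'.+1 => fix gm (n : nat) : F :=
      match n with 0 => 1 | n'.+1 => gm n' + t ^+ n * gauss m' n end
  end.

Lemma gauss0 m : gauss m 0 = 1. Proof. by case: m. Qed.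
Lemma gaussS m n : gauss m.+1 n.+1 = gauss m.+1 n + t ^+ n.+1 * gauss m n.+1.
Proof. by []. Qed.

Lemma qfactS n : qfact n.+1 = qfact n * qint n.+1.
Proof. by rewrite /qfact big_ord_recr. Qed.

Lemma gauss_fact m n : gauss m n * (qfact m * qfact n) = qfact (m + n).
Proof.
have f0 : qfact 0 = 1 by rewrite /qfact big_ord0.
elim: m n => [|m IHm] n; first by rewrite /= f0 !mul1r.
elim: n => [|n IHn]; first by rewrite gauss0 addn0 f0 mulr1 mul1r.
rewrite gaussS mulrDl.
have -> : gauss m.+1 n * (qfact m.+1 * qfact n.+1) = qfact (m.+1 + n) * qint n.+1.
  by rewrite -IHn (qfactS n); ring.
have -> : t ^+ n.+1 * gauss m n.+1 * (qfact m.+1 * qfact n.+1)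
    = qfact (m + n.+1) * (t ^+ n.+1 * qint m.+1).
  by rewrite -IHm (qfactS m); ring.
by rewrite addSnnS -mulrDr -qintD -qfactS addSn addnS.
Qed.

(** The product formula writes a product of q-integers as a multiple of the
    coefficient. *)
Lemma gauss_neq0 m n : (forall k, (0 < k)%N -> t ^+ k != 1) -> gauss m n != 0.
Proof.
move=> tk; apply/eqP => h; have := gauss_fact m n; rewrite h mul0r => /esym/eqP.
rewrite /qfact prodf_seq_eq0 => /hasP[j _ /andP[_]].
by rewrite (negPf (qint_neq0 _ _)) ?tk //; have := tk 1%N isT; rewrite expr1.
Qed.
End Gauss.

Section Nondegenerate.
Local Open Scope classical_set_scope.
Variables (F : fieldType) (q : F).
Hypothesis q0 : q != 0.
Hypothesis qn1 : forall n, (0 < n)%N -> q ^+ n != 1.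
Notation U := (Uq q).
Notation V := (V0 q).
Notation form := (V -> F^o).
Notation zeta := (@zeta F q).
Notation feps := (@feps F q).
Notation LF := (@LF F q).

Lemma qdiff_neq0 : q - q^-1 != 0.
Proof.
rewrite subr_eq0; apply/eqP => h; have := qn1 (isT : (0 < 2)%N).
by rewrite expr2 {2}h mulfV // eqxx.
Qed.
Lemma qsum_neq0 : q + q^-1 != 0.
Proof.
rewrite addr_eq0; apply/eqP => h; have := qn1 (isT : (0 < 4)%N).
have e : q ^+ 2 = -1 by rewrite expr2 {2}h mulrN mulfV.
by rewrite (exprM q 2 2) e sqrrN expr1n eqxx.
Qed.

Let qq := qdiff_neq0.
Let q2 := qsum_neq0.

Lemma qpow_eq1 (e : int) : q ^ e = 1 -> e = 0.
Proof.
case: e => n; first by case: n => // n /eqP; rewrite -exprnP (negPf (qn1 _)).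
rewrite NegzE -exprnN => /(congr1 (@GRing.inv F)); rewrite invrK invr1 => /eqP.
by rewrite (negPf (qn1 _)).
Qed.
Lemma qpow_inj (e e' : int) : q ^ e = q ^ e' -> e = e'.
Proof.
move=> h; apply/eqP; rewrite -subr_eq0; apply/eqP/qpow_eq1.
by rewrite expfzDr // h -expfzDr // addrN expr0z.
Qed.

Notation psi := (@psi F q).
Let psilin := psi_lin q0 qq q2.

Section Top.
Variable i : 'I_3.
(** The transpose of F_i is a twisted derivation of the algebra of forms. *)
Definition low (f : form) : form := pre f (uF q i).
Definition lowFn (n : nat) (f : form) : form := iter n low f.

Lemma low_lin c f g : low (c *: f + g) = c *: low f + low g. Proof. by []. Qed.
Lemma lowF_lin n c f g : lowFn n (c *: f + g) = c *: lowFn n f + lowFn n g.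
Proof. by elim: n => [//|n IH]; rewrite /lowFn !iterS -/(lowFn n _) IH. Qed.
Lemma lowF_LF n f : LF f -> LF (lowFn n f).
Proof. by move=> fl; elim: n => [//|n IH]; apply: LF_pre. Qed.
Lemma lowFS n f : lowFn n.+1 f = lowFn n (low f). Proof. exact: iterSr. Qed.

Lemma low_weight f mu j : LF f -> pre f (uK' q j) = mu *: f ->
  pre (low f) (uK' q j) = (q ^ (- cartan j i) * mu) *: low f.
Proof.
move=> fl h; rewrite /low -preM.
have -> : uF q i * uK' q j = q ^ (- cartan j i) *: (uK' q j * uF q i).
  by rewrite uK'_F // scalerA -expfzDr // addNr expr0z scale1r.
by rewrite preZ // preM h preZf scalerA.
Qed.
Lemma lowF_weight n f mu j : LF f -> pre f (uK' q j) = mu *: f ->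
  pre (lowFn n f) (uK' q j) = ((q ^ (- cartan j i)) ^+ n * mu) *: lowFn n f.
Proof.
move=> fl h; elim: n => [|n IH]; first by rewrite expr0 mul1r.
by rewrite -[lowFn n.+1 f]/(low (lowFn n f)) (low_weight (lowF_LF n fl) IH) exprS mulrA.
Qed.

Lemma low_mul f g mu : LF f -> LF g -> pre f (uK' q i) = mu *: f ->
  low (fmul f g) = mu *: fmul f (low g) + fmul (low f) g.
Proof.
move=> fl gl h; rewrite /low (fmul_preF q0 qq q2) // h.
by rewrite (linZ (fun c u v => fmul_linl c u v _)).
Qed.

(** The extreme term of the twisted Leibniz rule. *)
Lemma lowF_mul N m n f g mu : (m + n)%N = N -> LF f -> LF g ->
  pre f (uK' q i) = mu *: f -> lowFn m.+1 f = 0 -> lowFn n.+1 g = 0 ->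
  lowFn N (fmul f g) = (gauss (q ^ (-2)) m n * mu ^+ n) *: fmul (lowFn m f) (lowFn n g).
Proof.
elim: N m n f g mu => [|N IH] m n f g mu.
  by case: m n => [|m] [|n] // *; rewrite expr0 mulr1 scale1r.
move=> e fl gl h hf hg; rewrite lowFS (low_mul fl gl h) lowF_lin.
have h' := low_weight fl h; rewrite /cartan eqxx -/(low f) in h'.
have Dl := LF_pre (uF q i) fl : LF (low f); have Dg := LF_pre (uF q i) gl : LF (low g).
case: m e hf => [|m] e hf.
  have -> : low f = 0 by [].
  rewrite fmul0l (lin0 (lowF_lin N)) addr0; case: n e hg => [//|n] [e] hg.
  rewrite (IH 0%N n f (low g) mu) //; last by rewrite -lowFS.
  by rewrite scalerA -lowFS exprS; congr (_ *: _); rewrite -[gauss _ 0 n]/(1 : F) -[gauss _ 0 n.+1]/(1 : F); ring.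
case: n e hg => [|n] e hg.
  have -> : low g = 0 by [].
  rewrite fmul0r (lin0 (lowF_lin N)) scaler0 add0r.
  rewrite (IH m 0%N _ g _ _ Dl gl h') ?gauss0 ?expr0 ?mulr1 ?lowFS //.
    by rewrite addSn in e; case: e.
  by rewrite -!lowFS.
have e1 : (m.+1 + n)%N = N by lia.
have e2 : (m + n.+1)%N = N by lia.
have hg' : lowFn n.+1 (low g) = 0 by rewrite -lowFS.
have hf' : lowFn m.+1 (low f) = 0 by rewrite -lowFS.
rewrite (IH m.+1 n f (low g) mu e1) // (IH m n.+1 _ g _ e2 Dl gl h') //.
rewrite -!lowFS scalerA -scalerDl gaussS; congr (_ *: _).
set A := gauss _ _ _; set B := gauss _ _ _; set x := q ^ _.
by rewrite exprMn !exprS; ring.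
Qed.

Lemma lowF_mul_over m n f g mu : LF f -> LF g -> pre f (uK' q i) = mu *: f ->
  lowFn m.+1 f = 0 -> lowFn n.+1 g = 0 -> lowFn (m + n).+1 (fmul f g) = 0.
Proof.
move=> fl gl h hf hg; rewrite -[LHS]/(low (lowFn (m + n) _)).
rewrite (lowF_mul erefl fl gl h hf hg) (linZ low_lin).
rewrite (low_mul (lowF_LF m fl) (lowF_LF n gl) (lowF_weight m fl h)).
rewrite -[low (lowFn n g)]/(lowFn n.+1 g) hg -[low (lowFn m f)]/(lowFn m.+1 f) hf.
by rewrite fmul0r fmul0l scaler0 addr0 scaler0.
Qed.

(** f' spans the image of f under the last nonzero power of the operator. *)
Record top (m : nat) (f f' : form) : Prop := Top {
  top_LF : LF f; top_LF' : LF f';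
  top_weight : exists mu, mu != 0 /\ pre f (uK' q i) = mu *: f;
  top_last : exists c, c != 0 /\ lowFn m f = c *: f';
  top_over : lowFn m.+1 f = 0 }.

(** Only one term of the Leibniz rule survives in degree m + n; its
    coefficient is a Gaussian binomial, nonzero since q is not a root of unity. *)
Lemma top_mul m n f g f' g' : top m f f' -> top n g g' ->
  top (m + n) (fmul f g) (fmul f' g').
Proof.
move=> [fl fl' [mu [mu0 wf]] [c [c0 ef]] of'] [gl gl' [nu [nu0 wg]] [d [d0 eg]] og].
split; try exact: fmul_LF q0 qq q2 _ _ _ _.
- exists (mu * nu); rewrite mulf_neq0 // (fmul_preK' q0 qq q2) // wf wg; split=> //.
  rewrite (linZ (fun c u v => fmul_linl c u v _)) (linZ (fun c => fmul_linr c _)).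
  by rewrite scalerA.
- exists (gauss (q ^ (-2)) m n * mu ^+ n * (c * d)); split.
    rewrite !mulf_neq0 ?expf_neq0 // gauss_neq0 // => k k0.
    apply/eqP; rewrite exprnP exprz_exp => /qpow_eq1.
    by lia.
  rewrite (lowF_mul erefl fl gl wf of' og) ef eg.
  rewrite (linZ (fun c u v => fmul_linl c u v _)) (linZ (fun c => fmul_linr c _)).
  by rewrite !scalerA.
- exact: lowF_mul_over wf of' og.
Qed.

Lemma top_eps : top 0 feps feps.
Proof.
have el := @feps_LF F q; split=> //.
- by exists 1; rewrite oner_neq0 scale1r feps_pre counitE scale1r.
- by exists 1; rewrite oner_neq0 scale1r.
- by rewrite -[LHS]/(pre feps (uF q i)) feps_pre counitE scale0r.
Qed.

Definition fpow (f : form) (n : nat) : form := iter n (fmul f) feps.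

Lemma top_pow m n f f' : top m f f' -> top (n * m) (fpow f n) (fpow f' n).
Proof.
move=> h; elim: n => [|n IH]; first exact: top_eps.
by rewrite mulSn; apply: top_mul.
Qed.

Lemma top_lowF_gt m n f f' : top m f f' -> (m < n)%N -> lowFn n f = 0.
Proof.
move=> h mn; rewrite -(subnK mn) /lowFn iterD -/(lowFn m.+1 f) (top_over h).
exact: lin0 (lowF_lin _).
Qed.
End Top.
End Nondegenerate.

Section Evaluation.
Local Open Scope classical_set_scope.
Variables (F : fieldType) (q : F).
Hypothesis q0 : q != 0.
Hypothesis qn1 : forall n, (0 < n)%N -> q ^+ n != 1.
Notation U := (Uq q).
Notation V := (V0 q).
Notation form := (V -> F^o).
Notation zeta := (@zeta F q).
Notation feps := (@feps F q).
Notation LF := (@LF F q).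
Notation psi := (@psi F q).
Let qq := qdiff_neq0 q0 qn1.
Let q2 := qsum_neq0 q0 qn1.
Let psilin := psi_lin q0 qq q2.
Notation z11 := (zeta (true, true)).
Notation z10 := (zeta (true, false)).
Notation z01 := (zeta (false, true)).
Notation z00 := (zeta (false, false)).

Definition fprod (f1 f2 f3 f4 : form) (n : exps) : form :=
  let: (n1, n2, n3, n4) := n in
  fmul (fmul (fmul (fpow f1 n1) (fpow f2 n2)) (fpow f3 n3)) (fpow f4 n4).
Definition fmon : exps -> form := fprod z11 z10 z01 z00.

Lemma fpow_LF f n : LF f -> LF (fpow f n).
Proof. by move=> fl; elim: n => [|n IH]; [exact: feps_LF|exact: (fmul_LF q0 qq q2)]. Qed.

Lemma Zalg_pow s n : Zalg (zU q s ^+ n).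
Proof.
have ZA := @Zalg_is F q; elim: n => [|n IH]; first exact: subalg1 ZA.
by rewrite exprS; apply: (subalgM ZA) => //; apply: Zalg_z.
Qed.
Lemma psi_pow s n : psi (zU q s ^+ n) = fpow (zeta s) n.
Proof.
elim: n => [|n IH]; first by rewrite expr0 psi1.
by rewrite exprS (psiM q0 qq q2 (Zalg_z s) (Zalg_pow s n)) IH psi_zE.
Qed.
Lemma Zalg_zmon n : Zalg (zmon q n).
Proof.
have ZM := subalgM (@Zalg_is F q).
case: n => [[[n1 n2] n3] n4]; rewrite /zmon /mon.
by apply: (ZM); [apply: (ZM); [apply: (ZM)|]|]; apply: Zalg_pow.
Qed.

Lemma psi_zmon n : psi (zmon q n) = fmon n.
Proof.
case: n => [[[n1 n2] n3] n4]; rewrite /zmon /mon.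
have P := Zalg_pow; have ZM := subalgM (@Zalg_is F q).
by rewrite !(psiM q0 qq q2) ?psi_pow //; do ?[apply: (ZM)] => //; apply: P.
Qed.
Lemma fmon_LF n : LF (fmon n).
Proof. by rewrite -psi_zmon; apply: (psi_LF q0 qq q2); apply: Zalg_zmon. Qed.

Lemma zeta_weight s j : pre (zeta s) (uK' q j) = (levi_table q (GK j) s).1 *: zeta s.
Proof. by rewrite -(fact_K q0 qq q2) (fact_zeta q0 qq q2 s (isT : levi (GK j))). Qed.

(** * The lowering operators on the degree one forms *)

Lemma fact_pre_F i f : LF f -> fact (uF q i) f = 0 -> pre f (uF q i) = 0.
Proof.
move=> fl h; rewrite (pre_F q0 qq q2) // h; apply/funext => v.
by rewrite /fact -[LHS]/(- (0 : F^o)) oppr0.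
Qed.

Lemma top0_form i f mu : LF f -> mu != 0 -> pre f (uK' q i) = mu *: f ->
  fact (uF q i) f = 0 -> top i 0 f f.
Proof.
move=> fl mu0 w h; split=> //.
- by exists mu.
- by exists 1; rewrite oner_neq0 scale1r.
- exact: fact_pre_F.
Qed.

Lemma top1_form i f f' mu nu c : LF f -> LF f' -> mu != 0 -> nu != 0 -> c != 0 ->
  pre f (uK' q i) = mu *: f -> pre f' (uK' q i) = nu *: f' ->
  fact (uF q i) f = c *: f' -> fact (uF q i) f' = 0 -> top i 1 f f'.
Proof.
move=> fl fl' mu0 nu0 c0 w w' h h'.
have e : pre f (uF q i) = (- (c * nu)) *: f'.
  rewrite (pre_F q0 qq q2) // h -[fact _ (c *: f')]/(c *: fact (uK q i) f') fact_K //.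
  by rewrite w' scalerA scaleNr.
split=> //.
- by exists mu.
- by exists (- (c * nu)); rewrite oppr_eq0 mulf_neq0.
- rewrite -[LHS]/(pre (pre f (uF q i)) (uF q i)) e preZf fact_pre_F //.
  exact: scaler0.
Qed.

Lemma levi_weight_neq0 s j : (levi_table q (GK j) s).1 != 0.
Proof. exact: expfz_neq0. Qed.

Lemma top_zeta_levi0 i s : i != node2 -> (levi_table q (GF i) s).1 = 0 ->
  top i 0 (zeta s) (zeta s).
Proof.
move=> hi h; apply: top0_form (zeta_LF q0 qq q2 s) (levi_weight_neq0 s i) (zeta_weight s i) _.
by rewrite (fact_zeta q0 qq q2 s (hi : levi (GF i))) h scale0r.
Qed.

Lemma top_zeta_levi1 i s t : i != node2 -> levi_table q (GF i) s = (1, t) ->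
  (levi_table q (GF i) t).1 = 0 -> top i 1 (zeta s) (zeta t).
Proof.
move=> hi h h'; apply: (top1_form (zeta_LF q0 qq q2 s) (zeta_LF q0 qq q2 t)
  (levi_weight_neq0 s i) (levi_weight_neq0 t i) (oner_neq0 F)
  (zeta_weight s i) (zeta_weight t i)).
  by rewrite (fact_zeta q0 qq q2 s (hi : levi (GF i))) h.
by rewrite (fact_zeta q0 qq q2 t (hi : levi (GF i))) h' scale0r.
Qed.

Lemma top_zeta2_0 s : s != (false, false) -> top node2 0 (zeta s) (zeta s).
Proof.
move=> h; apply: top0_form (zeta_LF q0 qq q2 s) (levi_weight_neq0 s _) (zeta_weight s _) _.
by rewrite fact_F2_zeta // (negPf h) scale0r.
Qed.
Lemma top_zeta2_1 : top node2 1 z00 feps.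
Proof.
have N1 : (-1 : F) != 0 by rewrite oppr_eq0 oner_neq0.
apply: (top1_form (zeta_LF q0 qq q2 _) (@feps_LF F q) (levi_weight_neq0 _ _)
  (oner_neq0 F) N1 (zeta_weight _ _)).
- by rewrite feps_pre counitE.
- by rewrite fact_F2_zeta // scale1r scaleN1r.
- by rewrite (fact_feps q0 qq q2 (GF node2)) scale0r.
Qed.

Lemma top_prod i m1 m2 m3 m4 f1 f2 f3 f4 g1 g2 g3 g4 (n : exps) :
  top i m1 f1 g1 -> top i m2 f2 g2 -> top i m3 f3 g3 -> top i m4 f4 g4 ->
  top i (let: (n1, n2, n3, n4) := n in n1 * m1 + n2 * m2 + n3 * m3 + n4 * m4)%N
    (fprod f1 f2 f3 f4 n) (fprod g1 g2 g3 g4 n).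
Proof.
case: n => [[[n1 n2] n3] n4] h1 h2 h3 h4.
have P := top_pow q0 qn1; have M := top_mul q0 qn1.
by apply: (M); [apply: (M); [apply: (M)|]|]; apply: P.
Qed.

(** The powers of the F_i which take the monomial with exponents n to a
    constant: F_2^n4 removes the factors zeta_00, then F_1 and F_3 turn all other
    factors into zeta_00, and F_2 removes these. *)
Definition lower (n : exps) (f : form) : form :=
  let: (n1, n2, n3, n4) := n in
  lowFn node2 (n1 + n2 + n3) (lowFn node3 (n1 + n3) (lowFn node1 (n1 + n2) (lowFn node2 n4 f))).
Definition ev n (f : form) : F := lower n f (v0 q).

Lemma lowerL n c f g : lower n (c *: f + g) = c *: lower n f + lower n g.
Proof. by case: n => [[[n1 n2] n3] n4]; rewrite /lower !lowF_lin. Qed.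
Lemma ev_lin n c f g : ev n (c *: f + g) = c * ev n f + ev n g.
Proof. by rewrite /ev lowerL. Qed.

(** Each of the four powers is the last nonzero one, so each step is governed
    by top_prod and gives a nonzero multiple of one monomial, at the end a power
    of the unit. *)
Lemma ev_diag n : ev n (fmon n) != 0.
Proof.
case: n => [[[n1 n2] n3] n4].
have t0 i := top_eps q i.
have T1 := top_prod (n1, n2, n3, n4) (top_zeta2_0 (isT : (true, true) != (false, false)))
  (top_zeta2_0 (isT : (true, false) != (false, false)))
  (top_zeta2_0 (isT : (false, true) != (false, false))) top_zeta2_1.
have T2 := top_prod (n1, n2, n3, n4)
  (@top_zeta_levi1 node1 (true, true) (false, true) isT erefl erefl)
  (@top_zeta_levi1 node1 (true, false) (false, false) isT erefl erefl)
  (@top_zeta_levi0 node1 (false, true) isT erefl) (t0 node1).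
have T3 := top_prod (n1, n2, n3, n4)
  (@top_zeta_levi1 node3 (false, true) (false, false) isT erefl erefl)
  (@top_zeta_levi0 node3 (false, false) isT erefl)
  (@top_zeta_levi1 node3 (false, true) (false, false) isT erefl erefl) (t0 node3).
have T4 := top_prod (n1, n2, n3, n4) top_zeta2_1 top_zeta2_1 top_zeta2_1 (t0 node2).
rewrite ?(muln0, muln1, addn0, add0n) in T1 T2 T3 T4.
have [c1 [c10 e1]] := top_last T1; have [c2 [c20 e2]] := top_last T2.
have [c3 [c30 e3]] := top_last T3; have [c4 [c40 e4]] := top_last T4.
rewrite /ev /lower /fmon e1 (linZ (lowF_lin _ _)) e2 !(linZ (lowF_lin _ _)) e3 !(linZ (lowF_lin _ _)) e4.
have el := @feps_LF F q.
have p0 n : fpow feps n (v0 q) = 1.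
  elim: n => [|n IH]; first exact: feps_v0.
  by rewrite /= (fmul_v0 q0 qq q2) // ?IH ?feps_v0 ?mulr1 //; apply: fpow_LF.
have L n := fpow_LF n el; have LM := fmul_LF q0 qq q2.
have -> : (c1 *: (c2 *: (c3 *: (c4 *: fprod feps feps feps feps (n1, n2, n3, n4))))) (v0 q)
  = c1 * (c2 * (c3 * (c4 * fprod feps feps feps feps (n1, n2, n3, n4) (v0 q)))) by [].
have v2 a b : fmul (fpow feps a) (fpow feps b) (v0 q) = 1.
  by rewrite (fmul_v0 q0 qq q2 (L a) (L b)) !p0 mulr1.
have -> : fprod feps feps feps feps (n1, n2, n3, n4) (v0 q) = 1.
  rewrite /fprod (fmul_v0 q0 qq q2 (LM _ _ (LM _ _ (L _) (L _)) (L _)) (L _)).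
  by rewrite (fmul_v0 q0 qq q2 (LM _ _ (L _) (L _)) (L _)) v2 !p0 !mulr1.
by rewrite mulr1 !mulf_neq0.
Qed.

(** The first step already gives 0: a monomial with fewer factors zeta_00 is
    killed by F_2^n4. *)
Lemma ev_low n n' : (n'.2 < n.2)%N -> ev n (fmon n') = 0.
Proof.
case: n => [[[n1 n2] n3] n4]; case: n' => [[[k1 k2] k3] k4] /= h.
have T1 := top_prod (k1, k2, k3, k4) (top_zeta2_0 (isT : (true, true) != (false, false)))
  (top_zeta2_0 (isT : (true, false) != (false, false)))
  (top_zeta2_0 (isT : (false, true) != (false, false))) top_zeta2_1.
rewrite ?(muln0, muln1, addn0, add0n) in T1.
by rewrite /ev /lower (top_lowF_gt T1 h) !(lin0 (lowF_lin _ _)).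
Qed.

Definition fweight (j : 'I_3) (n : exps) : int :=
  let: (n1, n2, n3, n4) := n in
  cartan j node1 * (n1 + n2)%:Z + cartan j node2 * (n1 + n2 + n3 + n4)%:Z
  + cartan j node3 * (n1 + n3)%:Z.

Lemma fpow_weight f e j n : LF f -> pre f (uK' q j) = q ^ e *: f ->
  pre (fpow f n) (uK' q j) = q ^ (e * n%:Z) *: fpow f n.
Proof.
move=> fl h; elim: n => [|n IH].
  by rewrite mulr0 expr0z scale1r /= feps_pre counitE scale1r.
have fnl := fpow_LF n fl.
rewrite /= (fmul_preK' q0 qq q2) // h IH.
rewrite (linZ (fun c u v => fmul_linl c u v _)) (linZ (fun c => fmul_linr c _)).
by rewrite scalerA -expfzDr // -[in RHS]addn1 PoszD mulrDr mulr1 addrC.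
Qed.
Lemma fmul_weight f g e e' j : LF f -> LF g -> pre f (uK' q j) = q ^ e *: f ->
  pre g (uK' q j) = q ^ e' *: g -> pre (fmul f g) (uK' q j) = q ^ (e + e') *: fmul f g.
Proof.
move=> fl gl hf hg; rewrite (fmul_preK' q0 qq q2) // hf hg.
rewrite (linZ (fun c u v => fmul_linl c u v _)) (linZ (fun c => fmul_linr c _)).
by rewrite scalerA -expfzDr.
Qed.

Lemma fmon_weight j n : pre (fmon n) (uK' q j) = q ^ fweight j n *: fmon n.
Proof.
case: n => [[[n1 n2] n3] n4]; rewrite /fmon /fprod.
have W s k := fpow_weight k (zeta_LF q0 qq q2 s) (zeta_weight s j).
have L s k := fpow_LF k (zeta_LF q0 qq q2 s); have LM := fmul_LF q0 qq q2.
have w12 := fmul_weight (L (true, true) n1) (L (true, false) n2) (W _ _) (W _ _).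
have l12 := LM _ _ (L (true, true) n1) (L (true, false) n2).
have w123 := fmul_weight l12 (L (false, true) n3) w12 (W _ _).
have l123 := LM _ _ l12 (L (false, true) n3).
rewrite (fmul_weight l123 (L (false, false) n4) w123 (W _ _)).
congr (q ^ _ *: _); rewrite /= ?(mulr1, mulr0, addr0).
by rewrite !PoszD; ring.
Qed.

Lemma lower_weight j n e f : LF f -> pre f (uK' q j) = q ^ e *: f ->
  pre (lower n f) (uK' q j) = q ^ (e - fweight j n) *: lower n f.
Proof.
case: n => [[[n1 n2] n3] n4] fl h; rewrite /lower.
have step i k g e' : LF g -> pre g (uK' q j) = q ^ e' *: g ->
    pre (lowFn i k g) (uK' q j) = q ^ (e' - cartan j i * k%:Z) *: lowFn i k g.
  move=> gl hg; rewrite (lowF_weight q0 i k gl hg) exprnP exprz_exp -expfzDr //.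
  by rewrite mulNr addrC.
have l1 := lowF_LF node2 n4 fl; have w1 := step node2 n4 _ _ fl h.
have l2 := lowF_LF node1 (n1 + n2) l1; have w2 := step node1 (n1 + n2)%N _ _ l1 w1.
have l3 := lowF_LF node3 (n1 + n3) l2; have w3 := step node3 (n1 + n3)%N _ _ l2 w2.
rewrite (step node2 (n1 + n2 + n3)%N _ _ l3 w3).
by congr (q ^ _ *: _); rewrite /fweight !PoszD; ring.
Qed.

(** The generator has weight 0, so a weight form is nonzero there only if its
    weight is 0: the lowering operators must remove exactly the weight of the
    monomial. *)
Lemma ev_weight n n' : ev n (fmon n') != 0 -> forall j, fweight j n' = fweight j n.
Proof.
move=> h j; have fl := fmon_LF n'.
have := lower_weight n fl (fmon_weight j n').
move=> /(congr1 (fun f : form => f (v0 q))); rewrite /pre v0_K'.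
rewrite -[RHS]/(_ * ev n (fmon n')) -[LHS]/(ev n (fmon n')) => e.
have e1 : q ^ (fweight j n' - fweight j n) = 1.
  by apply: (mulIf h); rewrite mul1r -e.
by apply/eqP; rewrite -subr_eq0 (qpow_eq1 qn1 e1).
Qed.

(** The weight fixes n1 + n2, n1 + n3 and the total degree, so only n4 is
    free. *)
Lemma fweight_inj n n' : (forall j, fweight j n' = fweight j n) -> n'.2 = n.2 -> n' = n.
Proof.
case: n => [[[n1 n2] n3] n4]; case: n' => [[[k1 k2] k3] k4] h /= e4; subst k4.
have := h node1; have := h node2; have := h node3; rewrite /fweight /cartan /= => h1 h2 h3; clear -h1 h2 h3.
have e1 : k1 = n1 by lia.
have e2 : k2 = n2 by lia.
have e3 : k3 = n3 by lia.
by rewrite e1 e2 e3.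
Qed.

(** The evaluations form a triangular matrix with nonzero diagonal: by ev_low
    and ev_weight the value of the n-th evaluation on another monomial m can be
    nonzero only if m has the last exponent larger. The induction starts from
    the largest last exponent. *)
Lemma fmon_free (t : seq exps) (k : exps -> F) : uniq t ->
  \sum_(n <- t) k n *: fmon n = 0 -> forall n, n \in t -> k n = 0.
Proof.
move=> ut h0; pose M := foldr maxn 0%N [seq n.2 | n <- t].
have leM n : n \in t -> (n.2 <= M)%N.
  rewrite /M; elim: (t) => [//|m s IH]; rewrite inE => /orP[/eqP->|/IH] /=.
    exact: leq_maxl.
  by move=> /leq_trans; apply; apply: leq_maxr.
suff H : forall e n, n \in t -> (M - n.2 < e)%N -> k n = 0.
  by move=> n nt; apply: (H (M - n.2).+1).
elim=> [//|e IH] n nt lt; have := congr1 (ev n) h0.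
have evS s : ev n (\sum_(m <- s) k m *: fmon m) = \sum_(m <- s) k m * ev n (fmon m).
  elim: s => [|m s IHs]; last by rewrite !big_cons ev_lin IHs.
  rewrite !big_nil; have := ev_lin n (-1) 0 0; rewrite scaler0 addr0 mulN1r addNr.
  by [].
rewrite evS.
have -> : ev n 0 = 0.
  by have := ev_lin n (-1) 0 0; rewrite scaler0 addr0 mulN1r addNr.
rewrite (bigD1_seq n) //= big_seq_cond big1 ?addr0 => [/eqP|m /andP[mt mn]].
  by rewrite mulf_eq0 (negPf (ev_diag n)) orbF => /eqP.
have [lmn|] := ltnP m.2 n.2; first by rewrite ev_low // mulr0.
rewrite leq_eqVlt => /orP[/eqP e2|lnm]; last first.
  by rewrite (IH m mt) ?mul0r //; have := leM m mt; lia.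
have [->|hev] := eqVneq (ev n (fmon m)) 0; first by rewrite mulr0.
by case/eqP: mn; apply: fweight_inj (ev_weight hev) _.
Qed.

End Evaluation.

(** * The isomorphism *)

Section Iso.
Local Open Scope classical_set_scope.
Variables (F : fieldType) (q : F).
Hypothesis q0 : q != 0.
Hypothesis qn1 : forall n, (0 < n)%N -> q ^+ n != 1.
Notation U := (Uq q).
Notation V := (V0 q).
Notation form := (V -> F^o).
Notation LF := (@LF F q).
Notation psi := (@psi F q).
Notation fmon := (@fmon F q).
Notation V0_deg := (@V0_deg F q).
Notation Cg_set := (@Cg_set F q).
Let qq := qdiff_neq0 q0 qn1.
Let q2 := qsum_neq0 q0 qn1.
Let psilin := psi_lin q0 qq q2.
Let om := omega_hom q0 qq q2.

Lemma ad_K_pow i (x : U) e n : ad (uK q i) x = q ^ e *: x ->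
  ad (uK q i) (x ^+ n) = q ^ (e * n%:Z) *: x ^+ n.
Proof.
move=> h; elim: n => [|n IH].
  by rewrite expr0 (ad_one q0 qq q2 (isT : levi (GK i))) mulr0 expr0z.
rewrite exprS ad_K_mul // h IH -scalerAl -scalerAr scalerA -expfzDr //.
by rewrite -[in RHS]addn1 PoszD mulrDr mulr1 addrC.
Qed.
Lemma ad_K_weightM i (x y : U) e e' : ad (uK q i) x = q ^ e *: x ->
  ad (uK q i) y = q ^ e' *: y -> ad (uK q i) (x * y) = q ^ (e + e') *: (x * y).
Proof. by move=> hx hy; rewrite ad_K_mul // hx hy -scalerAl -scalerAr scalerA -expfzDr. Qed.

Lemma zmon_weight i n : ad (uK q i) (zmon q n) = q ^ fweight i n *: zmon q n.
Proof.
case: n => [[[n1 n2] n3] n4]; rewrite /zmon /mon.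
have W s k := ad_K_pow k (ad_zU q0 qq q2 s (isT : levi (GK i))).
rewrite (ad_K_weightM (ad_K_weightM (ad_K_weightM (W _ _) (W _ _)) (W _ _)) (W _ _)).
by congr (q ^ _ *: _); rewrite /fweight !PoszD /= ?(mulr1, mulr0, addr0); ring.
Qed.

(** The transfer of the monomials to V(0) by the Chevalley involution. *)
Definition vmon (n : exps) : V := V0act (omega (zmon q n)) (v0 q).

Lemma vmon_weight n i : V0act (uK q i) (vmon n) = q ^ (- fweight i n) *: vmon n.
Proof.
have h := zmon_weight i n; rewrite ad_K // in h.
have e : uK q i * zmon q n = q ^ fweight i n *: (zmon q n * uK q i).
  by rewrite scalerAl -h -!mulrA uK'K mulr1.
have e' := inv_qcomm (uKK' q i) (uK'K q i) (expfz_neq0 _ q0) e.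
rewrite /vmon -V0actM.
have -> : uK q i * omega (zmon q n) = omega (uK' q i * zmon q n).
  by rewrite (homM om) omegaE.
rewrite e' (homZ om) (homM om) V0actZl V0actM [omega (uK' q i)]omegaE //=.
by rewrite v0_K invr_expz.
Qed.

Definition deg (n : exps) : nat := let: (n1, n2, n3, n4) := n in n1 + n2 + n3 + n4.

Lemma fweight_deg n :
  fweight node1 n + 2 * fweight node2 n + fweight node3 n = 2 * (deg n)%:Z.
Proof. by case: n => [[[n1 n2] n3] n4]; rewrite /fweight /deg /cartan /=; lia. Qed.

Lemma vmon_deg n : V0_deg (- (deg n)%:Z) (vmon n).
Proof.
exists [:: vmon n]; first by rewrite big_seq1.
move=> w; rewrite inE => /eqP->; exists (fun i => - fweight i n).
  by have := fweight_deg n; lia.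
by move=> i; apply: vmon_weight.
Qed.

(** F_1 and F_3 kill the generator, so omega(E_i y) v0 = omega(ad E_i (y)) v0
    for i = 1, 3; hence Z can be used in place of U+. *)
Lemma V0_Zalg v : exists y, Zalg y /\ v = V0act (omega y) (v0 q).
Proof.
have ZA := @Zalg_is F q.
have L0 : omega (0 : U) = 0 := hom0 om.
elim: (Fspan_all q0 v) => [w||c u u' _ [y [Zy ->]] _ [y' [Zy' ->]]]; last 2 first.
- exists 0; split; first exact: subalg0 ZA.
  by rewrite L0 -(scale0r (1 : U)) V0actZl scale0r.
- exists (c *: y + y'); split; first exact: (subalgL ZA).
  by rewrite (homD om) (homZ om) V0act_linl.
elim: w => [|i w [y [Zy e]]].
  by exists 1; split; [exact: subalg1 ZA|rewrite (hom1 om) V0act1].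
have -> : Fword q (i :: w) = V0act (omega (uE q i * y)) (v0 q).
  by rewrite (homM om) omegaE // V0actM -e.
have [i2|i2] := eqVneq i node2.
  exists (uE q i * y); split=> //; apply: (subalgM ZA) => //.
  by rewrite i2; apply: (Zalg_z (false, false)).
exists (ad (uE q i) y); split; first exact: (Zalg_ad_gen q0 qq q2 (i2 : levi (GE i))).
have -> : uE q i * y = ad (uE q i) y + ad (uK q i) y * uE q i.
  by rewrite ad_E // ad_K // subrK.
rewrite (homD om) (homM om) V0actDl V0actM [omega (uE q i)]omegaE //=.
by rewrite v0_F // V0act0 addr0.
Qed.

Lemma form_ext_mon f g : LF f -> LF g -> (forall n, f (vmon n) = g (vmon n)) -> f = g.
Proof.
move=> fl gl h; apply/funext => v; have [y [Zy ->]] := V0_Zalg v.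
have [s ->] := Zalg_span q0 qq q2 Zy.
elim: s => [|p s IH].
  rewrite big_nil (hom0 om) -(scale0r (1 : U)) V0actZl scale0r.
  by rewrite (lin0 fl) (lin0 gl).
rewrite big_cons (homD om) (homZ om) V0act_linl fl gl IH; congr (_ *: _ + _).
exact: h.
Qed.

Lemma Cg_setL c f g : Cg_set f -> Cg_set g -> Cg_set (c *: f + g).
Proof.
move=> [fl [N hN]] [gl [M hM]]; split; first exact: LF_lin.
exists (maxn N M) => k; rewrite gtn_max => /andP[Nk Mk] v hv.
by rewrite -[LHS]/(c *: f v + g v) (hN k) // (hM k) // scaler0 addr0.
Qed.

(** A form of weight mu vanishes on vectors of weight other than - mu, and the
    grading is a function of the weight. *)
Lemma fmon_deg n k v : k != deg n -> V0_deg (- k%:Z) v -> fmon n v = 0.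
Proof.
move=> kn [s -> hs]; have fl := fmon_LF q0 qn1 n.
have f0 := lin0 fl; rewrite big_seq; elim/big_rec: _ => [//|w u ws hu].
rewrite (linD fl) hu addr0; have [m em mw] := hs w ws.
apply/eqP/negPn/negP => fw; case/eqP: kn.
have e i : m i = - fweight i n.
  have := congr1 (fun f : form => f w) (fmon_weight q0 qn1 i n).
  have -> : pre (fmon n) (uK' q i) w = q ^ (- m i) *: fmon n w.
    rewrite /pre -(linZ fl); congr (fmon n _).
    have mw' : V0act (uK q i) w = q ^ m i *: w := mw i.
    have := congr1 (V0act (uK' q i)) mw'.
    rewrite -V0actM uK'K V0act1 V0actZ => h.
    by rewrite {2}h scalerA -expfzDr // addNr expr0z scale1r.
  rewrite -[RHS]/(_ *: fmon n w) => /(mulIf fw)/(qpow_inj q0 qn1) => <-.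
  by rewrite opprK.
by have := fweight_deg n; rewrite !e in em; lia.
Qed.

Lemma fmon_Cg n : Cg_set (fmon n).
Proof.
split; first exact: fmon_LF.
exists (deg n) => k nk v; apply: fmon_deg.
by rewrite gtn_eqF.
Qed.

Lemma psi_sum s : psi (\sum_(p <- s) p.1 *: zmon q p.2) = \sum_(p <- s) p.1 *: fmon p.2.
Proof.
elim: s => [|p s IH]; first by rewrite !big_nil; apply: lin0 psilin.
by rewrite !big_cons psilin IH psi_zmon.
Qed.

Lemma psi_Cg x : Zalg x -> Cg_set (psi x).
Proof.
move=> /(Zalg_span q0 qq q2)[s ->]; rewrite psi_sum.
elim: s => [|p s IH]; last by rewrite big_cons; apply: Cg_setL => //; apply: fmon_Cg.
rewrite big_nil; split; first exact: LF0.
by exists 0%N.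
Qed.

Lemma psi_inj x : Zalg x -> psi x = 0 -> x = 0.
Proof.
move=> /(Zalg_span q0 qq q2)/mon_span_uniq[t [k [ut ->]]] h.
have h' : \sum_(n <- t) k n *: fmon n = 0.
  rewrite -[RHS]h {h ut}; elim: t => [|m s IH]; first by rewrite !big_nil (lin0 psilin).
  by rewrite !big_cons psilin IH -[mon _ _ _ _ m]/(zmon q m) psi_zmon.
rewrite big_seq big1 // => n nt.
by rewrite (fmon_free q0 qn1 ut h' nt) scale0r.
Qed.

(** Only the monomials of degree at most N matter. Their vectors vmon span the
    part of V(0) on which f may be nonzero, and the matrix of the values of the
    forms fmon on them is square with independent rows, hence invertible: f is the
    combination with the values prescribed. *)
Lemma psi_surj f : Cg_set f -> exists x, Zalg x /\ psi x = f.
Proof.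
move=> [fl [N hN]].
pose I := iota 0 N.+1.
pose box : seq exps := allpairs pair (allpairs pair (allpairs pair I I) I) I.
pose t := [seq n <- box | (deg n <= N)%N].
have ut : uniq t.
  have pI (S T : Type) : injective (fun p : S * T => (p.1, p.2)) by case=> a b [a' b'] /= [-> ->].
  apply: filter_uniq; do !apply: allpairs_uniq; rewrite ?iota_uniq // => -[a b] [a' b'] //=.
have tN n : (deg n <= N)%N = (n \in t).
  rewrite mem_filter; have [dn|//] := boolP (deg n <= N)%N; symmetry.
  case: n dn => [[[a b] c] d]; rewrite /deg => dn.
  have mI k : (k <= N)%N -> k \in I by move=> kN; rewrite mem_iota.
  by do !apply: allpairs_f; apply: mI; lia.
pose n0 : exps := (0, 0, 0, 0)%N.
pose e (i : 'I_(size t)) := nth n0 t i.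
have et i : e i \in t by apply: mem_nth.
have eN i : (deg (e i) <= N)%N by rewrite tN.
pose A : 'M[F]_(size t) := \matrix_(i, j) fmon (e i) (vmon (e j)).
pose comb (u : 'rV[F]_(size t)) : form := \sum_i u ord0 i *: fmon (e i).
have combE u v : comb u v = \sum_i u ord0 i * fmon (e i) v.
  rewrite /comb; elim: (index_enum _) => [|i s IH]; first by rewrite !big_nil.
  by rewrite !big_cons -IH.
have combL u : LF (comb u).
  rewrite /comb; elim/big_rec: _ => [|i f' _ lf']; first exact: LF0.
  by apply: LF_lin => //; apply: fmon_LF.
have comb_in u j : comb u (vmon (e j)) = (u *m A) ord0 j.
  by rewrite combE mxE; apply: eq_bigr => i _; rewrite mxE.
have comb_out u n : n \notin t -> comb u (vmon n) = 0.
  rewrite -tN -ltnNge => hn; rewrite combE big1 // => i _.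
  rewrite (fmon_deg _ (vmon_deg n)) ?mulr0 //.
  by rewrite gtn_eqF // (leq_ltn_trans (eN i)).
have in_e n : n \in t -> exists j, n = e j.
  move=> nt; have it : (index n t < size t)%N by rewrite index_mem.
  by exists (Ordinal it); rewrite /e /= nth_index.
have Afree : A \in unitmx.
  rewrite -row_free_unit; apply: inj_row_free => u uA.
  have c0 : comb u = 0.
    apply: form_ext_mon => // [|n]; first exact: LF0.
    have [/in_e[j ->]|/comb_out->//] := boolP (n \in t).
    by rewrite comb_in uA mxE.
  pose k n := if insub (index n t) is Some i then u ord0 i else 0.
  have ke i : k (e i) = u ord0 i.
    rewrite /k /e index_uniq // insubT //= => h.
    by congr (u _ _); apply: val_inj.
  apply/rowP => i; rewrite mxE -ke.
  apply: (fmon_free q0 qn1 ut _ (et i)).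
  rewrite -[RHS]c0 /comb (big_nth n0) big_mkord.
  by apply: eq_bigr => j _; rewrite -ke.
pose u : 'rV[F]_(size t) := (\row_j (f (vmon (e j)) : F)) *m invmx A.
pose y : U := \sum_i u ord0 i *: zmon q (e i).
exists y; split.
  have ZA := @Zalg_is F q; rewrite /y; elim/big_rec: _ => [|i x _ Zx]; first exact: subalg0 ZA.
  by apply: (subalgL ZA) => //; apply: Zalg_zmon.
have -> : psi y = comb u.
  rewrite /comb /y; elim/big_rec2: _ => [|i g x _ <-]; first exact: lin0 psilin.
  by rewrite psilin psi_zmon.
apply: form_ext_mon => // n; have [/in_e[j ->]|nt] := boolP (n \in t).
  by rewrite comb_in /u mulmxKV // mxE.
rewrite comb_out // (hN (deg n)) //; last exact: vmon_deg.
by rewrite ltnNge tN.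
Qed.

(** The inverse of psi on the generated algebra. *)
Lemma CgI_Cg : U0_modalg_iso (Cg q) (CgI q).
Proof.
have ZA := @Zalg_is F q.
have inj x y : Zalg x -> Zalg y -> psi x = psi y -> x = y.
  move=> Zx Zy h; apply/eqP; rewrite -subr_eq0; apply/eqP/psi_inj.
    exact: (subalgB ZA).
  by rewrite (linB psilin) h subrr.
have SE := CgI_setE q0 qq q2.
pose phi (f : form) : U := xget 0 [set x | Zalg x /\ psi x = f].
have phiP f : Cg_set f -> Zalg (phi f) /\ psi (phi f) = f.
  by move=> /psi_surj[x hx]; apply: (@xgetPex _ 0 [set x | Zalg x /\ psi x = f]); exists x.
have phiE f x : Zalg x -> psi x = f -> phi f = x.
  move=> Zx <-; have [Z e] := phiP _ (psi_Cg Zx); exact: inj.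
exists phi; rewrite [ma_set (m := CgI q)]SE; split.
- split=> [f /phiP[]//|f g|x Zx] /=.
    by rewrite !inE => /phiP[_ ef] /phiP[_ eg] e; rewrite -ef -eg e.
  by exists (psi x); [exact: psi_Cg|exact: phiE].
- move=> c f g /phiP[Zf ef] /phiP[Zg eg]; apply: phiE; first exact: (subalgL ZA).
  by rewrite psilin ef eg.
- by apply: phiE; [exact: subalg1 ZA|exact: psi1].
- move=> f g /phiP[Zf ef] /phiP[Zg eg]; apply: phiE; first exact: (subalgM ZA).
  by rewrite (psiM q0 qq q2) // ef eg.
- move=> xi f hxi /phiP[Zf ef]; apply: phiE; first exact: (Zalg_ad q0 qq q2).
  by rewrite (psi_ad q0 qq q2) // ef.
Qed.
End Iso.

(** * The ground field and the theorem *)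

Lemma subf_div (K : fieldType) (a b c d : K) :
  b != 0 -> d != 0 -> a / b - c / d = (a * d - c * b) / (b * d).
Proof. by move=> b0 d0; field; rewrite b0 d0. Qed.

Section GroundField.
Variable R : realType.
Local Notation C := R[i].
Local Notation K := (ground R).
Local Notation x4 := (q4 R).
Local Notation bp := (@bar_poly R).

Lemma q4_neq0 : x4 != 0.
Proof. by rewrite tofrac_eq0 polyX_eq0. Qed.

Lemma qg_neq0 : qg R != 0.
Proof. by rewrite expf_neq0 ?q4_neq0. Qed.

Lemma qg_not_root_of_unity n : (0 < n)%N -> qg R ^+ n != 1.
Proof.
move=> n0; rewrite /qg /q4 -exprM -rmorphXn -[1](rmorph1 (@tofrac _)) tofrac_eq.
apply/eqP => /(congr1 (fun p : {poly C} => size p)).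
by rewrite size_polyXn size_poly1; lia.
Qed.

Definition bar_coef : {rmorphism C -> K} := (@tofrac {poly C} \o polyC \o conjc)%FUN.

(** The formula for the bar involution is the evaluation at q^{-1/4} of the
    polynomial with conjugate coefficients, hence a ring morphism. *)
Lemma bar_polyE p : bp p = (map_poly bar_coef p).[x4^-1].
Proof.
rewrite (@horner_coef_wide _ (size p)) ?size_poly // /bar_poly.
by apply: eq_bigr => i _; rewrite coef_map /= exprVn.
Qed.

Lemma bar_polyB p r : bp (p - r) = bp p - bp r.
Proof. by rewrite !bar_polyE rmorphB hornerD hornerN. Qed.
Lemma bar_polyM p r : bp (p * r) = bp p * bp r.
Proof. by rewrite !bar_polyE rmorphM hornerM. Qed.
Lemma bar_poly1 : bp 1 = 1.
Proof. by rewrite bar_polyE rmorph1 hornerC. Qed.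
Lemma bar_polyX : bp 'X = x4^-1.
Proof. by rewrite bar_polyE map_polyX hornerX. Qed.

(** Multiplied by the power of q^{1/4} equal to the degree of p, the value is
    the reversed polynomial, whose constant coefficient is the conjugate of the
    leading coefficient of p. *)
Lemma bar_poly_eq0 p : (bp p == 0) = (p == 0).
Proof.
apply/idP/idP => [/eqP h|/eqP->]; last by rewrite bar_polyE rmorph0 horner0.
apply/negPn/negP => p0.
have sp : (0 < size p)%N by rewrite size_poly_gt0.
pose r : {poly C} := \poly_(j < size p) conjc p`_((size p).-1 - j).
have e : bp p * x4 ^+ (size p).-1 = tofrac r.
  rewrite /bar_poly mulr_suml /r poly_def (reindex_inj rev_ord_inj) rmorph_sum /=.
  apply: eq_bigr => i _; have hi := ltn_ord i.
  have -> : (size p - i.+1 = (size p).-1 - i)%N by rewrite -subn1 -subnDA add1n.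
  rewrite -mul_polyC rmorphM rmorphXn /= -/x4 -mulrA; congr (_ * _).
  have -> : ((size p).-1 = ((size p).-1 - i) + i)%N.
    by rewrite subnK // -ltnS prednK.
  by rewrite [in X in _ * X = _]exprD addnK mulKf // expf_neq0 ?q4_neq0.
move: e; rewrite h mul0r => /esym/eqP; rewrite tofrac_eq0 => /eqP/(congr1 (fun s : {poly C} => s`_0)).
rewrite coef_poly sp coef0 subn0 => /eqP.
by rewrite fmorph_eq0 -/(lead_coef p) lead_coef_eq0 (negPf p0).
Qed.

Lemma ground_frac (x : K) :
  x = tofrac \n_(repr (x : {fraction {poly C}})) / tofrac \d_(repr (x : {fraction {poly C}})).
Proof.
set r := repr _; have d0 : tofrac \d_r != 0 by rewrite tofrac_eq0 denom_ratioP.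
apply: (canRL (mulfK d0)); rewrite -{1}[x](reprK (x : {fraction {poly C}})) -/r.
unlock tofrac; rewrite -[LHS]FracField.pi_mul; apply/eqmodP => /=.
rewrite /FracField.equivf /FracField.mulf /= !numden_Ratio ?mulr1 ?oner_neq0 ?denom_ratioP //.
by rewrite mulrC.
Qed.

(** The quotient does not depend on the representative because bar_poly is
    multiplicative and nonzero on nonzero polynomials. *)
Lemma ground_barE n d : d != 0 -> ground_bar (tofrac n / tofrac d : K) = bp n / bp d.
Proof.
move=> d0; have := ground_frac (tofrac n / tofrac d).
rewrite /ground_bar /=; set r := repr _; have r0 := denom_ratioP r.
move/eqP; rewrite eqr_div ?tofrac_eq0 // -!rmorphM tofrac_eq => /eqP e.
by apply/eqP; rewrite eqr_div ?bar_poly_eq0 // -!bar_polyM e.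
Qed.

Lemma ground_ind (P : K -> Prop) :
  (forall n d : {poly C}, d != 0 -> P (tofrac n / tofrac d)) -> forall x, P x.
Proof. by move=> h x; rewrite [x]ground_frac; apply: h; apply: denom_ratioP. Qed.

Lemma ground_bar_zmod : zmod_morphism (@ground_bar R).
Proof.
move=> x y; elim/ground_ind: x => n d d0; elim/ground_ind: y => n' d' d0'.
have [t t'] : tofrac d != 0 /\ tofrac d' != 0 by rewrite !tofrac_eq0.
have [b b'] : bp d != 0 /\ bp d' != 0 by rewrite !bar_poly_eq0.
rewrite (subf_div _ _ t t') -!rmorphM -rmorphB.
rewrite !ground_barE ?mulf_neq0 // bar_polyB !bar_polyM.
by rewrite [RHS](subf_div _ _ b b').
Qed.

Lemma ground_bar_monoid : monoid_morphism (@ground_bar R).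
Proof.
split=> [|x y].
  have := @ground_barE 1 1 (oner_neq0 _); rewrite rmorph1 bar_poly1 !divr1; exact.
elim/ground_ind: x => n d d0; elim/ground_ind: y => n' d' d0'.
have -> : tofrac n / tofrac d * (tofrac n' / tofrac d') = tofrac (n * n') / tofrac (d * d') :> K.
  by rewrite !rmorphM mulf_div.
by rewrite !ground_barE ?mulf_neq0 // !bar_polyM mulf_div.
Qed.

HB.instance Definition _ :=
  GRing.isZmodMorphism.Build K K (@ground_bar R) ground_bar_zmod.
HB.instance Definition _ :=
  GRing.isMonoidMorphism.Build K K (@ground_bar R) ground_bar_monoid.

Lemma ground_bar_qg : ground_bar (qg R) = (qg R)^-1.
Proof.
rewrite /qg rmorphXn -exprVn /=; congr (_ ^+ _).
have := @ground_barE 'X 1 (oner_neq0 _); rewrite rmorph1 bar_poly1 !divr1 bar_polyX; exact.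
Qed.
End GroundField.

Lemma U0_modalg_iso_refl (F : fieldType) (q : F) (A : modalg q) : U0_modalg_iso A A.
Proof. by exists id; split=> //; split=> // x; exists x. Qed.

Theorem mainTheorem7 (R : realType) :
  let A := Cg (qg R) in
  let AI := CgI (qg R) in
  let AII := CgII (qg R) (@ground_bar R) in
  [/\ U0_modalg_iso A AI, U0_modalg_iso AI AII & U0_modalg_iso A AII].
Proof.
have q0 := qg_neq0 R; have qn1 := @qg_not_root_of_unity R.
have e : CgI (qg R) = CgII (qg R) (@ground_bar R).
  exact: (CgI_CgII q0 (qdiff_neq0 q0 qn1) (qsum_neq0 q0 qn1) (ground_bar_qg R)).
by rewrite /= -e; split; [exact: CgI_Cg|exact: U0_modalg_iso_refl|exact: CgI_Cg].
Qed.
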